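(* $\mathsf{RCA}_0\vdash\mathsf{MLR}\to\mathsf{BR}$. Thus $\mathsf{MLR}$ and $\mathsf{BR}$ are equivalent over $\mathsf{RCA}_0$.
   Context: $\mathsf{RCA}_0$ is the theory in the language of second-order arithmetic with axioms: the basic axioms $\mathsf{PA}^-$ of Peano arithmetic (the natural numbers form a discretely ordered commutative semiring with $1$); the $\Sigma^0_1$ induction scheme, i.e. the universal closures of $(\varphi(0)\wedge\forall n(\varphi(n)\to\varphi(n+1)))\to\forall n\,\varphi(n)$ for $\varphi$ a $\Sigma^0_1$ formula; and the $\Delta^0_1$ comprehension scheme, i.e. the universal closures of $\forall n(\varphi(n)\leftrightarrow\psi(n))\to\exists X\forall n(n\in X\leftrightarrow\varphi(n))$ for $\varphi$ a $\Sigma^0_1$ and $\psi$ a $\Pi^0_1$ formula with $X$ not free in $\varphi$. Set parameters are allowed in formulas. All definitions below are made inside $\mathsf{RCA}_0$. $\mathbb{N}$ is the (possibly nonstandard) first-order part. Finite strings, finite sets and rationals are coded as usual; $(\Phi_e)_{e\in\mathbb{N}}$ is an effective sequence of all Turing functionals; $\leq_{\mathrm T}$ is Turing reducibility. $2^{<\mathbb{N}}$ is the set of finite binary strings, $|\sigma|$ is the length of $\sigma$. For a set $B$ of strings, $X\in[B]$ means some $\sigma\in B$ is an initial segment of $X$. Open sets: A code for a $\mathbf{\Sigma^0_1}$ (open) set $\mathcal U$ is a sequence $(B_i)_{i\in\mathbb{N}}$ of coded finite subsets of $2^{<\mathbb{N}}$; it codes a $\Sigma^{0,Z}_1$ set if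 $(B_i)_{i\in\mathbb{N}}\leq_{\mathrm T}Z$; a uniform sequence of $\Sigma^{0,Z}_1$ sets is coded by a double sequence $(B_{n,i})_{n,i\in\mathbb{N}}\leq_{\mathrm T}Z$. $X\in\mathcal U$ means $\exists i\,(X\in[B_i])$. For finite $B\subseteq 2^{<\mathbb{N}}$, $\mu(B)=\sum_{\sigma\in\widehat B}2^{-|\sigma|}$, where $\widehat B$ is the set of $\sigma\in B$ with no proper initial segment in $B$; $\mu(\mathcal U)\leq r$ means $\forall m\,(\mu(\bigcup_{i\leq m}B_i)\leq r)$. $1$-randomness: A Martin-Löf test relative to $Z$ is a uniform sequence $(\mathcal U_n)_{n\in\mathbb{N}}$ of $\Sigma^{0,Z}_1$ sets with $\forall n\,(\mu(\mathcal U_n)\leq 2^{-n})$. $X$ is $1$-random relative to $Z$ if $X\notin\bigcap_n\mathcal U_n$ for every such test. $\mathsf{MLR}$ is the statement ''for every $Z$ there is an $X$ that is $1$-random relative to $Z$.'' Balanced randomness: For $h\colon\mathbb{N}\to\mathbb{N}$, a (coded) $h$-r.e. function is a function $g\colon\mathbb{N}\times\mathbb{N}\to\mathbb{N}$ such that $|\{s:g(n,s)\neq g(n,s+1)\}|\leq h(n)$ for every $n$. For $h\leq_{\mathrm T}Z$, a code for an $h$-Demuth test relative to $Z$ is a coded $h$-r.e. function $g\leq_{\mathrm T}Z$ such that, for all $n$, $e_n=\lim_s g(n,s)$ is an index for which $\Phi^Z_{e_n}$ computes a code for a $\Sigma^{0,Z}_1$ set $\mathcal U_n$ with $\mu(\mathcal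 U_n)\leq 2^{-n}$. $X$ weakly passes this test if there is an $n$ with $X\notin\mathcal U_n$. $X$ is balanced random relative to $Z$ if, for every $c\in\mathbb{N}$, $X$ weakly passes every $c2^n$-Demuth test relative to $Z$ (i.e. with $h(n)=c2^n$). $\mathsf{BR}$ is the statement ''for every $Z$ there is an $X$ that is balanced random relative to $Z$.'' *)

(* Defs.v *)
From Stdlib Require Import List.
Import ListNotations.

(** Two-sorted de Bruijn syntax: number variables and set variables are
    indexed independently.  Equality of sets is not primitive. *)

Inductive term : Type :=
| tVar : nat -> term
| tZero : term
| tOne : term
| tAdd : term -> term -> term
| tMul : term -> term -> term.

Inductive form : Type :=
| fBot : form
| fEq : term -> term -> form
| fLt : term -> term -> form
| fMem : term -> nat -> form
| fImp : form -> form -> form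
| fAnd : form -> form -> form
| fOr : form -> form -> form
| fAllN : form -> form
| fExN : form -> form
| fAllS : form -> form
| fExS : form -> form.

Definition fNot (p : form) : form := fImp p fBot.
Definition fIff (p q : form) : form := fAnd (fImp p q) (fImp q p).

Fixpoint subst_term (s : nat -> term) (t : term) : term :=
  match t with
  | tVar n => s n
  | tZero => tZero
  | tOne => tOne
  | tAdd a b => tAdd (subst_term s a) (subst_term s b)
  | tMul a b => tMul (subst_term s a) (subst_term s b)
  end.

Definition shift_term : term -> term := subst_term (fun n => tVar (S n)).

Definition upN (s : nat -> term) (n : nat) : term :=
  match n with O => tVar 0 | S k => shift_term (s k) end.
Definition upS (r : nat -> nat) (n : nat) : nat :=
  match n with O => O | S k => S (r k) end.

(** Simultaneous substitution of terms for number variables and of set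
    variables for set variables. *)
Fixpoint subst_form (s : nat -> term) (r : nat -> nat) (p : form) : form :=
  match p with
  | fBot => fBot
  | fEq a b => fEq (subst_term s a) (subst_term s b)
  | fLt a b => fLt (subst_term s a) (subst_term s b)
  | fMem a X => fMem (subst_term s a) (r X)
  | fImp p q => fImp (subst_form s r p) (subst_form s r q)
  | fAnd p q => fAnd (subst_form s r p) (subst_form s r q)
  | fOr p q => fOr (subst_form s r p) (subst_form s r q)
  | fAllN p => fAllN (subst_form (upN s) r p)
  | fExN p => fExN (subst_form (upN s) r p)
  | fAllS p => fAllS (subst_form s (upS r) p)
  | fExS p => fExS (subst_form s (upS r) p)
  end.

Definition shiftN : form -> form := subst_form (fun n => tVar (S n)) (fun X => X).
Definition shiftS : form -> form := subst_form tVar S.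
Definition instN (t : term) : form -> form :=
  subst_form (fun n => match n with O => t | S k => tVar k end) (fun X => X).
Definition instS (Y : nat) : form -> form :=
  subst_form tVar (fun X => match X with O => Y | S k => k end).

Inductive derives : list form -> form -> Prop :=
| d_hyp G p : In p G -> derives G p
| d_impI G p q : derives (p :: G) q -> derives G (fImp p q)
| d_impE G p q : derives G (fImp p q) -> derives G p -> derives G q
| d_andI G p q : derives G p -> derives G q -> derives G (fAnd p q)
| d_andE1 G p q : derives G (fAnd p q) -> derives G p
| d_andE2 G p q : derives G (fAnd p q) -> derives G q
| d_orI1 G p q : derives G p -> derives G (fOr p q)
| d_orI2 G p q : derives G q -> derives G (fOr p q)
| d_orE G p q r : derives G (fOr p q) ->
    derives (p :: G) r -> derives (q :: G) r -> derives G r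
| d_raa G p : derives (fNot p :: G) fBot -> derives G p
| d_allNI G p : derives (map shiftN G) p -> derives G (fAllN p)
| d_allNE G p t : derives G (fAllN p) -> derives G (instN t p)
| d_exNI G p t : derives G (instN t p) -> derives G (fExN p)
| d_exNE G p q : derives G (fExN p) ->
    derives (p :: map shiftN G) (shiftN q) -> derives G q
| d_allSI G p : derives (map shiftS G) p -> derives G (fAllS p)
| d_allSE G p Y : derives G (fAllS p) -> derives G (instS Y p)
| d_exSI G p Y : derives G (instS Y p) -> derives G (fExS p)
| d_exSE G p q : derives G (fExS p) ->
    derives (p :: map shiftS G) (shiftS q) -> derives G q
| d_eqI G t : derives G (fEq t t)
| d_eqE G p s t : derives G (fEq s t) -> derives G (instN s p) -> derives G (instN t p).

Definition proves (T : form -> Prop) (p : form) : Prop :=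
  exists G, (forall q, In q G -> T q) /\ derives G p.

Notation "T |-- p" := (proves T p) (at level 90, no associativity).

(** A [tm], [sv] or [fm] is a family of terms, set variables or formulas
    indexed by the numbers of enclosing number and set quantifiers.  The
    quantifiers below hand their body the de Bruijn index that points back to
    them at each depth, so no explicit shifting is needed; a sentence is
    obtained by placing an [fm] at depth 0. *)

Definition tm : Type := nat -> term.
Definition sv : Type := nat -> nat.
Definition fm : Type := nat -> nat -> form.

Definition sentence (p : fm) : form := p 0 0.

Definition add' (s t : tm) : tm := fun d => tAdd (s d) (t d).
Definition mul' (s t : tm) : tm := fun d => tMul (s d) (t d).
Fixpoint num (k : nat) : tm :=
  match k with
  | O => fun _ => tZero
  | S O => fun _ => tOne
  | S j => add' (num j) (fun _ => tOne)
  end.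

Definition eq' (s t : tm) : fm := fun d _ => fEq (s d) (t d).
Definition lt' (s t : tm) : fm := fun d _ => fLt (s d) (t d).
Definition mem' (t : tm) (X : sv) : fm := fun d e => fMem (t d) (X e).
Definition imp' (p q : fm) : fm := fun d e => fImp (p d e) (q d e).
Definition and' (p q : fm) : fm := fun d e => fAnd (p d e) (q d e).
Definition or' (p q : fm) : fm := fun d e => fOr (p d e) (q d e).
Definition not' (p : fm) : fm := fun d e => fNot (p d e).
Definition iff' (p q : fm) : fm := fun d e => fIff (p d e) (q d e).
Definition allN (f : tm -> fm) : fm :=
  fun d e => fAllN (f (fun d' => tVar (d' - S d)) (S d) e).
Definition exN (f : tm -> fm) : fm :=
  fun d e => fExN (f (fun d' => tVar (d' - S d)) (S d) e).
Definition allS (f : sv -> fm) : fm :=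
  fun d e => fAllS (f (fun e' => e' - S e) d (S e)).
Definition exS (f : sv -> fm) : fm :=
  fun d e => fExS (f (fun e' => e' - S e) d (S e)).

Declare Scope tm_scope.
Declare Scope fm_scope.
Delimit Scope tm_scope with tm.
Delimit Scope fm_scope with fm.
Bind Scope tm_scope with tm.
Bind Scope fm_scope with fm.

Notation "# k" := (num k) (at level 0, k at level 0, format "# k") : tm_scope.
Notation "s + t" := (add' s t) : tm_scope.
Notation "s * t" := (mul' s t) : tm_scope.
Notation "s == t" := (eq' s%tm t%tm) (at level 70, no associativity) : fm_scope.
Notation "s < t" := (lt' s%tm t%tm) : fm_scope.
Notation "s <= t" := (or' (lt' s%tm t%tm) (eq' s%tm t%tm)) : fm_scope.
Notation "t ∈ X" := (mem' t%tm X) (at level 70, no associativity) : fm_scope.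
Notation "~ p" := (not' p) : fm_scope.
Notation "p /\ q" := (and' p q) : fm_scope.
Notation "p \/ q" := (or' p q) : fm_scope.
Notation "p ==> q" := (imp' p q) (at level 96, right associativity) : fm_scope.
Notation "p <=> q" := (iff' p q) (at level 95, no associativity) : fm_scope.
Notation "'ALL' x .. y , p" := (allN (fun x => .. (allN (fun y => p%fm)) ..))
  (at level 200, x binder, y binder, right associativity) : fm_scope.
Notation "'EX' x .. y , p" := (exN (fun x => .. (exN (fun y => p%fm)) ..))
  (at level 200, x binder, y binder, right associativity) : fm_scope.
Notation "'ALLS' X .. Y , p" := (allS (fun X => .. (allS (fun Y => p%fm)) ..))
  (at level 200, X binder, Y binder, right associativity) : fm_scope.
Notation "'EXS' X .. Y , p" := (exS (fun X => .. (exS (fun Y => p%fm)) ..))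
  (at level 200, X binder, Y binder, right associativity) : fm_scope.

Local Open Scope fm_scope.

Definition PAminus : list form := map sentence
  [ ALL x y z, (x + y) + z == x + (y + z);
    ALL x y, x + y == y + x;
    ALL x y z, (x * y) * z == x * (y * z);
    ALL x y, x * y == y * x;
    ALL x y z, x * (y + z) == x * y + x * z;
    ALL x, x + #0 == x;
    ALL x, x * #0 == #0;
    ALL x, x * #1 == x;
    ALL x y z, x < y /\ y < z ==> x < z;
    ALL x, ~ x < x;
    ALL x y, x < y \/ x == y \/ y < x;
    ALL x y z, x < y ==> x + z < y + z;
    ALL x y z, #0 < z /\ x < y ==> x * z < y * z;
    ALL x y, x < y ==> EX z, x + z == y;
    #0 < #1 /\ (ALL x, #0 < x ==> #1 <= x);
    ALL x, #0 <= x ].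

(** Formulas all of whose quantifiers are bounded number quantifiers; the
    bound is shifted since it does not contain the quantified variable. *)
Inductive Delta00 : form -> Prop :=
| D_bot : Delta00 fBot
| D_eq s t : Delta00 (fEq s t)
| D_lt s t : Delta00 (fLt s t)
| D_mem t X : Delta00 (fMem t X)
| D_imp p q : Delta00 p -> Delta00 q -> Delta00 (fImp p q)
| D_and p q : Delta00 p -> Delta00 q -> Delta00 (fAnd p q)
| D_or p q : Delta00 p -> Delta00 q -> Delta00 (fOr p q)
| D_all t p : Delta00 p ->
    Delta00 (fAllN (fImp (fLt (tVar 0) (shift_term t)) p))
| D_ex t p : Delta00 p ->
    Delta00 (fExN (fAnd (fLt (tVar 0) (shift_term t)) p)).

Inductive Sigma01 : form -> Prop :=
| Sigma01_ex p : Delta00 p -> Sigma01 (fExN p).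

Inductive Pi01 : form -> Prop :=
| Pi01_all p : Delta00 p -> Pi01 (fAllN p).

(** Every free number (set) variable of [p] is below [boundN p] ([boundS p]). *)
Fixpoint bound_term (t : term) : nat :=
  match t with
  | tVar n => S n
  | tZero | tOne => 0
  | tAdd a b | tMul a b => Nat.max (bound_term a) (bound_term b)
  end.

Fixpoint boundN (p : form) : nat :=
  match p with
  | fBot => 0
  | fEq a b | fLt a b => Nat.max (bound_term a) (bound_term b)
  | fMem a _ => bound_term a
  | fImp p q | fAnd p q | fOr p q => Nat.max (boundN p) (boundN q)
  | fAllN p | fExN p => Nat.pred (boundN p)
  | fAllS p | fExS p => boundN p
  end.

Fixpoint boundS (p : form) : nat :=
  match p with
  | fBot | fEq _ _ | fLt _ _ => 0
  | fMem _ X => S X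
  | fImp p q | fAnd p q | fOr p q => Nat.max (boundS p) (boundS q)
  | fAllN p | fExN p => boundS p
  | fAllS p | fExS p => Nat.pred (boundS p)
  end.

Definition universal_closure (p : form) : form :=
  Nat.iter (boundS p) fAllS (Nat.iter (boundN p) fAllN p).

(** In both schemes the distinguished number variable is [tVar 0]. *)
Definition induction_for (p : form) : form :=
  let p_succ :=
    subst_form
      (fun n => match n with O => tAdd (tVar 0) tOne | S k => tVar (S k) end)
      (fun X => X) p in
  fImp (fAnd (instN tZero p) (fAllN (fImp p p_succ))) (fAllN p).

Definition comprehension_for (p q : form) : form :=
  fImp (fAllN (fIff p q))
       (fExS (fAllN (fIff (fMem (tVar 0) 0) (shiftS p)))).

Inductive RCA0 : form -> Prop :=
| RCA0_basic p : In p PAminus -> RCA0 p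
| RCA0_induction p :
    Sigma01 p -> RCA0 (universal_closure (induction_for p))
| RCA0_comprehension p q :
    Sigma01 p -> Pi01 q -> RCA0 (universal_closure (comprehension_for p q)).

Definition pr (x y : tm) : tm := (x + y) * (x + y) + x.

(** The number [pr k (pr m n)] codes the finite set of all [i < k] such that
    [m * (i + 1) + 1] divides [n]; a set is represented by its least code. *)
Definition elt (i c : tm) : fm :=
  EX k m n, c == pr k (pr m n) /\ i < k /\ EX q, n == q * (m * (i + #1) + #1).

Definition FinSet (c : tm) : fm :=
  ALL c', c' < c ==> ~ (ALL i, elt i c' <=> elt i c).

Definition FinSeq (s l : tm) : fm :=
  FinSet s /\
  (ALL p, elt p s ==> EX i x, i < l /\ p == pr i x) /\
  (ALL i, i < l ==> EX x, ALL y, elt (pr i y) s <=> y == x).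

Definition BinString (s l : tm) : fm :=
  FinSeq s l /\ ALL i x, elt (pr i x) s ==> x < #2.

Definition InitialSegment (s t : tm) : fm := ALL p, elt p s ==> elt p t.

Definition StringSet (B : tm) : fm :=
  FinSet B /\ ALL s, elt s B ==> EX l, BinString s l.

Definition InBasic (X : sv) (B : tm) : fm :=
  EX s, elt s B /\ ALL i x, elt (pr i x) s ==> (x == #1 <=> i ∈ X).

(** A nonnegative rational [a / b] is coded by [pr a b] with [0 < b]. *)

Definition Pow2 (n p : tm) : fm :=
  EX s, FinSeq s (n + #1) /\ elt (pr #0 #1) s /\
    (ALL i x, i < n /\ elt (pr i x) s ==> elt (pr (i + #1) (#2 * x)) s) /\
    elt (pr n p) s.

Definition MinimalIn (s B : tm) : fm :=
  elt s B /\ ~ (EX t, elt t B /\ InitialSegment t s /\ ~ t == s).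

(** [mu(B) = a / b].  The elements of a coded set [B] are below the number
    [B]; the sequence [S] lists the partial sums, its entry at [x] being the
    sum of [2^{-|s|}] over the minimal strings [s < x] of [B]. *)
Definition Mu (B a b : tm) : fm :=
  EX S, FinSeq S (B + #1) /\ elt (pr #0 (pr #0 #1)) S /\
    (ALL x c d, x < B /\ elt (pr x (pr c d)) S ==>
       (~ MinimalIn x B ==> elt (pr (x + #1) (pr c d)) S) /\
       (MinimalIn x B ==> ALL l p, BinString x l /\ Pow2 l p ==>
          elt (pr (x + #1) (pr (c * p + d) (d * p))) S)) /\
    elt (pr B (pr a b)) S.

Definition MuLePow2Neg (B n : tm) : fm :=
  EX a b p, Mu B a b /\ Pow2 n p /\ a * p <= b.

(** A function [N -> N] is its graph, a set of pairs; a function on [N x N]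
    is a set of pairs [pr (pr n i) x]. *)
Definition Function1 (F : sv) : fm :=
  (ALL p, p ∈ F ==> EX i x, p == pr i x) /\
  (ALL i, EX x, ALL y, pr i y ∈ F <=> y == x).

Definition Function2 (F : sv) : fm :=
  (ALL p, p ∈ F ==> EX n i x, p == pr (pr n i) x) /\
  (ALL n i, EX x, ALL y, pr (pr n i) y ∈ F <=> y == x).

(** Below, a sequence [(B_i)] of coded finite sets is given by the relation
    [U i b] expressing [B_i = b]. *)

Definition OpenCode (U : tm -> tm -> fm) : fm :=
  ALL i b, U i b ==> StringSet b.

Definition InOpen (X : sv) (U : tm -> tm -> fm) : fm :=
  EX i b, U i b /\ InBasic X b.

Definition OpenMuLePow2Neg (U : tm -> tm -> fm) (n : tm) : fm :=
  ALL m, EX C, FinSet C /\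
    (ALL s, elt s C <=> EX i b, i <= m /\ U i b /\ elt s b) /\
    MuLePow2Neg C n.

(** Kleene's indices for the partial recursive functionals with a set oracle
    [Z], acting on numbers, several arguments being paired:
    - [<0,k>]: the constant [k];  [<1,0>]: identity;  [<2,0>]: successor;
    - [<3,0>], [<4,0>]: first and second component of a pair;
    - [<5,0>]: characteristic function of the oracle;
    - [<6,<b,c>>]: pairing of [b] and [c];
    - [<7,<b,c>>]: composition, [c] first;
    - [<8,<b,c>>]: primitive recursion [f<x,0> = b(x)],
      [f<x,n+1> = c<<x,n>,f<x,n>>];
    - [<9,b>]: [u |-> ] the least [v] with [b<u,v> = 0].

    [KleeneStep] says that the value of [a] at [u] is [v] in view of the
    values recorded by [R]. *)
Definition KleeneStep (Z : sv) (R : tm -> tm -> tm -> fm) (a u v : tm) : fm :=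
  a == pr #0 v \/
  (a == pr #1 #0 /\ v == u) \/
  (a == pr #2 #0 /\ v == u + #1) \/
  (a == pr #3 #0 /\ EX w, u == pr v w) \/
  (a == pr #4 #0 /\ EX w, u == pr w v) \/
  (a == pr #5 #0 /\ ((u ∈ Z /\ v == #1) \/ (~ u ∈ Z /\ v == #0))) \/
  (EX b c, a == pr #6 (pr b c) /\
     EX w1 w2, R b u w1 /\ R c u w2 /\ v == pr w1 w2) \/
  (EX b c, a == pr #7 (pr b c) /\ EX w, R c u w /\ R b w v) \/
  (EX b c, a == pr #8 (pr b c) /\ EX x n, u == pr x n /\
     ((n == #0 /\ R b x v) \/
      (EX m w, n == m + #1 /\ R a (pr x m) w /\ R c (pr (pr x m) w) v))) \/
  (EX b, a == pr #9 b /\ R b (pr u v) #0%tm /\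
     ALL w, w < v ==> EX k, R b (pr u w) (k + #1)%tm).

(** [Phi_e^Z(x) = y]: some finite computation, a sequence of entries
    [<a,<u,v>>] each justified by earlier ones, contains the entry
    [<e,<x,y>>]. *)
Definition Phi (Z : sv) (e x y : tm) : fm :=
  EX s l, FinSeq s l /\
    (ALL i p, elt (pr i p) s ==> EX a u v, p == pr a (pr u v) /\
       KleeneStep Z
         (fun a' u' v' => EX j, j < i /\ elt (pr j (pr a' (pr u' v'))) s)
         a u v) /\
    (EX i, elt (pr i (pr e (pr x y))) s).

Definition Computes1 (Z : sv) (e : tm) (F : sv) : fm :=
  ALL i x, pr i x ∈ F <=> Phi Z e i x.

Definition Computes2 (Z : sv) (e : tm) (F : sv) : fm :=
  ALL n i x, pr (pr n i) x ∈ F <=> Phi Z e (pr n i) x.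

Definition TuringLe1 (F Z : sv) : fm := EX e, Computes1 Z e F.
Definition TuringLe2 (F Z : sv) : fm := EX e, Computes2 Z e F.

Definition seq_of (F : sv) : tm -> tm -> fm := fun i b => pr i b ∈ F.
Definition section (F : sv) (n : tm) : tm -> tm -> fm :=
  fun i b => pr (pr n i) b ∈ F.

Definition MLTest (U Z : sv) : fm :=
  Function2 U /\ TuringLe2 U Z /\
  ALL n, OpenCode (section U n) /\ OpenMuLePow2Neg (section U n) n.

Definition OneRandom (X Z : sv) : fm :=
  ALLS U, MLTest U Z ==> ~ (ALL n, InOpen X (section U n)).

Definition MLR : form := sentence (ALLS Z, EXS X, OneRandom X Z).

(** Stated without assuming that the [x] with [A x] form a coded finite set:
    every injective finite sequence of them has length at most [k]. *)
Definition AtMost (A : tm -> fm) (k : tm) : fm :=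
  ALL s l, FinSeq s l /\
    (ALL i x, elt (pr i x) s ==> A x) /\
    (ALL i j x, elt (pr i x) s /\ elt (pr j x) s ==> i == j)
    ==> l <= k.

Definition HRE (h g : sv) : fm :=
  Function2 g /\
  ALL n k, pr n k ∈ h ==>
    AtMost (fun s => ~ (EX v, pr (pr n s) v ∈ g /\ pr (pr n (s + #1)) v ∈ g)) k.

Definition Limit (g : sv) (n e : tm) : fm :=
  EX s0, ALL s, s0 <= s ==> pr (pr n s) e ∈ g.

Definition DemuthTest (h g Z : sv) : fm :=
  Function1 h /\ TuringLe1 h Z /\ HRE h g /\ TuringLe2 g Z /\
  ALL n, EX e, Limit g n e /\
    EXS F, Function1 F /\ Computes1 Z e F /\
      OpenCode (seq_of F) /\ OpenMuLePow2Neg (seq_of F) n.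

(** For some [n], [X] is not in the open set coded by [Phi_e^Z], where
    [e = lim_s g(n,s)]. *)
Definition WeaklyPasses (X g Z : sv) : fm :=
  EX n e, Limit g n e /\ ~ InOpen X (Phi Z e).

Definition IsCPow2 (c : tm) (h : sv) : fm :=
  Function1 h /\ ALL n p, Pow2 n p ==> pr n (c * p) ∈ h.

Definition BalancedRandom (X Z : sv) : fm :=
  ALL c, ALLS h g, IsCPow2 c h /\ DemuthTest h g Z ==> WeaklyPasses X g Z.

Definition BR : form := sentence (ALLS Z, EXS X, BalancedRandom X Z).

(* Main.v *)
(** By the completeness theorem it suffices to compare MLR and BR in an arbitrary, possibly
    nonstandard, model of RCA0.

    MLR implies BR: let X be 1-random relative to Z, with even half X0 and odd half X1.  If
    neither half were balanced random, there would be a c 2^n-Demuth test (U_n) with X0 in every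
    U_n and a c' 2^n-Demuth test (V_n) with X1 in every V_n.  Enumerate into W_n the products
    U_n[s] x V_n[s] of all versions of the two tests, where a version is enumerated only while
    its measure stays below 2^-n.  There are at most 1 + c 2^n + c' 2^n pairs of versions, each
    contributing at most 2^-2n, so W_n has measure at most (1 + c + c') 2^-n.  A tail of (W_n)
    is a Martin-Loef test that captures X.  Measures are compared by counting the strings of one
    large length that extend a given finite set of strings.

    BR implies MLR: a Martin-Loef test is a Demuth test whose indices, given by the s-m-n
    theorem, never change. *)

From Stdlib Require Import List Arith Lia ZArith Ring.
From Stdlib Require Import Classical ClassicalEpsilon FunctionalExtensionality PropExtensionality.
From Stdlib Require Cantor.
Require Import Defs.
Import ListNotations.

(** * Substitution *)

(** One test alone cannot be turned into a Martin-Löf test in this way: all versions of [U_n]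
    together may have measure about [(1 + c 2^n) 2^-n], which does not tend to 0. Pairing two tests
    multiplies the measures of two versions but only adds the numbers of changes, and this gain of
    [2^-n] is what the split of [X] buys. The price is that the argument is by contradiction and
    does not tell which half succeeds.

    An index that is not the final one may belong to a partial functional or to a set of large
    measure, and whether it does is not decidable. A version therefore acts only through finite
    unions of its members for which a bounded witness confirms both convergence and small measure.

    Induction is available for Sigma-1 formulas only. So cardinalities are values of a primitive
    recursion, infinite measures never occur, and every predicate is classified with its set
    parameters. The parameters matter: a function that is Sigma-1 definable from [Z] alone receives
    a Kleene index relative to [Z], which a test must have. *)

Definition scons {A : Type} (x : A) (f : nat -> A) (n : nat) : A :=
  match n with O => x | S k => f k end.
Notation "x .: f" := (scons x f) (at level 55, f at level 55, right associativity).

Lemma subst_term_comp s s' t :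
  subst_term s (subst_term s' t) = subst_term (fun n => subst_term s (s' n)) t.
Proof. induction t; simpl; congruence. Qed.

Lemma subst_term_id t : subst_term tVar t = t.
Proof. induction t; simpl; congruence. Qed.

Lemma upN_shift s t : subst_term (upN s) (shift_term t) = shift_term (subst_term s t).
Proof. unfold shift_term; now rewrite !subst_term_comp. Qed.

Lemma upN_comp s s' :
  (fun n => subst_term (upN s) (upN s' n)) = upN (fun n => subst_term s (s' n)).
Proof. extensionality n; destruct n as [|n]; simpl; [easy | apply upN_shift]. Qed.

Lemma upS_comp r r' : (fun n => upS r (upS r' n)) = upS (fun n => r (r' n)).
Proof. extensionality n; now destruct n. Qed.

Lemma subst_form_comp p : forall s r s' r',
  subst_form s r (subst_form s' r' p)
  = subst_form (fun n => subst_term s (s' n)) (fun n => r (r' n)) p.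
Proof.
  induction p; intros; simpl; rewrite ?subst_term_comp, ?IHp, ?IHp1, ?IHp2,
    ?upN_comp, ?upS_comp; auto.
Qed.

Lemma upN_var : upN tVar = tVar.
Proof. extensionality n; now destruct n. Qed.

Lemma upS_id : upS (fun X => X) = fun X => X.
Proof. extensionality n; now destruct n. Qed.

Lemma subst_form_id p : subst_form tVar (fun X => X) p = p.
Proof.
  induction p; simpl; rewrite ?subst_term_id, ?upN_var, ?upS_id; congruence.
Qed.

Lemma subst_term_agree t : forall s s',
  (forall n, n < bound_term t -> s n = s' n) -> subst_term s t = subst_term s' t.
Proof.
  induction t; intros s s' H; simpl in *; auto;
    f_equal; (apply IHt1 || apply IHt2); intros; apply H; lia.
Qed.

Lemma subst_form_agree p : forall s s' r r',
  (forall n, n < boundN p -> s n = s' n) -> (forall X, X < boundS p -> r X = r' X) ->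
  subst_form s r p = subst_form s' r' p.
Proof.
  induction p; intros s s' r r' HN HS; simpl in *; auto; f_equal;
    first [ apply subst_term_agree; intros; apply HN; lia
          | apply HS; lia
          | apply IHp1; intros; (apply HN || apply HS); lia
          | apply IHp2; intros; (apply HN || apply HS); lia
          | apply IHp; intros n Hn; auto; destruct n as [|n]; simpl; auto;
            f_equal; (apply HN || apply HS); lia ].
Qed.

Lemma shiftN_subst s r p : subst_form (upN s) r (shiftN p) = shiftN (subst_form s r p).
Proof. unfold shiftN; now rewrite !subst_form_comp. Qed.

Lemma shiftS_subst s r p : subst_form s (upS r) (shiftS p) = shiftS (subst_form s r p).
Proof.
  unfold shiftS; rewrite !subst_form_comp. f_equal.
  extensionality n; simpl. now rewrite subst_term_id.
Qed.

Lemma instN_subst s r t p :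
  subst_form s r (instN t p) = instN (subst_term s t) (subst_form (upN s) r p).
Proof.
  unfold instN; rewrite !subst_form_comp. f_equal. extensionality n.
  destruct n; simpl; auto. unfold shift_term. rewrite subst_term_comp; simpl.
  now rewrite subst_term_id.
Qed.

Lemma instS_subst s r Y p :
  subst_form s r (instS Y p) = instS (r Y) (subst_form s (upS r) p).
Proof.
  unfold instS; rewrite !subst_form_comp. f_equal.
  - extensionality n; simpl. now rewrite subst_term_id.
  - extensionality n; now destruct n.
Qed.

Lemma instN_up s r t p :
  instN t (subst_form (upN s) r p) = subst_form (t .: s) r p.
Proof.
  unfold instN; rewrite subst_form_comp. f_equal. extensionality n.
  destruct n; simpl; auto. unfold shift_term. rewrite subst_term_comp. apply subst_term_id.
Qed.

Lemma instS_up s r Y p :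
  instS Y (subst_form s (upS r) p) = subst_form s (Y .: r) p.
Proof.
  unfold instS; rewrite subst_form_comp. f_equal.
  - extensionality n; apply subst_term_id.
  - extensionality n; now destruct n.
Qed.

(** * Derivations *)

Lemma derives_weaken G p : derives G p -> forall G', incl G G' -> derives G' p.
Proof.
  induction 1; intros G' HG.
  - apply d_hyp; auto.
  - apply d_impI, IHderives, incl_cons; [left; auto | apply incl_tl; auto].
  - eapply d_impE; eauto.
  - apply d_andI; auto.
  - eapply d_andE1; eauto.
  - eapply d_andE2; eauto.
  - apply d_orI1; auto.
  - apply d_orI2; auto.
  - eapply d_orE; [eauto | apply IHderives2 | apply IHderives3];
      (apply incl_cons; [left; auto | apply incl_tl; auto]).
  - apply d_raa, IHderives, incl_cons; [left; auto | apply incl_tl; auto].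
  - apply d_allNI, IHderives, incl_map; auto.
  - apply d_allNE; auto.
  - eapply d_exNI; eauto.
  - eapply d_exNE; [eauto | apply IHderives2, incl_cons; [left; auto|]].
    apply incl_tl, incl_map; auto.
  - apply d_allSI, IHderives, incl_map; auto.
  - apply d_allSE; auto.
  - eapply d_exSI; eauto.
  - eapply d_exSE; [eauto | apply IHderives2, incl_cons; [left; auto|]].
    apply incl_tl, incl_map; auto.
  - apply d_eqI.
  - eapply d_eqE; eauto.
Qed.

(** Every rule commutes with simultaneous substitution; below a binder, lifting the substitution
    matches shifting the context. It serves to turn a fresh variable into an eigenvariable in
    [consistent_witness]. *)
Lemma derives_subst G p : derives G p ->
  forall s r, derives (map (subst_form s r) G) (subst_form s r p).
Proof.
  assert (EN : forall s r G,
    map (subst_form (upN s) r) (map shiftN G) = map shiftN (map (subst_form s r) G)).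
  { intros; rewrite !map_map; apply map_ext; intros; apply shiftN_subst. }
  assert (ES : forall s r G,
    map (subst_form s (upS r)) (map shiftS G) = map shiftS (map (subst_form s r) G)).
  { intros; rewrite !map_map; apply map_ext; intros; apply shiftS_subst. }
  induction 1; intros s' r'; simpl in *.
  - apply d_hyp, in_map; auto.
  - apply d_impI, IHderives.
  - eapply d_impE; [apply IHderives1 | apply IHderives2].
  - apply d_andI; auto.
  - eapply d_andE1; apply IHderives.
  - eapply d_andE2; apply IHderives.
  - apply d_orI1; auto.
  - apply d_orI2; auto.
  - eapply d_orE; [apply IHderives1 | apply IHderives2 | apply IHderives3].
  - apply d_raa, IHderives.
  - apply d_allNI. rewrite <- EN; auto.
  - rewrite instN_subst. apply d_allNE, IHderives.
  - apply d_exNI with (subst_term s' t). rewrite <- instN_subst; auto.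
  - eapply d_exNE; [apply IHderives1|].
    rewrite <- shiftN_subst, <- EN; apply IHderives2.
  - apply d_allSI. rewrite <- ES; auto.
  - rewrite instS_subst. apply d_allSE, IHderives.
  - apply d_exSI with (r' Y). rewrite <- instS_subst; auto.
  - eapply d_exSE; [apply IHderives1|].
    rewrite <- shiftS_subst, <- ES; apply IHderives2.
  - apply d_eqI.
  - rewrite instN_subst. eapply d_eqE; [apply IHderives1|].
    rewrite <- instN_subst; auto.
Qed.

Lemma derives_cut G p q : derives G p -> derives (p :: G) q -> derives G q.
Proof. intros H1 H2; eapply d_impE; [apply d_impI, H2 | auto]. Qed.

Lemma derives_exfalso G p : derives G fBot -> derives G p.
Proof. intros H; apply d_raa. eapply derives_weaken; [eauto | apply incl_tl, incl_refl]. Qed.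

(** * An enumeration of the formulas *)

Fixpoint decode_term (fuel n : nat) : term :=
  match fuel with
  | O => tZero
  | S f =>
    let (tag, k) := Cantor.of_nat n in
    let (a, b) := Cantor.of_nat k in
    match tag with
    | 0 => tVar k
    | 1 => tZero
    | 2 => tOne
    | 3 => tAdd (decode_term f a) (decode_term f b)
    | _ => tMul (decode_term f a) (decode_term f b)
    end
  end.

Fixpoint decode_form (fuel n : nat) : form :=
  match fuel with
  | O => fBot
  | S f =>
    let (tag, k) := Cantor.of_nat n in
    let (a, b) := Cantor.of_nat k in
    match tag with
    | 0 => fBot
    | 1 => fEq (decode_term f a) (decode_term f b)
    | 2 => fLt (decode_term f a) (decode_term f b)
    | 3 => fMem (decode_term f a) b
    | 4 => fImp (decode_form f a) (decode_form f b)
    | 5 => fAnd (decode_form f a) (decode_form f b)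
    | 6 => fOr (decode_form f a) (decode_form f b)
    | 7 => fAllN (decode_form f k)
    | 8 => fExN (decode_form f k)
    | 9 => fAllS (decode_form f k)
    | _ => fExS (decode_form f k)
    end
  end.

Definition enum_form (n : nat) : form :=
  let (fuel, k) := Cantor.of_nat n in decode_form fuel k.

(** Two subterms are decoded with the same remaining fuel, so the induction needs a value that is
    stable for all larger fuel. *)
Lemma decode_term_onto t : exists f0 n, forall f, f0 <= f -> decode_term f n = t.
Proof.
  induction t as [k| | |t1 (f1 & n1 & H1) t2 (f2 & n2 & H2)|t1 (f1 & n1 & H1) t2 (f2 & n2 & H2)].
  - exists 1, (Cantor.to_nat (0, k)). intros [|f] Hf; [lia|]; cbn [decode_term].
    rewrite Cantor.cancel_of_to. now destruct (Cantor.of_nat k).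
  - exists 1, (Cantor.to_nat (1, 0)). intros [|f] Hf; [lia | reflexivity].
  - exists 1, (Cantor.to_nat (2, 0)). intros [|f] Hf; [lia | reflexivity].
  - exists (S (f1 + f2)), (Cantor.to_nat (3, Cantor.to_nat (n1, n2))).
    intros [|f] Hf; [lia|]; cbn [decode_term]; rewrite !Cantor.cancel_of_to, H1, H2; auto; lia.
  - exists (S (f1 + f2)), (Cantor.to_nat (4, Cantor.to_nat (n1, n2))).
    intros [|f] Hf; [lia|]; cbn [decode_term]; rewrite !Cantor.cancel_of_to, H1, H2; auto; lia.
Qed.

Lemma decode_form_onto p : exists f0 n, forall f, f0 <= f -> decode_form f n = p.
Proof.
  induction p as [|a b|a b|a X|p (f1 & n1 & H1) q (f2 & n2 & H2)|p (f1 & n1 & H1) q (f2 & n2 & H2)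
    |p (f1 & n1 & H1) q (f2 & n2 & H2)|p (f1 & n1 & H1)|p (f1 & n1 & H1)|p (f1 & n1 & H1)|p (f1 & n1 & H1)].
  1: exists 1, 0; intros [|f] Hf; [lia | reflexivity].
  1,2: destruct (decode_term_onto a) as (f1 & n1 & H1), (decode_term_onto b) as (f2 & n2 & H2).
  3: destruct (decode_term_onto a) as (f1 & n1 & H1).
  1: exists (S (f1 + f2)), (Cantor.to_nat (1, Cantor.to_nat (n1, n2))).
  2: exists (S (f1 + f2)), (Cantor.to_nat (2, Cantor.to_nat (n1, n2))).
  3: exists (S f1), (Cantor.to_nat (3, Cantor.to_nat (n1, X))).
  4: exists (S (f1 + f2)), (Cantor.to_nat (4, Cantor.to_nat (n1, n2))).
  5: exists (S (f1 + f2)), (Cantor.to_nat (5, Cantor.to_nat (n1, n2))).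
  6: exists (S (f1 + f2)), (Cantor.to_nat (6, Cantor.to_nat (n1, n2))).
  7: exists (S f1), (Cantor.to_nat (7, n1)).
  8: exists (S f1), (Cantor.to_nat (8, n1)).
  9: exists (S f1), (Cantor.to_nat (9, n1)).
  10: exists (S f1), (Cantor.to_nat (10, n1)).
  all: intros [|f] Hf; [lia|]; cbn [decode_form]; rewrite !Cantor.cancel_of_to.
  7-10: destruct (Cantor.of_nat n1); rewrite H1; auto; lia.
  all: rewrite ?H1, ?H2; auto; lia.
Qed.

Lemma enum_form_onto p : exists n, enum_form n = p.
Proof.
  destruct (decode_form_onto p) as (f0 & n & H). exists (Cantor.to_nat (f0, n)).
  unfold enum_form. rewrite Cantor.cancel_of_to. now apply H.
Qed.

(** * Structures and satisfaction *)

Record structure : Type := {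
  dom : Type; sdom : Type;
  mzero : dom; mone : dom;
  madd : dom -> dom -> dom; mmul : dom -> dom -> dom;
  mlt : dom -> dom -> Prop; mmem : dom -> sdom -> Prop;
}.

Fixpoint eval (K : structure) (v : nat -> dom K) (t : term) : dom K :=
  match t with
  | tVar n => v n
  | tZero => mzero K
  | tOne => mone K
  | tAdd a b => madd K (eval K v a) (eval K v b)
  | tMul a b => mmul K (eval K v a) (eval K v b)
  end.

Fixpoint sat (K : structure) (v : nat -> dom K) (w : nat -> sdom K) (p : form) : Prop :=
  match p with
  | fBot => False
  | fEq a b => eval K v a = eval K v b
  | fLt a b => mlt K (eval K v a) (eval K v b)
  | fMem a X => mmem K (eval K v a) (w X)
  | fImp p q => sat K v w p -> sat K v w q
  | fAnd p q => sat K v w p /\ sat K v w q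
  | fOr p q => sat K v w p \/ sat K v w q
  | fAllN p => forall x, sat K (x .: v) w p
  | fExN p => exists x, sat K (x .: v) w p
  | fAllS p => forall X, sat K v (X .: w) p
  | fExS p => exists X, sat K v (X .: w) p
  end.

(** * Henkin's completeness theorem *)

Section Completeness.
Variable T : form -> Prop.
Hypothesis T_closed : forall q, T q -> boundN q = 0 /\ boundS q = 0.
Variable goal : form.
Hypothesis goal_unprovable : ~ (T |-- goal).

(** The possibly infinite theory is kept apart from the finite list [G]: being closed, it contains
    no variable, so freshness has to be checked for [G] only. *)
Definition consistent (G : list form) : Prop :=
  ~ exists H, (forall q, In q H -> T q) /\ derives (G ++ H) fBot.

Lemma consistent_start : consistent [fNot goal].
Proof.
  intros (H & HT & HD). apply goal_unprovable. exists H; split; auto.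
  apply d_raa; exact HD.
Qed.

Definition freshN (G : list form) : nat := list_max (map boundN G).
Definition freshS (G : list form) : nat := list_max (map boundS G).

Lemma freshN_le G q : In q G -> boundN q <= freshN G.
Proof.
  intros H. assert (L := list_max_le (map boundN G) (freshN G)).
  destruct L as [L _]. specialize (L (le_n _)).
  rewrite Forall_forall in L; apply L, in_map; auto.
Qed.

Lemma freshS_le G q : In q G -> boundS q <= freshS G.
Proof.
  intros H. assert (L := list_max_le (map boundS G) (freshS G)).
  destruct L as [L _]. specialize (L (le_n _)).
  rewrite Forall_forall in L; apply L, in_map; auto.
Qed.

Definition with_witness (p : form) (G : list form) : list form :=
  match p with
  | fExN q => instN (tVar (freshN (p :: G))) q :: p :: G
  | fExS q => instS (freshS (p :: G)) q :: p :: G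
  | _ => p :: G
  end.

(** Sending the fresh variable to index 0 and shifting all others turns a refutation of the extended
    list into the second premise of the existential elimination rule. On the remaining hypotheses
    this substitution is the plain shift, by freshness for [G] and closedness for [T]. *)
Lemma consistent_witness p G : consistent (p :: G) -> consistent (with_witness p G).
Proof.
  intros HC. destruct p as [| | | | | | | |p| |p]; simpl; auto;
    intros (H & HT & HD); apply HC; exists H; split; auto.
  - set (y := freshN (fExN p :: G)) in *.
    set (s := fun k => if Nat.eqb k y then tVar 0 else tVar (S k)).
    assert (Hs : forall k, k < y -> s k = tVar (S k)).
    { intros k Hk; unfold s. destruct (Nat.eqb_spec k y); auto; lia. }
    apply (derives_subst _ _) with (s := s) (r := fun X => X) in HD.
    eapply (d_exNE _ p fBot); [apply d_hyp; left; reflexivity|].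
    eapply derives_weaken; [exact HD|]. clear HD HC.
    intros q Hq. apply in_map_iff in Hq as (q' & <- & [<-|Hq']).
    + left. rewrite instN_subst. simpl. replace (s y) with (tVar 0)
        by (unfold s; now rewrite Nat.eqb_refl).
      rewrite instN_up. rewrite <- (subst_form_id p) at 1.
      apply subst_form_agree; auto. intros [|n] Hn; simpl; auto.
      symmetry; apply Hs. assert (boundN (fExN p) <= y) by (apply freshN_le; left; auto).
      simpl in *; lia.
    + right. apply in_map_iff. exists q'. split; auto. unfold shiftN.
      apply subst_form_agree; auto. intros n Hn. symmetry; apply Hs.
      change (fExN p :: G ++ H) with ((fExN p :: G) ++ H) in Hq'.
      apply in_app_or in Hq' as [Hq'|Hq'].
      * apply freshN_le in Hq'. unfold y; lia.
      * apply HT, T_closed in Hq'. lia.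
  - set (y := freshS (fExS p :: G)) in *.
    set (r := fun k => if Nat.eqb k y then 0 else S k).
    assert (Hr : forall k, k < y -> r k = S k).
    { intros k Hk; unfold r. destruct (Nat.eqb_spec k y); auto; lia. }
    apply (derives_subst _ _) with (s := tVar) (r := r) in HD.
    eapply (d_exSE _ p fBot); [apply d_hyp; left; reflexivity|].
    eapply derives_weaken; [exact HD|]. clear HD HC.
    intros q Hq. apply in_map_iff in Hq as (q' & <- & [<-|Hq']).
    + left. rewrite instS_subst. replace (r y) with 0
        by (unfold r; now rewrite Nat.eqb_refl).
      rewrite instS_up. rewrite <- (subst_form_id p) at 1.
      apply subst_form_agree; auto. intros [|n] Hn; simpl; auto.
      symmetry; apply Hr. assert (boundS (fExS p) <= y) by (apply freshS_le; left; auto).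
      simpl in *; lia.
    + right. apply in_map_iff. exists q'. split; auto. unfold shiftS.
      apply subst_form_agree; auto. intros n Hn. symmetry; apply Hr.
      change (fExS p :: G ++ H) with ((fExS p :: G) ++ H) in Hq'.
      apply in_app_or in Hq' as [Hq'|Hq'].
      * apply freshS_le in Hq'. unfold y; lia.
      * apply HT, T_closed in Hq'. lia.
Qed.

Fixpoint henkin (n : nat) : list form :=
  match n with
  | O => [fNot goal]
  | S k =>
    if excluded_middle_informative (consistent (enum_form k :: henkin k))
    then with_witness (enum_form k) (henkin k) else henkin k
  end.

Lemma henkin_consistent n : consistent (henkin n).
Proof.
  induction n; simpl; [apply consistent_start|].
  destruct excluded_middle_informative; auto using consistent_witness.
Qed.

Lemma henkin_mono n m : n <= m -> incl (henkin n) (henkin m).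
Proof.
  induction 1; [apply incl_refl|]. simpl.
  destruct excluded_middle_informative; auto.
  eapply incl_tran; [apply IHle|]. destruct (enum_form m); simpl;
    auto using incl_tl, incl_refl.
Qed.

Definition henkin_set (p : form) : Prop := exists n, In p (henkin n).

Lemma henkin_finite G : (forall q, In q G -> henkin_set q) -> exists n, incl G (henkin n).
Proof.
  induction G as [|q G IH]; intros H; [exists 0; easy|].
  destruct IH as [n Hn]; [intros; apply H; now right|].
  destruct (H q (or_introl eq_refl)) as [m Hm]. exists (n + m).
  apply incl_cons; [eapply henkin_mono; [|eauto]; lia|].
  eapply incl_tran; [eauto | apply henkin_mono; lia].
Qed.

Lemma henkin_decide p :
  henkin_set p \/ exists n H, (forall q, In q H -> T q) /\ derives (p :: henkin n ++ H) fBot.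
Proof.
  destruct (enum_form_onto p) as [k <-].
  destruct (classic (consistent (enum_form k :: henkin k))) as [C|C].
  - left. exists (S k). simpl. destruct excluded_middle_informative; [|easy].
    destruct (enum_form k); simpl; auto.
  - right. apply NNPP in C as (H & HT & HD). exists k, H; auto.
Qed.

Lemma henkin_closed_aux G H p : (forall q, In q G -> henkin_set q) ->
  (forall q, In q H -> T q) -> derives (G ++ H) p -> henkin_set p.
Proof.
  intros HG HH HD. destruct (henkin_decide p) as [|(n & H' & HT & HD')]; auto.
  exfalso. destruct (henkin_finite _ HG) as [m Hm].
  apply (henkin_consistent (n + m)). exists (H ++ H'). split.
  - intros q Hq; apply in_app_or in Hq as [?|?]; auto.
  - assert (I1 : incl (henkin n) (henkin (n + m))) by (apply henkin_mono; lia).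
    assert (I2 : incl (henkin m) (henkin (n + m))) by (apply henkin_mono; lia).
    apply derives_cut with p; (eapply derives_weaken; [eassumption|]).
    + intros q Hq. apply in_app_or in Hq as [?|?]; rewrite !in_app_iff; auto.
    + apply incl_cons; [now left|]. intros q Hq. right.
      apply in_app_or in Hq as [?|?]; rewrite !in_app_iff; auto.
Qed.

Lemma henkin_closed G p : (forall q, In q G -> henkin_set q) -> derives G p -> henkin_set p.
Proof.
  intros HG HD. apply henkin_closed_aux with G []; auto; [easy|]. now rewrite app_nil_r.
Qed.

Lemma henkin_T q : T q -> henkin_set q.
Proof.
  intros Hq. apply henkin_closed_aux with [] [q]; [easy | | apply d_hyp; now left].
  intros ? [<-|[]]; auto.
Qed.

Lemma henkin_bot : ~ henkin_set fBot.
Proof.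
  intros [n Hn]. apply (henkin_consistent n). exists []. split; [easy|].
  apply d_hyp, in_or_app; auto.
Qed.

Lemma henkin_not p : henkin_set (fNot p) <-> ~ henkin_set p.
Proof.
  split.
  - intros H1 H2. apply henkin_bot, henkin_closed with [fNot p; p].
    + intros ? [<-|[<-|[]]]; auto.
    + eapply d_impE; apply d_hyp; [now left | right; now left].
  - intros Hp. destruct (henkin_decide p) as [|(n & H & HT & HD)]; [easy|].
    apply henkin_closed_aux with (henkin n) H; auto; [intros q Hq; now exists n|].
    now apply d_impI.
Qed.

(** A member of the Henkin set is consistent with the stage at which it is enumerated, because the
    set is closed and does not contain [fBot]. So it is added at that very stage, together with its
    witness. *)
Lemma henkin_witness p : henkin_set p ->
  exists n, In p (henkin n) /\ henkin n = with_witness p (henkin (pred n)).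
Proof.
  intros HE. destruct (enum_form_onto p) as [k <-].
  assert (C : consistent (enum_form k :: henkin k)).
  { intros (H & HT & HD). apply henkin_bot, henkin_closed_aux with (enum_form k :: henkin k) H; auto.
    intros q [<-|Hq]; auto. now exists k. }
  exists (S k). simpl. destruct excluded_middle_informative; [|easy]. split; auto.
  destruct (enum_form k); simpl; auto.
Qed.

(** That the witness is a variable, not just a term, is what lets [countermodel] name every element
    by a variable. *)
Lemma henkin_exN_var p : henkin_set (fExN p) -> exists y, henkin_set (instN (tVar y) p).
Proof.
  intros H. destruct (henkin_witness _ H) as (n & _ & E). eexists. exists n. rewrite E. now left.
Qed.

Lemma henkin_exN p : henkin_set (fExN p) <-> exists t, henkin_set (instN t p).
Proof.
  split; [intros H; destruct (henkin_exN_var p H); eauto|].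
  intros [t Ht]. apply henkin_closed with [instN t p]; [intros ? [<-|[]]; auto|].
  apply d_exNI with t, d_hyp; now left.
Qed.

Lemma henkin_exS p : henkin_set (fExS p) <-> exists Y, henkin_set (instS Y p).
Proof.
  split.
  - intros H. destruct (henkin_witness _ H) as (n & _ & E). eexists. exists n. rewrite E. now left.
  - intros [t Ht]. apply henkin_closed with [instS t p]; [intros ? [<-|[]]; auto|].
    apply d_exSI with t, d_hyp; now left.
Qed.

Ltac by_closure L :=
  apply henkin_closed with L; [simpl; intros ? Hin; repeat destruct Hin as [<-|Hin]; tauto|].

Lemma henkin_imp p q : henkin_set (fImp p q) <-> (henkin_set p -> henkin_set q).
Proof.
  split.
  - intros H1 H2. by_closure [fImp p q; p].
    eapply d_impE; apply d_hyp; [now left | right; now left].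
  - intros H. destruct (classic (henkin_set p)) as [Hp|Hp].
    + assert (Hq := H Hp). by_closure [q]. apply d_impI, d_hyp; right; now left.
    + apply henkin_not in Hp. by_closure [fNot p].
      apply d_impI, derives_exfalso. eapply d_impE; apply d_hyp; [right; now left | now left].
Qed.

Lemma henkin_and p q : henkin_set (fAnd p q) <-> henkin_set p /\ henkin_set q.
Proof.
  split.
  - intros H; split; by_closure [fAnd p q]; [eapply d_andE1 | eapply d_andE2];
      apply d_hyp; now left.
  - intros [H1 H2]. by_closure [p; q]. apply d_andI; apply d_hyp; [|right]; now left.
Qed.

Lemma henkin_or p q : henkin_set (fOr p q) <-> henkin_set p \/ henkin_set q.
Proof.
  split.
  - intros H. apply NNPP; intros N. apply not_or_and in N as [N1 N2].
    apply henkin_not in N1, N2. apply henkin_bot. by_closure [fOr p q; fNot p; fNot q].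
    eapply d_orE; [apply d_hyp; now left| |]; eapply d_impE; apply d_hyp;
      simpl; [do 2 right; now left | now left | do 3 right; now left | now left].
  - intros [H|H]; [by_closure [p]; apply d_orI1 | by_closure [q]; apply d_orI2];
      apply d_hyp; now left.
Qed.

Lemma henkin_allN p : henkin_set (fAllN p) <-> forall t, henkin_set (instN t p).
Proof.
  split.
  - intros H t. by_closure [fAllN p]. apply d_allNE, d_hyp; now left.
  - intros H. apply NNPP; intros N. apply henkin_not in N.
    assert (HE : henkin_set (fExN (fNot p))).
    { by_closure [fNot (fAllN p)]. apply d_raa. eapply d_impE; [apply d_hyp; right; now left|].
      apply d_allNI, d_raa. eapply d_impE; [apply d_hyp; right; now left|].
      (* The body, shifted below its own binder and then instantiated at the eigenvariable 0, is the
         original body. *)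
      apply d_exNI with (tVar 0). fold shiftN. unfold instN. simpl.
      rewrite subst_form_comp. apply d_hyp. left. unfold fNot. f_equal.
      rewrite <- (subst_form_id p) at 1. f_equal. extensionality n; now destruct n. }
    apply henkin_exN in HE as [t Ht]. apply (henkin_not (instN t p)); auto.
Qed.

Lemma henkin_allS p : henkin_set (fAllS p) <-> forall Y, henkin_set (instS Y p).
Proof.
  split.
  - intros H t. by_closure [fAllS p]. apply d_allSE, d_hyp; now left.
  - intros H. apply NNPP; intros N. apply henkin_not in N.
    assert (HE : henkin_set (fExS (fNot p))).
    { by_closure [fNot (fAllS p)]. apply d_raa. eapply d_impE; [apply d_hyp; right; now left|].
      apply d_allSI, d_raa. eapply d_impE; [apply d_hyp; right; now left|].
      apply d_exSI with 0. unfold instS. simpl.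
      rewrite subst_form_comp. apply d_hyp. left. unfold fNot. f_equal.
      rewrite <- (subst_form_id p) at 1. f_equal; extensionality n; simpl; auto; now destruct n. }
    apply henkin_exS in HE as [t Ht]. apply (henkin_not (instS t p)); auto.
Qed.

Lemma henkin_leibniz s t p : henkin_set (fEq s t) ->
  henkin_set (instN s p) -> henkin_set (instN t p).
Proof.
  intros H1 H2. by_closure [fEq s t; instN s p].
  apply d_eqE with s; apply d_hyp; [now left | right; now left].
Qed.

Lemma henkin_eq_refl t : henkin_set (fEq t t).
Proof. by_closure (@nil form). apply d_eqI. Qed.

Lemma inst_shift u t : subst_term (fun n => match n with O => u | S k => tVar k end) (shift_term t) = t.
Proof. unfold shift_term; rewrite subst_term_comp; simpl. apply subst_term_id. Qed.

Lemma henkin_eq_sym s t : henkin_set (fEq s t) -> henkin_set (fEq t s).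
Proof.
  intros H. assert (L := henkin_leibniz s t (fEq (tVar 0) (shift_term s)) H).
  unfold instN in L; simpl in L. rewrite !inst_shift in L. apply L, henkin_eq_refl.
Qed.

Lemma henkin_eq_trans s t u : henkin_set (fEq s t) -> henkin_set (fEq t u) -> henkin_set (fEq s u).
Proof.
  intros H1 H2. assert (L := henkin_leibniz t u (fEq (shift_term s) (tVar 0)) H2).
  unfold instN in L; simpl in L. rewrite !inst_shift in L. auto.
Qed.

(** Satisfaction reads [fEq] as equality of the domain, so the domain must be the quotient of the
    terms by provable equality; the quotient is built as a type of equivalence classes. *)
Definition term_class (t : term) : term -> Prop := fun s => henkin_set (fEq t s).
Definition hdom : Type := {P : term -> Prop | exists t, P = term_class t}.
Definition cls (t : term) : hdom := exist _ (term_class t) (ex_intro _ t eq_refl).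

Lemma cls_eq s t : cls s = cls t <-> henkin_set (fEq s t).
Proof.
  split.
  - intros H. apply (f_equal (@proj1_sig _ _)) in H. simpl in H.
    change (term_class s t). rewrite H. apply henkin_eq_refl.
  - intros H. assert (E : term_class s = term_class t).
    { extensionality u. apply propositional_extensionality. unfold term_class. split; intros.
      - eapply henkin_eq_trans; [apply henkin_eq_sym|]; eauto.
      - eapply henkin_eq_trans; eauto. }
    unfold cls. revert E. generalize (ex_intro (fun t' => term_class s = term_class t') s eq_refl).
    generalize (term_class s). intros P e E. subst P. f_equal. apply proof_irrelevance.
Qed.

Lemma cls_onto (a : hdom) : exists t, a = cls t.
Proof. destruct a as [P [t ->]]. exists t. unfold cls. f_equal. Qed.

Definition rep (a : hdom) : term := proj1_sig (constructive_indefinite_description _ (cls_onto a)).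
Lemma rep_eq t : henkin_set (fEq t (rep (cls t))).
Proof.
  unfold rep. destruct constructive_indefinite_description as [u Hu]. simpl.
  now apply cls_eq.
Qed.

Definition henkin_model : structure := {|
  dom := hdom; sdom := nat;
  mzero := cls tZero; mone := cls tOne;
  madd a b := cls (tAdd (rep a) (rep b));
  mmul a b := cls (tMul (rep a) (rep b));
  mlt a b := henkin_set (fLt (rep a) (rep b));
  mmem a X := henkin_set (fMem (rep a) X);
|}.

Lemma henkin_congr (F : term -> term -> term) s s' t t' :
  (forall r u v, subst_term r (F u v) = F (subst_term r u) (subst_term r v)) ->
  henkin_set (fEq s s') -> henkin_set (fEq t t') -> henkin_set (fEq (F s t) (F s' t')).
Proof.
  intros HF H1 H2.
  assert (L1 := henkin_leibniz s s' (fEq (shift_term (F s t)) (F (tVar 0) (shift_term t))) H1).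
  assert (L2 := henkin_leibniz t t' (fEq (shift_term (F s t)) (F (shift_term s') (tVar 0))) H2).
  unfold instN in L1, L2. simpl in L1, L2. rewrite !HF, !inst_shift in L1, L2.
  apply L2, L1, henkin_eq_refl.
Qed.

Lemma henkin_eval s t : eval henkin_model (fun n => cls (s n)) t = cls (subst_term s t).
Proof.
  induction t; simpl; auto; rewrite IHt1, IHt2; apply cls_eq, henkin_eq_sym.
  - apply (henkin_congr tAdd); auto using rep_eq.
  - apply (henkin_congr tMul); auto using rep_eq.
Qed.

Lemma henkin_rep_lt s t :
  henkin_set (fLt (rep (cls s)) (rep (cls t))) <-> henkin_set (fLt s t).
Proof.
  assert (E1 := rep_eq s). assert (E2 := rep_eq t).
  revert E1 E2. generalize (rep (cls s)) (rep (cls t)). intros s' t' E1 E2.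
  split; intros H.
  - apply henkin_eq_sym in E1, E2.
    assert (L1 := henkin_leibniz s' s (fLt (tVar 0) (shift_term t')) E1).
    assert (L2 := henkin_leibniz t' t (fLt (shift_term s) (tVar 0)) E2).
    unfold instN in L1, L2. simpl in L1, L2. rewrite !inst_shift in L1, L2. auto.
  - assert (L1 := henkin_leibniz s s' (fLt (tVar 0) (shift_term t)) E1).
    assert (L2 := henkin_leibniz t t' (fLt (shift_term s') (tVar 0)) E2).
    unfold instN in L1, L2. simpl in L1, L2. rewrite !inst_shift in L1, L2. auto.
Qed.

Lemma henkin_rep_mem s X : henkin_set (fMem (rep (cls s)) X) <-> henkin_set (fMem s X).
Proof.
  assert (E := rep_eq s). revert E. generalize (rep (cls s)). intros s' E.
  split; intros H; [apply henkin_eq_sym in E|].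
  - now apply (henkin_leibniz s' s (fMem (tVar 0) X)).
  - now apply (henkin_leibniz s s' (fMem (tVar 0) X)).
Qed.

(** Stated for all substitution instances, since a quantifier extends the assignment by the class of
    a term [t] and the substitution by [t] itself. *)
Lemma henkin_truth p : forall s r,
  sat henkin_model (fun n => cls (s n)) r p <-> henkin_set (subst_form s r p).
Proof.
  assert (EC : forall t s, cls t .: (fun n => cls (s n)) = fun n => cls ((t .: s) n)).
  { intros; extensionality n; now destruct n. }
  induction p; intros s r; simpl; rewrite ?henkin_eval.
  - split; [easy | intros H; now apply henkin_bot in H].
  - apply cls_eq.
  - apply henkin_rep_lt.
  - apply henkin_rep_mem.
  - now rewrite henkin_imp, IHp1, IHp2.
  - now rewrite henkin_and, IHp1, IHp2.
  - now rewrite henkin_or, IHp1, IHp2.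
  - rewrite henkin_allN. split.
    + intros H t. rewrite instN_up. apply IHp. rewrite <- EC. apply H.
    + intros H x. destruct (cls_onto x) as [t ->]. rewrite EC. apply IHp.
      rewrite <- instN_up. apply H.
  - rewrite henkin_exN. split.
    + intros [x H]. destruct (cls_onto x) as [t ->]. exists t.
      rewrite instN_up. apply IHp. rewrite <- EC. apply H.
    + intros [t H]. exists (cls t). rewrite EC. apply IHp. rewrite <- instN_up. apply H.
  - rewrite henkin_allS. split; intros H Y; [rewrite instS_up | ]; apply IHp.
    + apply H.
    + rewrite <- instS_up. apply H.
  - rewrite henkin_exS. split; intros [Y H]; exists Y; [rewrite instS_up | ]; apply IHp.
    + apply H.
    + rewrite <- instS_up. apply H.
Qed.

Lemma countermodel : exists (K : structure) (v : nat -> dom K) (w : nat -> sdom K),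
  (forall x, exists n, v n = x) /\ (forall X, exists n, w n = X) /\
  (forall q, T q -> sat K v w q) /\ ~ sat K v w goal.
Proof.
  exists henkin_model, (fun n => cls (tVar n)), (fun n => n).
  assert (HT : forall p, sat henkin_model (fun n => cls (tVar n)) (fun n => n) p <-> henkin_set p).
  { intros p. rewrite henkin_truth, subst_form_id. reflexivity. }
  split; [|split; [|split]].
  - intros x. destruct (cls_onto x) as [t ->].
    (* The Henkin witness of the statement that something equals [t] is a variable naming the class
       of [t]. *)
    assert (H : henkin_set (fExN (fEq (tVar 0) (shift_term t)))).
    { apply henkin_exN. exists t. unfold instN; simpl. rewrite inst_shift. apply henkin_eq_refl. }
    apply henkin_exN_var in H as [y H]. exists y. apply cls_eq.
    unfold instN in H; simpl in H. now rewrite inst_shift in H.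
  - intros X; now exists X.
  - intros q Hq. now apply HT, henkin_T.
  - rewrite HT. apply henkin_not. exists 0. now left.
Qed.
End Completeness.

(** Every element and every set of the countermodel is named by a variable, so that
    arbitrary parameters can later be supplied by one fixed assignment. *)
Theorem completeness (T : form -> Prop) (p : form) :
  (forall q, T q -> boundN q = 0 /\ boundS q = 0) ->
  (forall (K : structure) (v : nat -> dom K) (w : nat -> sdom K),
     (forall x, exists n, v n = x) -> (forall X, exists n, w n = X) ->
     (forall q, T q -> sat K v w q) -> sat K v w p) ->
  T |-- p.
Proof.
  intros HT H. apply NNPP; intros N.
  destruct (countermodel T HT p N) as (K & v & w & Hv & Hw & Hs & Hn). eauto.
Qed.

(** * Models of RCA0 *)

Lemma eval_agree K t : forall v v',
  (forall n, n < bound_term t -> v n = v' n) -> eval K v t = eval K v' t.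
Proof.
  induction t; intros v v' H; simpl in *; auto;
    f_equal; (apply IHt1 || apply IHt2); intros; apply H; lia.
Qed.

Lemma sat_agree K p : forall v v' w w',
  (forall n, n < boundN p -> v n = v' n) -> (forall X, X < boundS p -> w X = w' X) ->
  (sat K v w p <-> sat K v' w' p).
Proof.
  induction p; intros v v' w w' HN HS; simpl in *.
  1: tauto.
  1-2: rewrite (eval_agree _ t v v'), (eval_agree _ t0 v v'); [reflexivity| |];
    intros; apply HN; lia.
  1: rewrite (eval_agree _ t v v') by (intros; apply HN; lia); rewrite HS by lia; reflexivity.
  1-3: rewrite (IHp1 v v' w w'), (IHp2 v v' w w'); [reflexivity| | | |];
    intros; (apply HN || apply HS); lia.
  1,2: assert (E : forall x, sat K (x .: v) w p <-> sat K (x .: v') w' p) by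
     (intros x; apply IHp; auto; intros [|n] Hn; simpl; auto; apply HN; lia).
  3,4: assert (E : forall X, sat K v (X .: w) p <-> sat K v' (X .: w') p) by
     (intros x; apply IHp; auto; intros [|n] Hn; simpl; auto; apply HS; lia).
  1,3: split; intros H x; apply E, H.
  1,2: split; intros [x H]; exists x; apply E, H.
Qed.

Lemma sat_subst K p : forall v w s r,
  sat K v w (subst_form s r p) <-> sat K (fun n => eval K v (s n)) (fun X => w (r X)) p.
Proof.
  assert (ET : forall v s t, eval K v (subst_term s t) = eval K (fun n => eval K v (s n)) t)
    by (induction t; simpl; congruence).
  assert (EN : forall v s x, (fun n => eval K (x .: v) (upN s n)) = x .: (fun n => eval K v (s n))).
  { intros; extensionality n; destruct n; simpl; auto. unfold shift_term. now rewrite ET. }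
  assert (ES : forall (w : nat -> sdom K) r X, (fun n => (X .: w) (upS r n)) = X .: (fun n => w (r n))).
  { intros; extensionality n; now destruct n. }
  induction p; intros v w s r; simpl; rewrite ?ET; try tauto.
  1-3: now rewrite IHp1, IHp2.
  all: setoid_rewrite IHp; (setoid_rewrite EN || setoid_rewrite ES); reflexivity.
Qed.

Lemma sat_iter_allN K p w n : forall v v', (forall k, v' (k + n) = v k) ->
  sat K v w (Nat.iter n fAllN p) -> sat K v' w p.
Proof.
  induction n; intros v v' Hv H; simpl in H.
  - replace v' with v; auto. extensionality k. now rewrite <- Hv, Nat.add_0_r.
  - apply IHn with (v' n .: v); auto. intros [|k]; simpl; auto.
    rewrite <- Hv. f_equal; lia.
Qed.

Lemma sat_iter_allS K p v n : forall w w', (forall k, w' (k + n) = w k) ->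
  sat K v w (Nat.iter n fAllS p) -> sat K v w' p.
Proof.
  induction n; intros w w' Hw H; simpl in H.
  - replace w' with w; auto. extensionality k. now rewrite <- Hw, Nat.add_0_r.
  - apply IHn with (w' n .: w); auto. intros [|k]; simpl; auto.
    rewrite <- Hw. f_equal; lia.
Qed.

Lemma sat_universal_closure K p v w :
  sat K v w (universal_closure p) -> forall v' w', sat K v' w' p.
Proof.
  intros H v' w'. unfold universal_closure in H.
  (* [v1] follows [v'] on the variables free in [p] and continues with [v], so it is reached from
     [v] by instantiating the quantifiers of the closure one at a time. *)
  set (v1 := fun k => if k <? boundN p then v' k else v (k - boundN p)).
  set (w1 := fun k => if k <? boundS p then w' k else w (k - boundS p)).
  apply sat_agree with v1 w1.
  - intros n Hn; unfold v1. apply Nat.ltb_lt in Hn. now rewrite Hn.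
  - intros n Hn; unfold w1. apply Nat.ltb_lt in Hn. now rewrite Hn.
  - eapply sat_iter_allN; [|eapply sat_iter_allS; [|exact H]].
    + intros k. unfold v1. destruct (Nat.ltb_spec (k + boundN p) (boundN p)); [lia|].
      f_equal; lia.
    + intros k. unfold w1. destruct (Nat.ltb_spec (k + boundS p) (boundS p)); [lia|].
      f_equal; lia.
Qed.

Lemma universal_closure_closed p :
  boundN (universal_closure p) = 0 /\ boundS (universal_closure p) = 0.
Proof.
  unfold universal_closure. set (n := boundN p). set (m := boundS p).
  assert (EN : forall k, boundN (Nat.iter k fAllN p) = n - k /\ boundS (Nat.iter k fAllN p) = m).
  { induction k; simpl; [unfold n, m | destruct IHk]; lia. }
  assert (ES : forall k q, boundN (Nat.iter k fAllS q) = boundN q /\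
    boundS (Nat.iter k fAllS q) = boundS q - k).
  { induction k; intros; simpl; [|destruct (IHk q)]; lia. }
  destruct (EN n), (ES m (Nat.iter n fAllN p)). lia.
Qed.

Lemma RCA0_closed q : RCA0 q -> boundN q = 0 /\ boundS q = 0.
Proof.
  intros [p Hp| |]; try apply universal_closure_closed.
  simpl in Hp. repeat destruct Hp as [<-|Hp]; try (split; reflexivity). easy.
Qed.

Class model : Type := {
  struct : structure;
  nameN : nat -> dom struct;
  nameS : nat -> sdom struct;
  nameN_onto : forall x, exists n, nameN n = x;
  nameS_onto : forall X, exists n, nameS n = X;
  basic_ax : forall p v w, In p PAminus -> sat struct v w p;
  induction_ax : forall p v w, Sigma01 p -> sat struct v w (induction_for p);
  comprehension_ax : forall p q v w, Sigma01 p -> Pi01 q ->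
    sat struct v w (comprehension_for p q);
}.

Lemma RCA0_proves p : boundN p = 0 -> boundS p = 0 ->
  (forall (K : model) v w, sat struct v w p) -> RCA0 |-- p.
Proof.
  intros HN HS H. apply completeness; [apply RCA0_closed|].
  intros K v w Hv Hw HT. unshelve refine (H {| struct := K |} v w); auto.
  - intros q v' w' Hq. apply sat_agree with v w.
    1,2: intros; exfalso; destruct (RCA0_closed q); [now apply RCA0_basic | lia].
    apply HT, RCA0_basic, Hq.
  - intros q v' w' Hq. eapply sat_universal_closure, HT, RCA0_induction, Hq.
  - intros q q' v' w' Hq Hq'. eapply sat_universal_closure, HT, RCA0_comprehension; auto.
Qed.

(** * Linear arithmetic in a model *)

Declare Scope model_scope.
Delimit Scope model_scope with M.
Notation M := (dom struct).
Notation SetM := (sdom struct).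
Bind Scope model_scope with dom.
Notation "0" := (mzero struct) : model_scope.
Notation "1" := (mone struct) : model_scope.
Notation "x + y" := (madd struct x y) : model_scope.
Notation "x * y" := (mmul struct x y) : model_scope.
Notation "x < y" := (mlt struct x y) : model_scope.
Definition mle {K : model} (x y : M) : Prop := mlt struct x y \/ x = y.
Notation "x <= y" := (mle x y) : model_scope.
Notation "x '∈ₘ' X" := (mmem struct x X) (at level 70) : model_scope.
Notation "2" := (1 + 1)%M : model_scope.
Notation "3" := (2 + 1)%M : model_scope.
Notation "4" := (3 + 1)%M : model_scope.
Notation "5" := (4 + 1)%M : model_scope.
Notation "6" := (5 + 1)%M : model_scope.
Notation "7" := (6 + 1)%M : model_scope.
Notation "8" := (7 + 1)%M : model_scope.
Notation "9" := (8 + 1)%M : model_scope.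

Section BasicArithmetic.
Context {K : model}.
Local Open Scope model_scope.

Ltac basic n := exact (basic_ax _ (fun _ => 0) nameS (nth_In PAminus fBot (n := n) ltac:(repeat constructor))).

Lemma madd_assoc (x y z : M) : (x + y) + z = x + (y + z).
Proof. revert x y z. basic 0%nat. Qed.
Lemma madd_comm (x y : M) : x + y = y + x.
Proof. revert x y. basic 1%nat. Qed.
Lemma mmul_assoc (x y z : M) : (x * y) * z = x * (y * z).
Proof. revert x y z. basic 2%nat. Qed.
Lemma mmul_comm (x y : M) : x * y = y * x.
Proof. revert x y. basic 3%nat. Qed.
Lemma mmul_add (x y z : M) : x * (y + z) = x * y + x * z.
Proof. revert x y z. basic 4%nat. Qed.
Lemma madd_0 (x : M) : x + 0 = x.
Proof. revert x. basic 5%nat. Qed.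
Lemma mmul_0 (x : M) : x * 0 = 0.
Proof. revert x. basic 6%nat. Qed.
Lemma mmul_1 (x : M) : x * 1 = x.
Proof. revert x. basic 7%nat. Qed.
Lemma mlt_trans (x y z : M) : x < y /\ y < z -> x < z.
Proof. revert x y z. basic 8%nat. Qed.
Lemma mlt_irrefl (x : M) : ~ x < x.
Proof. revert x. basic 9%nat. Qed.
Lemma mlt_total (x y : M) : x < y \/ x = y \/ y < x.
Proof. revert x y. basic 10%nat. Qed.
Lemma mlt_add (x y z : M) : x < y -> x + z < y + z.
Proof. revert x y z. basic 11%nat. Qed.
Lemma mlt_mul (x y z : M) : 0 < z /\ x < y -> x * z < y * z.
Proof. revert x y z. basic 12%nat. Qed.
Lemma mlt_ex (x y : M) : x < y -> exists z, x + z = y.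
Proof. revert x y. basic 13%nat. Qed.
Lemma mlt_0_1 : 0 < 1.
Proof. refine (proj1 (_ : 0 < 1 /\ forall x : M, 0 < x -> 1 <= x)). basic 14%nat. Qed.
Lemma mlt_1 (x : M) : 0 < x -> 1 <= x.
Proof. revert x. refine (proj2 (_ : 0 < 1 /\ forall x : M, 0 < x -> 1 <= x)). basic 14%nat. Qed.
Lemma mle_0 (x : M) : 0 <= x.
Proof. revert x. basic 15%nat. Qed.

Lemma model_semi_ring : semi_ring_theory 0 1 (madd struct) (mmul struct) (@eq M).
Proof.
  constructor; intros.
  - rewrite madd_comm; apply madd_0.
  - apply madd_comm.
  - symmetry; apply madd_assoc.
  - rewrite mmul_comm; apply mmul_1.
  - rewrite mmul_comm; apply mmul_0.
  - apply mmul_comm.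
  - symmetry; apply mmul_assoc.
  - rewrite !(mmul_comm _ p), mmul_add. reflexivity.
Qed.
Add Ring model_ring : model_semi_ring.

Lemma mlt_asym (x y : M) : x < y -> ~ y < x.
Proof. intros H1 H2. apply (mlt_irrefl x), (mlt_trans x y x); auto. Qed.
Lemma mle_nlt (x y : M) : x <= y <-> ~ y < x.
Proof.
  split.
  - intros [H| ->]; [now apply mlt_asym | apply mlt_irrefl].
  - destruct (mlt_total x y); unfold mle; tauto.
Qed.
Lemma madd_le_cancel (x y z : M) : x + z <= y + z <-> x <= y.
Proof.
  split; intros H.
  - apply mle_nlt; intros N. apply mle_nlt in H. now apply H, mlt_add.
  - destruct H as [H| ->]; [left; now apply mlt_add | now right].
Qed.
Lemma mle_add (x y z t : M) : x <= y -> z <= t -> x + z <= y + t.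
Proof.
  intros H1 H2. apply (madd_le_cancel _ _ z) in H1. apply (madd_le_cancel _ _ y) in H2.
  rewrite !(madd_comm _ y) in H2.
  destruct H1 as [H1|H1], H2 as [H2|H2]; rewrite ?H1, <- ?H2;
    [left; eapply mlt_trans | left | left | right]; eauto; now rewrite ?H2, <- ?H1.
Qed.
Lemma mlt_le_succ (x y : M) : x < y <-> x + 1 <= y.
Proof.
  split.
  - intros H. destruct (mlt_ex x y H) as [z <-]. assert (Hz := mle_0 z). destruct Hz as [Hz| <-].
    + apply mlt_1 in Hz. apply mle_add; auto. now right.
    + rewrite madd_0 in H. now apply mlt_irrefl in H.
  - assert (L : x < x + 1).
    { assert (L := mlt_add 0 1 x mlt_0_1). replace (0 + x) with x in L by ring. now rewrite madd_comm. }
    intros [H| <-]; auto. eapply mlt_trans; eauto.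
Qed.

(** Polynomials are kept as association lists from monomials (sorted lists of atoms) to
    integers; negative coefficients are accounted for on the other side of an inequality. *)
Definition mono : Type := list nat.
Definition lpoly : Type := list (mono * Z).

Inductive pexp : Type :=
| PVar : nat -> pexp | PZero | POne | PAdd : pexp -> pexp -> pexp | PMul : pexp -> pexp -> pexp.

Section Soundness.
Variable env : list M.

Fixpoint peval (e : pexp) : M :=
  match e with
  | PVar n => nth n env 0
  | PZero => 0
  | POne => 1
  | PAdd a b => peval a + peval b
  | PMul a b => peval a * peval b
  end.

Fixpoint mono_eval (m : mono) : M :=
  match m with [] => 1 | n :: m' => nth n env 0 * mono_eval m' end.

Definition scal (n : nat) (x : M) : M := Nat.iter n (fun y => x + y) 0.

Lemma scal_add n m x : scal (n + m) x = scal n x + scal m x.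
Proof. induction n; simpl; [|unfold scal in *; simpl; rewrite IHn]; unfold scal; simpl; ring. Qed.
Lemma scal_mul n m x : scal (n * m) x = scal n (scal m x).
Proof. induction n; simpl; auto. rewrite scal_add, IHn. reflexivity. Qed.
Lemma scal_distr n x y : scal n (x + y) = scal n x + scal n y.
Proof. induction n; [|unfold scal in *; simpl; rewrite IHn]; unfold scal; simpl; ring. Qed.
Lemma scal_mul_r n x y : scal n x * y = scal n (x * y).
Proof. induction n; unfold scal in *; simpl; [ring|]. rewrite <- IHn; ring. Qed.
Lemma scal_le n x y : x <= y -> scal n x <= scal n y.
Proof. intros H; induction n; [now right|]. unfold scal in *; simpl. now apply mle_add. Qed.

Definition zpos (z : Z) (x : M) : M := scal (Z.to_nat z) x.
Definition zneg (z : Z) (x : M) : M := scal (Z.to_nat (- z)) x.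

Lemma zposneg_add a b x : zpos (a + b) x + (zneg a x + zneg b x) = zneg (a + b) x + (zpos a x + zpos b x).
Proof. unfold zpos, zneg. rewrite <- !scal_add. f_equal. lia. Qed.

Fixpoint lpos (L : lpoly) : M :=
  match L with [] => 0 | (m, z) :: L' => zpos z (mono_eval m) + lpos L' end.
Fixpoint lneg (L : lpoly) : M :=
  match L with [] => 0 | (m, z) :: L' => zneg z (mono_eval m) + lneg L' end.

(** [L] stands for the difference of [x] and [y], written without subtraction; accordingly [holds L]
    says that the value of [L] is not negative. *)
Definition denotes (L : lpoly) (x y : M) : Prop := lpos L + y = lneg L + x.
Definition holds (L : lpoly) : Prop := lneg L <= lpos L.

Lemma denotes_holds L x y : denotes L x y -> (holds L <-> y <= x).
Proof.
  unfold denotes, holds. intros H.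
  rewrite <- (madd_le_cancel _ _ y), H, (madd_comm (lneg L) y), (madd_comm (lneg L) x).
  apply madd_le_cancel.
Qed.

Fixpoint mono_eqb (m m' : mono) : bool :=
  match m, m' with
  | [], [] => true
  | a :: m, b :: m' => Nat.eqb a b && mono_eqb m m'
  | _, _ => false
  end.

Lemma mono_eqb_eq m : forall m', mono_eqb m m' = true -> m = m'.
Proof.
  induction m; intros [|b m']; simpl; try easy. intros H.
  apply andb_prop in H as [H1 H2]. apply Nat.eqb_eq in H1. f_equal; auto.
Qed.

Fixpoint ladd1 (m : mono) (z : Z) (L : lpoly) : lpoly :=
  match L with
  | [] => [(m, z)]
  | (m', z') :: L' =>
    if mono_eqb m m' then
      (if Z.eqb (z + z') 0 then L' else (m, (z + z')%Z) :: L')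
    else (m', z') :: ladd1 m z L'
  end.

Lemma ladd1_denotes m z L :
  denotes (ladd1 m z L) (zpos z (mono_eval m) + lpos L) (zneg z (mono_eval m) + lneg L).
Proof.
  unfold denotes. induction L as [|[m' z'] L IH]; simpl; [ring|].
  destruct (mono_eqb m m') eqn:E.
  - apply mono_eqb_eq in E; subst m'. assert (A := zposneg_add z z' (mono_eval m)).
    destruct (Z.eqb_spec (z + z') 0) as [E|E]; simpl.
    + rewrite E in A. change (zpos 0 (mono_eval m)) with (0 : M) in A.
      change (zneg 0 (mono_eval m)) with (0 : M) in A.
      transitivity (lpos L + lneg L + (0 + (zneg z (mono_eval m) + zneg z' (mono_eval m)))); [ring|].
      rewrite A. ring.
    + transitivity (lpos L + lneg L + (zpos (z + z') (mono_eval m) + (zneg z (mono_eval m) + zneg z' (mono_eval m)))); [ring|].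
      rewrite A. ring.
  - simpl.
    transitivity (lpos (ladd1 m z L) + (zneg z (mono_eval m) + lneg L) + (zpos z' (mono_eval m') + zneg z' (mono_eval m'))); [ring|].
    rewrite IH. ring.
Qed.

Fixpoint ladd (L1 L2 : lpoly) : lpoly :=
  match L1 with [] => L2 | (m, z) :: L => ladd1 m z (ladd L L2) end.

Lemma madd_cancel (x y z : M) : x + z = y + z -> x = y.
Proof.
  intros H. assert (A : x <= y) by (apply (madd_le_cancel x y z); now right).
  assert (B : y <= x) by (apply (madd_le_cancel y x z); now right).
  destruct A as [A|]; auto. now apply mle_nlt in B.
Qed.

Lemma denotes_trans L L' x y x' y' :
  denotes L (x' + lpos L') (y' + lneg L') -> denotes L' x y -> denotes L (x' + x) (y' + y).
Proof.
  unfold denotes. intros H1 H2.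
  apply (madd_cancel _ _ (lpos L' + lneg L')).
  transitivity ((lpos L + (y' + lneg L')) + (lpos L' + y)); [ring|].
  rewrite H1, H2; ring.
Qed.

Lemma ladd_denotes L1 L2 : denotes (ladd L1 L2) (lpos L1 + lpos L2) (lneg L1 + lneg L2).
Proof.
  induction L1 as [|[m z] L IH]; simpl; [unfold denotes; ring|].
  rewrite !madd_assoc. eapply denotes_trans; [apply ladd1_denotes | exact IH].
Qed.

Definition lscale (n : nat) (L : lpoly) : lpoly :=
  map (fun p => (fst p, (Z.of_nat n * snd p)%Z)) L.

Lemma lscale_eval n L : lpos (lscale n L) = scal n (lpos L) /\ lneg (lscale n L) = scal n (lneg L).
Proof.
  assert (S0 : scal n 0 = 0) by (induction n; unfold scal in *; simpl; rewrite ?IHn; ring).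
  induction L as [|[m z] L [IH1 IH2]]; simpl; [split; auto|].
  rewrite IH1, IH2, !scal_distr. unfold zpos, zneg. rewrite <- !scal_mul.
  split; f_equal; f_equal; lia.
Qed.

Definition lopp (L : lpoly) : lpoly := map (fun p => (fst p, (- snd p)%Z)) L.

Lemma lopp_eval L : lpos (lopp L) = lneg L /\ lneg (lopp L) = lpos L.
Proof.
  induction L as [|[m z] L [IH1 IH2]]; simpl; [split; auto|].
  rewrite IH1, IH2. unfold zpos, zneg. now rewrite Z.opp_involutive.
Qed.

Lemma lscale_holds n L : holds L -> holds (lscale n L).
Proof. unfold holds. destruct (lscale_eval n L) as [-> ->]. apply scal_le. Qed.
Lemma ladd_holds L1 L2 : holds L1 -> holds L2 -> holds (ladd L1 L2).
Proof. intros. apply (denotes_holds _ _ _ (ladd_denotes L1 L2)). now apply mle_add. Qed.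

Fixpoint mono_insert (a : nat) (m : mono) : mono :=
  match m with
  | [] => [a]
  | b :: m' => if Nat.leb a b then a :: m else b :: mono_insert a m'
  end.

Lemma mono_insert_eval a m : mono_eval (mono_insert a m) = nth a env 0 * mono_eval m.
Proof. induction m; simpl; auto. destruct Nat.leb; simpl; auto. rewrite IHm; ring. Qed.

Definition mono_mul (m m' : mono) : mono := fold_right mono_insert m' m.
Lemma mono_mul_eval m m' : mono_eval (mono_mul m m') = mono_eval m * mono_eval m'.
Proof. induction m; simpl; [ring|]. rewrite mono_insert_eval, IHm. ring. Qed.

Definition npoly : Type := list (mono * nat).
Fixpoint neval (P : npoly) : M :=
  match P with [] => 0 | (m, n) :: P' => scal n (mono_eval m) + neval P' end.
Definition nmul1 (m : mono) (n : nat) (P : npoly) : npoly :=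
  map (fun p => (mono_mul m (fst p), n * snd p)%nat) P.
Fixpoint nmul (P Q : npoly) : npoly :=
  match P with [] => [] | (m, n) :: P' => nmul1 m n Q ++ nmul P' Q end.

Lemma neval_app P Q : neval (P ++ Q) = neval P + neval Q.
Proof. induction P as [|[m n] P IH]; simpl; [|rewrite IH]; ring. Qed.
Lemma neval_mul1 m n P : neval (nmul1 m n P) = scal n (mono_eval m) * neval P.
Proof.
  induction P as [|[m' n'] P IH]; simpl; [ring|]. rewrite IH, mono_mul_eval, scal_mul.
  rewrite mmul_add. f_equal. rewrite scal_mul_r. f_equal.
  rewrite (mmul_comm _ (scal _ _)), scal_mul_r. f_equal. ring.
Qed.
Lemma neval_mul P Q : neval (nmul P Q) = neval P * neval Q.
Proof. induction P as [|[m n] P IH]; simpl; [ring|]. rewrite neval_app, neval_mul1, IH. ring. Qed.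

Fixpoint npoly_of (e : pexp) : npoly :=
  match e with
  | PVar n => [([n], 1%nat)]
  | PZero => []
  | POne => [([], 1%nat)]
  | PAdd a b => npoly_of a ++ npoly_of b
  | PMul a b => nmul (npoly_of a) (npoly_of b)
  end.
Lemma npoly_of_eval e : neval (npoly_of e) = peval e.
Proof.
  induction e; simpl; unfold scal; simpl; try ring.
  - rewrite neval_app; congruence.
  - rewrite neval_mul; congruence.
Qed.

Fixpoint lminus (Q : npoly) : lpoly :=
  match Q with [] => [] | (m, n) :: Q' => ladd1 m (- Z.of_nat n) (lminus Q') end.
Fixpoint lsub (P Q : npoly) : lpoly :=
  match P with [] => lminus Q | (m, n) :: P' => ladd1 m (Z.of_nat n) (lsub P' Q) end.
Lemma lsub_denotes P Q : denotes (lsub P Q) (neval P) (neval Q).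
Proof.
  assert (Z1 : forall n x, zpos (Z.of_nat n) x = scal n x) by
    (intros; unfold zpos; now rewrite Nat2Z.id).
  assert (Z2 : forall n x, zneg (Z.of_nat n) x = 0) by
    (intros; unfold zneg; replace (Z.to_nat (- Z.of_nat n)) with 0%nat by lia; reflexivity).
  assert (Z3 : forall n x, zneg (- Z.of_nat n) x = scal n x) by
    (intros; unfold zneg; now rewrite Z.opp_involutive, Nat2Z.id).
  assert (Z4 : forall n x, zpos (- Z.of_nat n) x = 0) by
    (intros; unfold zpos; replace (Z.to_nat (- Z.of_nat n)) with 0%nat by lia; reflexivity).
  assert (B : denotes (lminus Q) 0 (neval Q)).
  { induction Q as [|[m n] Q IH]; simpl; [unfold denotes; simpl; ring|].
    assert (A := ladd1_denotes m (- Z.of_nat n) (lminus Q)). rewrite Z3, Z4 in A.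
    assert (C := denotes_trans _ _ _ _ _ _ A IH). now rewrite madd_0 in C. }
  induction P as [|[m n] P IH]; [exact B|]. simpl.
  assert (A := ladd1_denotes m (Z.of_nat n) (lsub P Q)). rewrite Z1, Z2 in A.
  assert (C := denotes_trans _ _ _ _ _ _ A IH).
  rewrite (madd_comm 0), madd_0 in C. exact C.
Qed.

(** ** Fourier-Motzkin elimination *)
Fixpoint coef (m : mono) (L : lpoly) : Z :=
  match L with
  | [] => 0
  | (m', z) :: L' => if mono_eqb m m' then z else coef m L'
  end.

Definition absurd (L : lpoly) : bool :=
  Z.ltb (coef [] L) 0 && forallb (fun p => Z.leb (snd p) 0) L.

(** Monomials denote non-negative elements. With no positive coefficient and a negative constant,
    the positive part is 0 and the negative part is at least 1. *)
Lemma absurd_sound L : absurd L = true -> ~ holds L.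
Proof.
  unfold absurd. intros H. apply andb_prop in H as [H1 H2]. apply Z.ltb_lt in H1.
  assert (P0 : lpos L = 0).
  { clear H1. induction L as [|[m z] L IH]; simpl in *; auto.
    apply andb_prop in H2 as [H2 H3]. apply Z.leb_le in H2. simpl in H2.
    rewrite IH; auto. unfold zpos. replace (Z.to_nat z) with 0%nat by lia. unfold scal; simpl; ring. }
  assert (N1 : 0 < lneg L).
  { clear P0. induction L as [|[m z] L IH]; simpl in *; [lia|].
    apply andb_prop in H2 as [H2 H3]. apply Z.leb_le in H2. simpl in H2.
    destruct m as [|a m].
    - unfold zneg. assert (exists n, Z.to_nat (- z) = S n) as [n ->] by (exists (Z.to_nat (- z) - 1)%nat; lia).
      unfold scal. simpl. apply mlt_le_succ.
      assert (A := mle_0 (Nat.iter n (fun y => 1 + y) 0 + lneg L)).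
      apply (madd_le_cancel _ _ 1) in A.
      replace (1 + Nat.iter n (fun y => 1 + y) 0 + lneg L) with (Nat.iter n (fun y => 1 + y) 0 + lneg L + 1) by ring.
      exact A.
    - specialize (IH H1 H3). apply mlt_le_succ in IH. apply mlt_le_succ.
      rewrite (madd_comm (zneg _ _)). rewrite <- (madd_0 (0 + 1)). apply mle_add; auto using mle_0. }
  unfold holds. rewrite P0. intros H. apply mle_nlt in H. auto.
Qed.

(** The positive combination in which the monomial [m] cancels, when its coefficients in [L1] and
    [L2] have opposite signs. *)
Definition combine2 (m : mono) (L1 L2 : lpoly) : lpoly :=
  ladd (lscale (Z.abs_nat (coef m L2)) L1) (lscale (Z.abs_nat (coef m L1)) L2).

Definition is_pos (m : mono) (L : lpoly) := Z.ltb 0 (coef m L).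
Definition is_neg (m : mono) (L : lpoly) := Z.ltb (coef m L) 0.
Definition is_zero (m : mono) (L : lpoly) := Z.eqb (coef m L) 0.

Definition eliminate (m : mono) (Ls : list lpoly) : list lpoly :=
  flat_map (fun L1 => map (combine2 m L1) (filter (is_neg m) Ls)) (filter (is_pos m) Ls)
  ++ filter (is_zero m) Ls.

Lemma eliminate_sound m Ls : Forall holds Ls -> Forall holds (eliminate m Ls).
Proof.
  rewrite !Forall_forall. intros H L HL. apply in_app_or in HL as [HL|HL].
  - apply in_flat_map in HL as (L1 & H1 & HL). apply in_map_iff in HL as (L2 & <- & H2).
    apply filter_In in H1, H2. apply ladd_holds; apply lscale_holds; apply H; tauto.
  - apply filter_In in HL. apply H; tauto.
Qed.

Definition holds_eq (E : lpoly) : Prop := holds E /\ holds (lopp E).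

Lemma holds_opp L : holds (lopp L) <-> lpos L <= lneg L.
Proof. unfold holds. destruct (lopp_eval L) as [-> ->]. reflexivity. Qed.

Definition monos (Ls : list lpoly) : list mono :=
  fold_right (fun L acc => fold_right (fun p acc =>
    match fst p with [] => acc | m => if existsb (mono_eqb m) acc then acc else m :: acc end) acc L)
    [] Ls.

Definition cost (Ls : list lpoly) (m : mono) : nat :=
  length (filter (is_pos m) Ls) * length (filter (is_neg m) Ls).

Fixpoint cheapest (Ls : list lpoly) (best : mono) (ms : list mono) : mono :=
  match ms with
  | [] => best
  | m :: ms' => cheapest Ls (if Nat.ltb (cost Ls m) (cost Ls best) then m else best) ms'
  end.

Fixpoint refute (fuel : nat) (Ls : list lpoly) : bool :=
  existsb absurd Ls ||
  match fuel, monos Ls with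
  | S f, m :: ms => refute f (eliminate (cheapest Ls m ms) Ls)
  | _, _ => false
  end.

Lemma refute_sound fuel : forall Ls, refute fuel Ls = true -> Forall holds Ls -> False.
Proof.
  induction fuel; intros Ls H HL; simpl in H; apply Bool.orb_true_iff in H as [H|H]; try easy.
  1,2: apply existsb_exists in H as (L & H1 & H2);
    rewrite Forall_forall in HL; exact (absurd_sound L H2 (HL L H1)).
  destruct (monos Ls); [easy|]. eapply IHfuel; eauto using eliminate_sound.
Qed.

Inductive rel : Type := RLe | RLt | REq.
Definition fact : Type := rel * pexp * pexp.
Definition fact_holds (f : fact) : Prop :=
  match f with
  | (RLe, a, b) => peval a <= peval b
  | (RLt, a, b) => peval a < peval b
  | (REq, a, b) => peval a = peval b
  end.

Fixpoint eqs_of (fs : list fact) : list lpoly :=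
  match fs with
  | [] => []
  | (REq, a, b) :: fs' => lsub (npoly_of b) (npoly_of a) :: eqs_of fs'
  | _ :: fs' => eqs_of fs'
  end.
Fixpoint ineqs_of (fs : list fact) : list lpoly :=
  match fs with
  | [] => []
  | (RLe, a, b) :: fs' => lsub (npoly_of b) (npoly_of a) :: ineqs_of fs'
  | (RLt, a, b) :: fs' => lsub (npoly_of b) (([], 1%nat) :: npoly_of a) :: ineqs_of fs'
  | _ :: fs' => ineqs_of fs'
  end.

(** Products are opaque atoms for the elimination, so the non-negativity of each occurring monomial
    is supplied as an extra inequality. *)
Definition with_nonneg (Ls : list lpoly) : list lpoly :=
  map (fun m => [(m, 1%Z)]) (monos Ls) ++ Ls.

(** The number 30 limits the rounds of elimination; each equation enters as two inequalities. *)
Definition refute_facts (fs : list fact) : bool :=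
  refute 30 (with_nonneg (map lopp (eqs_of fs) ++ eqs_of fs ++ ineqs_of fs)).

Lemma with_nonneg_sound Ls : Forall holds Ls -> Forall holds (with_nonneg Ls).
Proof.
  intros H. apply Forall_app; split; auto. apply Forall_map, Forall_forall.
  intros m _. unfold holds; simpl. unfold zneg, zpos; simpl. unfold scal; simpl.
  replace (0 + 0) with (0 : M) by ring. apply mle_0.
Qed.

Lemma refute_facts_sound fs : refute_facts fs = true -> Forall fact_holds fs -> False.
Proof.
  unfold refute_facts. generalize 30%nat. intros n H HF. refine (refute_sound _ _ H _).
  assert (E1 : forall a b, peval a <= peval b -> holds (lsub (npoly_of b) (npoly_of a))).
  { intros a b Hab. apply (denotes_holds _ _ _ (lsub_denotes _ _)). now rewrite !npoly_of_eval. }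
  assert (E2 : Forall holds_eq (eqs_of fs)).
  { clear H. induction HF as [|[[[] a] b] fs Hf _ IH]; simpl; auto. constructor; auto.
    simpl in Hf. split; [apply E1; now right|].
    assert (D := lsub_denotes (npoly_of b) (npoly_of a)). unfold denotes in D.
    rewrite !npoly_of_eval, Hf in D. apply madd_cancel in D. apply holds_opp. now right. }
  assert (E3 : Forall holds (ineqs_of fs)).
  { clear H E2. induction HF as [|[[[] a] b] fs Hf _ IH]; simpl; auto; constructor; auto.
    apply (denotes_holds _ _ _ (lsub_denotes _ _)). simpl. rewrite !npoly_of_eval.
    unfold scal; simpl. simpl in Hf. apply mlt_le_succ in Hf.
    replace (1 + 0 + peval a) with (peval a + 1) by ring. exact Hf. }
  apply with_nonneg_sound, Forall_app; split; [|apply Forall_app; split; auto].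
  - apply Forall_map. eapply Forall_impl; [|exact E2]. now intros ? [].
  - eapply Forall_impl; [|exact E2]. now intros ? [].
Qed.
End Soundness.

Lemma mnlt_le (x y : M) : ~ x < y -> y <= x.
Proof. intros H; now apply mle_nlt. Qed.
Lemma mnle_lt (x y : M) : ~ x <= y -> y < x.
Proof. intros H. apply NNPP; intros N. now apply H, mle_nlt. Qed.
Lemma mle_antisym (x y : M) : x <= y -> y <= x -> x = y.
Proof. intros [H| ->] H2; auto. now apply mle_nlt in H2. Qed.
End BasicArithmetic.

(** * Reification of hypotheses and the tactic [lin] *)

Ltac in_list x l :=
  match l with
  | nil => constr:(false)
  | cons x _ => constr:(true)
  | cons _ ?l' => in_list x l'
  end.
Ltac index_of x l :=
  match l with
  | cons x _ => constr:(O)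
  | cons _ ?l' => let n := index_of x l' in constr:(S n)
  end.
Ltac collect e l :=
  match e with
  | madd _ ?a ?b => let l1 := collect a l in collect b l1
  | mmul _ ?a ?b => let l1 := collect a l in collect b l1
  | mzero _ => l
  | mone _ => l
  | _ => match in_list e l with true => l | false => constr:(cons e l) end
  end.
Ltac reify e l :=
  match e with
  | madd _ ?a ?b => let a' := reify a l in let b' := reify b l in constr:(PAdd a' b')
  | mmul _ ?a ?b => let a' := reify a l in let b' := reify b l in constr:(PMul a' b')
  | mzero _ => constr:(PZero)
  | mone _ => constr:(POne)
  | _ => let n := index_of e l in constr:(PVar n)
  end.
Ltac lin_hyps hs l fs prf :=
  match hs with
  | tt => constr:((fs, prf))
  | (?h, ?hs') =>
    let T := type of h in
    match T with
    | mlt _ ?a ?b =>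
      let a' := reify a l in let b' := reify b l in
      lin_hyps hs' l constr:(cons (RLt, a', b') fs) constr:(Forall_cons (P := fact_holds l) (RLt, a', b') h prf)
    | mle ?a ?b =>
      let a' := reify a l in let b' := reify b l in
      lin_hyps hs' l constr:(cons (RLe, a', b') fs) constr:(Forall_cons (P := fact_holds l) (RLe, a', b') h prf)
    | ?a = ?b =>
      let a' := reify a l in let b' := reify b l in
      lin_hyps hs' l constr:(cons (REq, a', b') fs) constr:(Forall_cons (P := fact_holds l) (REq, a', b') h prf)
    end
  end.
Ltac lin_atoms hs l :=
  match hs with
  | tt => l
  | (?h, ?hs') =>
    let T := type of h in
    match T with
    | mlt _ ?a ?b => let l1 := collect a l in let l2 := collect b l1 in lin_atoms hs' l2
    | mle ?a ?b => let l1 := collect a l in let l2 := collect b l1 in lin_atoms hs' l2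
    | ?a = ?b => let l1 := collect a l in let l2 := collect b l1 in lin_atoms hs' l2
    end
  end.
(** Hides a hypothesis from the next round of matching, so that [gather] collects each one once. *)
Ltac mark h := let T := type of h in change (id T) in h.
Ltac gather k acc :=
  match goal with
  | h : mlt _ _ _ |- _ => mark h; gather k (h, acc)
  | h : mle _ _ |- _ => mark h; gather k (h, acc)
  | h : @eq (dom _) _ _ |- _ => mark h; gather k (h, acc)
  | _ => unfold id in *|-; k acc
  end.
Ltac lin_false :=
  repeat match goal with
  | h : ~ mlt _ _ _ |- _ => apply mnlt_le in h
  | h : ~ mle _ _ |- _ => apply mnle_lt in h
  | h : mlt _ _ _ -> False |- _ => apply mnlt_le in h
  | h : mle _ _ -> False |- _ => apply mnle_lt in h
  end;
  gather ltac:(fun hs =>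
    match goal with |- False =>
      let s := constr:(@nil (dom struct)) in
      let l := lin_atoms hs s in
      let r := lin_hyps hs l constr:(@nil fact) constr:(Forall_nil (fact_holds l)) in
      match r with (?fs, ?prf) =>
        refine (refute_facts_sound l fs _ prf); vm_compute; reflexivity
      end
    end) tt.
Ltac lin_core :=
  match goal with
  | |- False => lin_false
  | |- ~ _ => let N := fresh in intros N; lin_false
  | |- mlt _ _ _ => let N := fresh in apply NNPP; intros N; lin_false
  | |- mle _ _ => let N := fresh in apply NNPP; intros N; lin_false
  | |- @eq (dom _) _ _ => apply mle_antisym; lin_core
  | |- _ => exfalso; lin_false
  end.
(** [lin] proves linear consequences of the hypotheses, with monomials as atoms. *)
Ltac lin := intros; repeat match goal with
  | h : _ /\ _ |- _ => destruct h
  end; repeat match goal with |- _ /\ _ => split end; lin_core.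

(** * Definability in a model *)

Section Definability.
Context {K : model}.
Local Open Scope model_scope.
Add Ring model_ring : model_semi_ring.

Definition env : Type := nat -> M.
Definition tl (r : env) : env := fun n => r (S n).

(** [T0], [D0], [S1], [D1] and [F1] are the terms, the Delta-0, Sigma-1 and Delta-1 predicates
    and the total functions with a Sigma-1 graph, all over environments; number parameters are
    arbitrary and set parameters come from [A]. *)
Inductive T0 : (env -> M) -> Prop :=
| T0_var k : T0 (fun r => r k)
| T0_const c : T0 (fun _ => c)
| T0_add f g : T0 f -> T0 g -> T0 (fun r => f r + g r)
| T0_mul f g : T0 f -> T0 g -> T0 (fun r => f r * g r).

Inductive D0 (A : SetM -> Prop) : (env -> Prop) -> Prop :=
| D0_bot : D0 A (fun _ => False)
| D0_eq f g : T0 f -> T0 g -> D0 A (fun r => f r = g r)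
| D0_lt f g : T0 f -> T0 g -> D0 A (fun r => f r < g r)
| D0_mem f X : A X -> T0 f -> D0 A (fun r => f r ∈ₘ X)
| D0_imp P Q : D0 A P -> D0 A Q -> D0 A (fun r => P r -> Q r)
| D0_and P Q : D0 A P -> D0 A Q -> D0 A (fun r => P r /\ Q r)
| D0_or P Q : D0 A P -> D0 A Q -> D0 A (fun r => P r \/ Q r)
| D0_all t P : T0 t -> D0 A P -> D0 A (fun r => forall x, x < t r -> P (x .: r))
| D0_ex t P : T0 t -> D0 A P -> D0 A (fun r => exists x, x < t r /\ P (x .: r)).

Definition S1 (A : SetM -> Prop) (P : env -> Prop) : Prop :=
  exists Q, D0 A Q /\ forall r, P r <-> exists x, Q (x .: r).

Definition D1 (A : SetM -> Prop) (P : env -> Prop) : Prop :=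
  S1 A P /\ S1 A (fun r => ~ P r).

Definition F1 (A : SetM -> Prop) (f : env -> M) : Prop := S1 A (fun r => r 0%nat = f (tl r)).

(** The first [n] variables read the environment and the later ones run through the names of all
    elements, so every parameter becomes a variable. The offset [n] stays adjustable in the next
    lemmas because two subformulas must share it and a bounded quantifier raises it by one. *)
Definition splice (n : nat) (r pi : env) : env := fun k => if k <? n then r k else pi (k - n)%nat.

Lemma splice_cons n x r pi : splice (S n) (x .: r) pi = x .: splice n r pi.
Proof. extensionality k; destruct k; reflexivity. Qed.

Lemma T0_term f : T0 f -> exists N, forall n, (N <= n)%nat ->
  exists t, forall r, f r = eval struct (splice n r nameN) t.
Proof.
  induction 1 as [k|c|f g _ [N1 H1] _ [N2 H2]|f g _ [N1 H1] _ [N2 H2]].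
  - exists (S k). intros n Hn. exists (tVar k). intros r. simpl. unfold splice.
    destruct (Nat.ltb_spec k n); [easy | lia].
  - exists 0%nat. intros n _. destruct (nameN_onto c) as [k <-]. exists (tVar (n + k)).
    intros r. simpl. unfold splice. destruct (Nat.ltb_spec (n + k) n); [lia|]. f_equal; lia.
  - exists (N1 + N2)%nat. intros n Hn. destruct (H1 n) as [t1 E1], (H2 n) as [t2 E2]; try lia.
    exists (tAdd t1 t2). intros r. simpl. now rewrite E1, E2.
  - exists (N1 + N2)%nat. intros n Hn. destruct (H1 n) as [t1 E1], (H2 n) as [t2 E2]; try lia.
    exists (tMul t1 t2). intros r. simpl. now rewrite E1, E2.
Qed.

Lemma eval_shift v x t : eval struct (x .: v) (shift_term t) = eval struct v t.
Proof. induction t; simpl; unfold shift_term in *; congruence. Qed.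

Lemma D0_form A P : D0 A P -> exists N, forall n, (N <= n)%nat ->
  exists p, Delta00 p /\ forall r, P r <-> sat struct (splice n r nameN) nameS p.
Proof.
  induction 1 as [|f g Hf Hg|f g Hf Hg|f X _ Hf|P Q _ [N1 H1] _ [N2 H2]|P Q _ [N1 H1] _ [N2 H2]
    |P Q _ [N1 H1] _ [N2 H2]|t P Ht _ [N H]|t P Ht _ [N H]].
  - exists 0%nat. intros n _. exists fBot. split; [constructor | reflexivity].
  - apply T0_term in Hf as [N1 H1], Hg as [N2 H2]. exists (N1 + N2)%nat. intros n Hn.
    destruct (H1 n) as [t1 E1], (H2 n) as [t2 E2]; try lia.
    exists (fEq t1 t2). split; [constructor|]. intros r. simpl. now rewrite E1, E2.
  - apply T0_term in Hf as [N1 H1], Hg as [N2 H2]. exists (N1 + N2)%nat. intros n Hn.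
    destruct (H1 n) as [t1 E1], (H2 n) as [t2 E2]; try lia.
    exists (fLt t1 t2). split; [constructor|]. intros r. simpl. now rewrite E1, E2.
  - apply T0_term in Hf as [N1 H1]. exists N1. intros n Hn. destruct (H1 n Hn) as [t1 E1].
    destruct (nameS_onto X) as [k <-].
    exists (fMem t1 k). split; [constructor|]. intros r. simpl. now rewrite E1.
  - exists (N1 + N2)%nat. intros n Hn. destruct (H1 n) as [p [? E1]], (H2 n) as [q [? E2]]; try lia.
    exists (fImp p q). split; [now constructor|]. intros r. simpl. now rewrite E1, E2.
  - exists (N1 + N2)%nat. intros n Hn. destruct (H1 n) as [p [? E1]], (H2 n) as [q [? E2]]; try lia.
    exists (fAnd p q). split; [now constructor|]. intros r. simpl. now rewrite E1, E2.
  - exists (N1 + N2)%nat. intros n Hn. destruct (H1 n) as [p [? E1]], (H2 n) as [q [? E2]]; try lia.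
    exists (fOr p q). split; [now constructor|]. intros r. simpl. now rewrite E1, E2.
  - apply T0_term in Ht as [N1 H1]. exists (N + N1)%nat. intros n Hn.
    destruct (H (S n)) as [p [? E]], (H1 n) as [s E1]; try lia.
    exists (fAllN (fImp (fLt (tVar 0) (shift_term s)) p)). split; [now constructor|].
    intros r. simpl. setoid_rewrite eval_shift. setoid_rewrite <- E1.
    setoid_rewrite E. setoid_rewrite splice_cons. reflexivity.
  - apply T0_term in Ht as [N1 H1]. exists (N + N1)%nat. intros n Hn.
    destruct (H (S n)) as [p [? E]], (H1 n) as [s E1]; try lia.
    exists (fExN (fAnd (fLt (tVar 0) (shift_term s)) p)). split; [now constructor|].
    intros r. simpl. setoid_rewrite eval_shift. setoid_rewrite <- E1.
    setoid_rewrite E. setoid_rewrite splice_cons. reflexivity.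
Qed.

Lemma S1_form A P : S1 A (fun r => P (r 0%nat)) ->
  exists p v, Delta00 p /\ forall x, P x <-> sat struct (x .: v) nameS (fExN p).
Proof.
  intros (Q & HQ & E). apply D0_form in HQ as [N H].
  destruct (H (S (S N)) ltac:(lia)) as [p [Hp Ep]].
  exists p, (splice N (fun _ => 0) nameN). split; auto. intros x.
  rewrite (E (x .: fun _ => 0)). simpl. setoid_rewrite Ep.
  setoid_rewrite splice_cons. setoid_rewrite splice_cons. reflexivity.
Qed.

Lemma D0_mono (A B : SetM -> Prop) P : (forall X, A X -> B X) -> D0 A P -> D0 B P.
Proof. intros H. induction 1; constructor; auto. Qed.
Lemma S1_mono (A B : SetM -> Prop) P : (forall X, A X -> B X) -> S1 A P -> S1 B P.
Proof. intros H (Q & HQ & E). exists Q. split; auto. now apply (D0_mono A). Qed.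
Lemma D1_mono (A B : SetM -> Prop) P : (forall X, A X -> B X) -> D1 A P -> D1 B P.
Proof. intros H [H1 H2]. split; now apply (S1_mono A). Qed.
Lemma F1_mono (A B : SetM -> Prop) f : (forall X, A X -> B X) -> F1 A f -> F1 B f.
Proof. apply S1_mono. Qed.

Lemma S1_induction A (P : M -> Prop) : S1 A (fun r => P (r 0%nat)) ->
  P 0 -> (forall x, P x -> P (x + 1)) -> forall x, P x.
Proof.
  intros HP H0 HS. destruct (S1_form A P HP) as (p & v & Hp & E).
  assert (I := induction_ax (fExN p) v nameS (Sigma01_ex p Hp)).
  assert (I' : forall x, sat struct (x .: v) nameS (fExN p)).
  { apply I. split.
    - unfold instN. rewrite sat_subst.
      replace (fun n => _) with (0 .: v) by (extensionality n; now destruct n).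
      now apply E.
    - intros x Hx. rewrite sat_subst.
      replace (fun n => _) with (x + 1 .: v) by (extensionality n; now destruct n).
      apply E, HS, E, Hx. }
  intros x. apply E, I'.
Qed.

Lemma D1_comprehension A (P : M -> Prop) : D1 A (fun r => P (r 0%nat)) ->
  exists X, forall x, x ∈ₘ X <-> P x.
Proof.
  intros [H1 (Q & HQ & EQ)]. destruct H1 as (R & HR & ER).
  apply D0_form in HQ as [N1 H1], HR as [N2 H2]. set (n := (N1 + N2)%nat).
  destruct (H1 (S (S n)) ltac:(lia)) as [q [Hq Eq]], (H2 (S (S n)) ltac:(lia)) as [p [Hp Ep]].
  set (v := splice n (fun _ => 0) nameN).
  assert (E1 : forall x, P x <-> sat struct (x .: v) nameS (fExN p)).
  { intros x. rewrite (ER (x .: fun _ => 0)). simpl. setoid_rewrite Ep.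
    setoid_rewrite splice_cons. setoid_rewrite splice_cons. reflexivity. }
  (* The Pi-1 form required by the comprehension axiom is the negation of the Sigma-1 form of the
     complement. *)
  assert (E2 : forall x, P x <-> sat struct (x .: v) nameS (fAllN (fNot q))).
  { intros x. assert (N := EQ (x .: fun _ => 0)). simpl in N. setoid_rewrite Eq in N.
    setoid_rewrite splice_cons in N. setoid_rewrite splice_cons in N. simpl. fold v in N.
    split; [intros Hx y Hy; apply N; eauto | intros Hx; apply NNPP; rewrite N; firstorder]. }
  assert (C := comprehension_ax (fExN p) (fAllN (fNot q)) v nameS (Sigma01_ex p Hp)
     (Pi01_all _ (D_imp _ _ Hq D_bot))).
  destruct C as [X HX].
  - intros x. split; intros; [apply E2, E1 | apply E1, E2]; auto.
  - exists X. intros x. specialize (HX x). unfold shiftS in HX.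
    rewrite E1. rewrite <- (subst_form_id (fExN p)), sat_subst.
    destruct HX as [HX1 HX2]. rewrite sat_subst in HX1, HX2. exact (conj HX1 HX2).
Qed.

Lemma T0_subst f : T0 f -> forall s : env -> env, (forall k, T0 (fun r => s r k)) ->
  T0 (fun r => f (s r)).
Proof. induction 1; intros s Hs; [apply Hs | constructor.. | constructor | constructor]; auto. Qed.

Lemma D0_subst A P : D0 A P -> forall s : env -> env, (forall k, T0 (fun r => s r k)) ->
  D0 A (fun r => P (s r)).
Proof.
  induction 1; intros s Hs; try (constructor; auto using T0_subst; fail).
  - apply (D0_all A (fun r => t (s r)) (fun r => P (r 0%nat .: s (tl r)))); auto using T0_subst.
    apply (IHD0 (fun r => r 0%nat .: s (tl r))). intros [|k]; simpl; [constructor|].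
    apply (T0_subst _ (Hs k) tl). intros; unfold tl; constructor.
  - apply (D0_ex A (fun r => t (s r)) (fun r => P (r 0%nat .: s (tl r)))); auto using T0_subst.
    apply (IHD0 (fun r => r 0%nat .: s (tl r))). intros [|k]; simpl; [constructor|].
    apply (T0_subst _ (Hs k) tl). intros; unfold tl; constructor.
Qed.

Lemma T0_scons (s : env -> env) f : T0 f -> (forall k, T0 (fun r => s r k)) ->
  forall k, T0 (fun r => (f r .: s r) k).
Proof. intros ? ? [|k]; simpl; auto. Qed.

Lemma S1_ext A (P Q : env -> Prop) : (forall r, P r <-> Q r) -> S1 A P -> S1 A Q.
Proof.
  intros H. replace Q with P; auto. extensionality r. now apply propositional_extensionality.
Qed.

Lemma D1_ext A (P Q : env -> Prop) : (forall r, P r <-> Q r) -> D1 A P -> D1 A Q.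
Proof.
  intros H. replace Q with P; auto. extensionality r. now apply propositional_extensionality.
Qed.

Hint Constructors T0 : t0.
Hint Resolve T0_scons : t0.

Lemma S1_D0 A P : D0 A P -> S1 A P.
Proof.
  intros H. exists (fun r => P (tl r)). split.
  - apply (D0_subst A P H tl); unfold tl; auto with t0.
  - intros r. split; [exists 0; auto | intros [? Hx]; auto].
Qed.

Lemma S1_subst A P : S1 A P -> forall s : env -> env, (forall k, T0 (fun r => s r k)) ->
  S1 A (fun r => P (s r)).
Proof.
  intros (Q & HQ & E) s Hs. exists (fun r => Q (r 0%nat .: s (tl r))). split.
  - apply (D0_subst A Q HQ (fun r => r 0%nat .: s (tl r))). apply T0_scons; auto with t0.
    intros k. apply (T0_subst _ (Hs k) tl); unfold tl; auto with t0.
  - intros r. simpl. rewrite E. reflexivity.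
Qed.

Lemma lt_max (x y : M) : exists z, x < z /\ y < z.
Proof. exists (x + y + 1). split; lin. Qed.

(** A single unbounded quantifier remains: it gives a common bound for the two witnesses, which
    become bounded. *)
Lemma S1_and A P Q : S1 A P -> S1 A Q -> S1 A (fun r => P r /\ Q r).
Proof.
  intros (P' & HP & EP) (Q' & HQ & EQ).
  exists (fun r => (exists x, x < r 0%nat /\ P' (x .: tl r)) /\ exists x, x < r 0%nat /\ Q' (x .: tl r)).
  split.
  - apply D0_and; [apply (D0_ex A (fun r => r 0%nat) (fun r => P' (r 0%nat .: tl (tl r))))
                  | apply (D0_ex A (fun r => r 0%nat) (fun r => Q' (r 0%nat .: tl (tl r))))];
      auto with t0; eapply D0_subst; auto; unfold tl; auto with t0.
  - intros r. rewrite EP, EQ. simpl. split.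
    + intros [[x Hx] [y Hy]]. destruct (lt_max x y) as (z & ? & ?).
      exists z. split; [exists x | exists y]; auto.
    + intros [z [(x & _ & Hx) (y & _ & Hy)]]. split; [exists x | exists y]; auto.
Qed.

Lemma S1_or A P Q : S1 A P -> S1 A Q -> S1 A (fun r => P r \/ Q r).
Proof.
  intros (P' & HP & EP) (Q' & HQ & EQ). exists (fun r => P' r \/ Q' r). split.
  - now apply D0_or.
  - intros r. rewrite EP, EQ. firstorder.
Qed.

Lemma S1_ex A (P : env -> M -> Prop) :
  S1 A (fun r => P (tl r) (r 0%nat)) -> S1 A (fun r => exists x, P r x).
Proof.
  intros (P' & HP & EP).
  exists (fun r => exists x, x < r 0%nat /\ exists y, y < r 0%nat /\ P' (y .: x .: tl r)). split.
  - apply (D0_ex A (fun r => r 0%nat) (fun r => exists y, y < r 1%nat /\ P' (y .: r 0%nat .: tl (tl r)))); auto with t0.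
    apply (D0_ex A (fun r => r 1%nat) (fun r => P' (r 0%nat .: r 1%nat .: tl (tl (tl r))))); auto with t0.
    eapply D0_subst; auto. unfold tl; auto with t0.
  - intros r. split.
    + intros [x Hx]. apply (EP (x .: r)) in Hx as [y Hy]. destruct (lt_max x y) as (z & ? & ?).
      exists z, x. split; auto. exists y; auto.
    + intros (z & x & _ & y & _ & Hy). exists x. apply (EP (x .: r)). eauto.
Qed.

(** This is Sigma-1 bounding, derived from Sigma-1 induction on [j]: one bound [b] serves the
    witnesses of all [x] below [j]. The disjunct [t r < j] makes the induction statement trivial
    beyond the bound of the quantifier. *)
Lemma S1_all_T0 A (t : env -> M) (P : env -> M -> Prop) : T0 t ->
  S1 A (fun r => P (tl r) (r 0%nat)) -> S1 A (fun r => forall x, x < t r -> P r x).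
Proof.
  intros Ht (P' & HP & EP).
  assert (E : forall r x, P r x <-> exists y, P' (y .: x .: r)) by (intros r x; apply (EP (x .: r))).
  exists (fun r => forall x, x < t (tl r) -> exists y, y < r 0%nat /\ P' (y .: x .: tl r)). split.
  - apply (D0_all A (fun r => t (tl r)) (fun r => exists y, y < r 1%nat /\ P' (y .: r 0%nat .: tl (tl r)))).
    + apply (T0_subst _ Ht). unfold tl; auto with t0.
    + apply (D0_ex A (fun r => r 1%nat) (fun r => P' (r 0%nat .: r 1%nat .: tl (tl (tl r))))); auto with t0.
      eapply D0_subst; auto. unfold tl; auto with t0.
  - intros r. simpl. change (tl (?x .: r)) with r. split.
    + intros H.
      assert (I : forall j, t r < j \/ exists b, forall x, x < j -> exists y, y < b /\ P' (y .: x .: r)).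
      { apply (S1_induction A (fun j => t r < j \/ exists b, forall x, x < j -> exists y, y < b /\ P' (y .: x .: r))).
        - exists (fun r' => t r < r' 1%nat \/ forall x, x < r' 1%nat -> exists y, y < r' 0%nat /\ P' (y .: x .: r)).
          split.
          + apply D0_or; [apply D0_lt; auto with t0|].
            apply (D0_all A (fun r => r 1%nat) (fun r' => exists y, y < r' 1%nat /\ P' (y .: r' 0%nat .: r))); auto with t0.
            apply (D0_ex A (fun r => r 1%nat) (fun r' => P' (r' 0%nat .: r' 1%nat .: r))); auto with t0.
            eapply D0_subst; auto. auto with t0.
          + intros r'; simpl. split; [intros [?|[b ?]]; [exists 0 | exists b]; auto |
              intros [b [?|?]]; eauto].
        - right. exists 0. intros x Hx. exfalso. lin.
        - intros j [?|[b Hb]]; [left; lin|].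
          destruct (classic (j < t r)) as [Hj|Hj]; [|left; lin].
          right. destruct (proj1 (E r j) (H j Hj)) as [y Hy].
          exists (b + y + 1). intros x Hx. destruct (classic (x < j)) as [Hxj|Hxj].
          + destruct (Hb x Hxj) as (y' & ? & ?). exists y'. split; auto. lin.
          + exists y. split; [lin|]. replace x with j; auto. lin. }
      destruct (I (t r)) as [?|[b Hb]]; [exfalso; lin|]. exists b. auto.
    + intros [b Hb] x Hx. apply E. destruct (Hb x Hx) as (y & _ & Hy). eauto.
Qed.

Lemma T0_F1 A f : T0 f -> F1 A f.
Proof.
  intros H. apply S1_D0, D0_eq; auto with t0. apply (T0_subst _ H). unfold tl; auto with t0.
Qed.

Lemma S1_comp A (P : env -> M -> Prop) f : S1 A (fun r => P (tl r) (r 0%nat)) -> F1 A f ->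
  S1 A (fun r => P r (f r)).
Proof.
  intros HP Hf. apply S1_ext with (fun r => exists y, y = f r /\ P r y).
  - intros r. split; [intros (y & -> & ?) | ]; eauto.
  - apply S1_ex, S1_and; auto.
Qed.

(** Since [f] is total, the failure of [P] at its value is also an existential statement about that
    value, hence Sigma-1. *)
Lemma D1_comp A (P : env -> M -> Prop) f : D1 A (fun r => P (tl r) (r 0%nat)) -> F1 A f ->
  D1 A (fun r => P r (f r)).
Proof. intros [H1 H2] Hf. split; [|apply (S1_comp A (fun r x => ~ P r x) f)]; auto. now apply S1_comp. Qed.

Lemma F1_tl A f : F1 A f -> F1 A (fun r => f (tl r)).
Proof.
  intros H. apply (S1_subst A _ H (fun r => r 0%nat .: tl (tl r))). unfold tl; auto with t0.
Qed.

Lemma F1_comp A (g : env -> M -> M) f : F1 A (fun r => g (tl r) (r 0%nat)) -> F1 A f ->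
  F1 A (fun r => g r (f r)).
Proof.
  intros Hg Hf. unfold F1.
  apply (S1_comp A (fun r y => r 0%nat = g (tl r) y) (fun r => f (tl r))); [|now apply F1_tl].
  apply (S1_subst A _ Hg (fun r => r 1%nat .: r 0%nat .: tl (tl r))). unfold tl; auto with t0.
Qed.

Lemma D1_S1 A P : D1 A P -> S1 A P.
Proof. now intros []. Qed.

Lemma D1_not A P : D1 A P -> D1 A (fun r => ~ P r).
Proof.
  intros [H1 H2]. split; auto. apply S1_ext with P; auto. intros r. split; auto. apply NNPP.
Qed.

Lemma D0_D1 A P : D0 A P -> D1 A P.
Proof. intros H. split; apply S1_D0; auto. apply D0_imp; auto. apply D0_bot. Qed.

Lemma D1_and A P Q : D1 A P -> D1 A Q -> D1 A (fun r => P r /\ Q r).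
Proof.
  intros [P1 P2] [Q1 Q2]. split; [now apply S1_and|].
  apply S1_ext with (fun r => ~ P r \/ ~ Q r); [|now apply S1_or]. intros r; tauto.
Qed.

Lemma D1_or A P Q : D1 A P -> D1 A Q -> D1 A (fun r => P r \/ Q r).
Proof.
  intros [P1 P2] [Q1 Q2]. split; [now apply S1_or|].
  apply S1_ext with (fun r => ~ P r /\ ~ Q r); [|now apply S1_and]. intros r; tauto.
Qed.

Lemma D1_imp A P Q : D1 A P -> D1 A Q -> D1 A (fun r => P r -> Q r).
Proof.
  intros HP HQ. apply D1_ext with (fun r => ~ P r \/ Q r); [intros r; tauto|].
  apply D1_or; auto. now apply D1_not.
Qed.

Lemma D1_iff A P Q : D1 A P -> D1 A Q -> D1 A (fun r => P r <-> Q r).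
Proof. intros. apply D1_and; now apply D1_imp. Qed.

Lemma S1_imp A P Q : D1 A P -> S1 A Q -> S1 A (fun r => P r -> Q r).
Proof.
  intros HP HQ. apply S1_ext with (fun r => ~ P r \/ Q r); [intros r; tauto|].
  apply S1_or; auto. apply HP.
Qed.

Lemma S1_lt A f g : F1 A f -> F1 A g -> S1 A (fun r => f r < g r).
Proof.
  intros Hf Hg. apply (S1_comp A (fun r x => x < g r) f); auto.
  apply (S1_comp A (fun r x => r 0%nat < x)); [|now apply F1_tl].
  apply S1_D0, D0_lt; unfold tl; auto with t0.
Qed.

Lemma D1_eq A f g : F1 A f -> F1 A g -> D1 A (fun r => f r = g r).
Proof.
  intros Hf Hg. apply (D1_comp A (fun r x => x = g r) f); auto.
  apply (D1_comp A (fun r x => r 0%nat = x)); [|now apply F1_tl].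
  apply D0_D1, D0_eq; unfold tl; auto with t0.
Qed.

Lemma D1_lt A f g : F1 A f -> F1 A g -> D1 A (fun r => f r < g r).
Proof.
  intros Hf Hg. apply (D1_comp A (fun r x => x < g r) f); auto.
  apply (D1_comp A (fun r x => r 0%nat < x)); [|now apply F1_tl].
  apply D0_D1, D0_lt; unfold tl; auto with t0.
Qed.

Lemma D1_le A f g : F1 A f -> F1 A g -> D1 A (fun r => f r <= g r).
Proof. intros. apply D1_or; [now apply D1_lt | now apply D1_eq]. Qed.

Lemma D1_mem A (X : SetM) f : A X -> F1 A f -> D1 A (fun r => f r ∈ₘ X).
Proof.
  intros HX Hf. apply (D1_comp A (fun r x => x ∈ₘ X) f); auto. apply D0_D1, D0_mem; auto with t0.
Qed.

Lemma S1_all A (t : env -> M) (P : env -> M -> Prop) : F1 A t ->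
  S1 A (fun r => P (tl r) (r 0%nat)) -> S1 A (fun r => forall x, x < t r -> P r x).
Proof.
  intros Ht HP. apply (S1_comp A (fun r b => forall x, x < b -> P r x) t); auto.
  apply (S1_all_T0 A (fun r => r 0%nat) (fun r x => P (tl r) x)); auto with t0.
  apply (S1_subst A _ HP (fun r => r 0%nat .: tl (tl r))). unfold tl; auto with t0.
Qed.

Lemma S1_bex A (t : env -> M) (P : env -> M -> Prop) : F1 A t ->
  S1 A (fun r => P (tl r) (r 0%nat)) -> S1 A (fun r => exists x, x < t r /\ P r x).
Proof.
  intros Ht HP. apply (S1_ex A (fun r x => x < t r /\ P r x)).
  apply S1_and; auto. apply S1_lt; [apply T0_F1; auto with t0 | now apply F1_tl].
Qed.

Lemma D1_all A (t : env -> M) (P : env -> M -> Prop) : F1 A t ->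
  D1 A (fun r => P (tl r) (r 0%nat)) -> D1 A (fun r => forall x, x < t r -> P r x).
Proof.
  intros Ht [H1 H2]. split; [now apply S1_all|].
  apply S1_ext with (fun r => exists x, x < t r /\ ~ P r x).
  - intros r. split; [firstorder|]. intros H. apply NNPP; intros N. apply H. intros x Hx.
    apply NNPP; intros Nx. apply N; eauto.
  - now apply S1_bex.
Qed.

Lemma D1_bex A (t : env -> M) (P : env -> M -> Prop) : F1 A t ->
  D1 A (fun r => P (tl r) (r 0%nat)) -> D1 A (fun r => exists x, x < t r /\ P r x).
Proof.
  intros Ht [H1 H2]. split; [now apply S1_bex|].
  apply S1_ext with (fun r => forall x, x < t r -> ~ P r x); [firstorder|].
  now apply S1_all.
Qed.

Lemma F1_add A f g : F1 A f -> F1 A g -> F1 A (fun r => f r + g r).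
Proof.
  intros Hf Hg. apply (F1_comp A (fun r x => x + g r) f); auto.
  apply (F1_comp A (fun r x => r 0%nat + x)); [|now apply F1_tl].
  apply T0_F1; unfold tl; auto with t0.
Qed.

Lemma F1_mul A f g : F1 A f -> F1 A g -> F1 A (fun r => f r * g r).
Proof.
  intros Hf Hg. apply (F1_comp A (fun r x => x * g r) f); auto.
  apply (F1_comp A (fun r x => r 0%nat * x)); [|now apply F1_tl].
  apply T0_F1; unfold tl; auto with t0.
Qed.

Lemma F1_var A k : F1 A (fun r => r k).
Proof. apply T0_F1; auto with t0. Qed.
Lemma F1_const A c : F1 A (fun _ => c).
Proof. apply T0_F1; auto with t0. Qed.

Lemma F1_graph A f (R : env -> M -> Prop) : (forall r y, R r y <-> y = f r) ->
  S1 A (fun r => R (tl r) (r 0%nat)) -> F1 A f.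
Proof. intros H. apply S1_ext. intros r. apply H. Qed.

Definition ite (P : Prop) (x y : M) : M := if excluded_middle_informative P then x else y.
Lemma ite_true (P : Prop) x y : P -> ite P x y = x.
Proof. intros; unfold ite; destruct excluded_middle_informative; easy. Qed.
Lemma ite_false (P : Prop) x y : ~ P -> ite P x y = y.
Proof. intros; unfold ite; destruct excluded_middle_informative; easy. Qed.

Lemma D1_subst A P : D1 A P -> forall s : env -> env, (forall k, T0 (fun r => s r k)) ->
  D1 A (fun r => P (s r)).
Proof. intros [H1 H2] s Hs. split; [now apply S1_subst | now apply (S1_subst A _ H2 s)]. Qed.

Lemma S1_tl A P : S1 A P -> S1 A (fun r => P (tl r)).
Proof. intros H. apply (S1_subst A P H tl). unfold tl; auto with t0. Qed.
Lemma D1_tl A P : D1 A P -> D1 A (fun r => P (tl r)).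
Proof. intros [H1 H2]. split; [now apply S1_tl | apply (S1_tl A _ H2)]. Qed.

Lemma F1_ite A P f g : D1 A P -> F1 A f -> F1 A g -> F1 A (fun r => ite (P r) (f r) (g r)).
Proof.
  intros HP Hf Hg. apply F1_graph with (fun r y => P r /\ y = f r \/ ~ P r /\ y = g r).
  - intros r y. unfold ite. destruct excluded_middle_informative; tauto.
  - apply D1_tl in HP. apply S1_or; apply S1_and; auto.
    + apply HP.
    + apply HP.
Qed.

Lemma D1_induction A (P : M -> Prop) : D1 A (fun r => P (r 0%nat)) ->
  P 0 -> (forall x, P x -> P (x + 1)) -> forall x, P x.
Proof. intros []. now apply (S1_induction A). Qed.
End Definability.

(** * Composition of definable relations and the tactic [defin] *)

Lemma F1_S1 {K : model} A f : F1 A f -> S1 A (fun r => r 0 = f (tl r)).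
Proof. easy. Qed.
Lemma D1_app1 {K : model} A (P : M -> Prop) f : D1 A (fun r => P (r 0)) -> F1 A f ->
  D1 A (fun r => P (f r)).
Proof.
  intros H Hf. apply (D1_comp A (fun _ x => P x) f); auto.
Qed.
Lemma F1_app1 {K : model} A (h : M -> M) f : F1 A (fun r => h (r 0)) -> F1 A f ->
  F1 A (fun r => h (f r)).
Proof.
  intros H Hf. apply (F1_comp A (fun _ x => h x) f); auto.
Qed.
Ltac by_subst H s := apply (S1_subst _ _ H s); intros [|[|[|k]]]; unfold tl; simpl; constructor.
Lemma S1_app2 {K : model} A (P : M -> M -> Prop) f g : S1 A (fun r => P (r 0) (r 1)) ->
  F1 A f -> F1 A g -> S1 A (fun r => P (f r) (g r)).
Proof.
  intros H Hf Hg. apply (S1_comp A (fun r x => P x (g r)) f); auto.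
  apply (S1_comp A (fun r y => P (r 0) y) (fun r => g (tl r))); [|now apply F1_tl].
  by_subst H (fun r : env => r 1 .: r 0 .: r).
Qed.
Lemma D1_app2 {K : model} A (P : M -> M -> Prop) f g : D1 A (fun r => P (r 0) (r 1)) ->
  F1 A f -> F1 A g -> D1 A (fun r => P (f r) (g r)).
Proof.
  intros [H1 H2] Hf Hg. split; [apply S1_app2 | apply (S1_app2 A (fun x y => ~ P x y))]; auto.
Qed.
Lemma F1_app2 {K : model} A (h : M -> M -> M) f g : F1 A (fun r => h (r 0) (r 1)) ->
  F1 A f -> F1 A g -> F1 A (fun r => h (f r) (g r)).
Proof.
  intros H Hf Hg. apply (F1_comp A (fun r x => h x (g r)) f); auto.
  apply (F1_comp A (fun r y => h (r 0) y) (fun r => g (tl r))); [|now apply F1_tl].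
  by_subst H (fun r : env => r 0 .: r 2 .: r 1 .: r).
Qed.
Lemma S1_app3 {K : model} A (P : M -> M -> M -> Prop) f g h : S1 A (fun r => P (r 0) (r 1) (r 2)) ->
  F1 A f -> F1 A g -> F1 A h -> S1 A (fun r => P (f r) (g r) (h r)).
Proof.
  intros H Hf Hg Hh. apply (S1_comp A (fun r x => P x (g r) (h r)) f); auto.
  apply (S1_comp A (fun r y => P (r 0) y (h (tl r))) (fun r => g (tl r))); [|now apply F1_tl].
  apply (S1_comp A (fun r z => P (r 1) (r 0) z) (fun r => h (tl (tl r)))); [|now apply (F1_tl A (fun r => h (tl r))), F1_tl].
  apply (S1_subst _ _ H (fun r : env => r 2 .: r 1 .: r 0 .: r)).
  intros [|[|[|k]]]; unfold tl; simpl; constructor.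
Qed.
Lemma D1_app3 {K : model} A (P : M -> M -> M -> Prop) f g h : D1 A (fun r => P (r 0) (r 1) (r 2)) ->
  F1 A f -> F1 A g -> F1 A h -> D1 A (fun r => P (f r) (g r) (h r)).
Proof.
  intros [H1 H2] Hf Hg Hh. split; [apply S1_app3 | apply (S1_app3 A (fun x y z => ~ P x y z))]; auto.
Qed.
Lemma S1_app5 {K : model} A (P : M -> M -> M -> M -> M -> Prop) f g h i j :
  S1 A (fun r => P (r 0) (r 1) (r 2) (r 3) (r 4)) ->
  F1 A f -> F1 A g -> F1 A h -> F1 A i -> F1 A j -> S1 A (fun r => P (f r) (g r) (h r) (i r) (j r)).
Proof.
  intros H Hf Hg Hh Hi Hj.
  assert (T : forall f, F1 A f -> F1 A (fun r => f (fun n => r (S n)))) by (intros; now apply F1_tl).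
  apply (S1_comp A (fun r x => P x (g r) (h r) (i r) (j r)) f); auto.
  apply (S1_comp A (fun r x => P (r 0) x (h (tl r)) (i (tl r)) (j (tl r))) (fun r => g (tl r))); [|now apply T].
  apply (S1_comp A (fun r x => P (r 1) (r 0) x (i (tl (tl r))) (j (tl (tl r)))) (fun r => h (tl (tl r))));
    [|now apply (T (fun r => h (tl r))), T].
  apply (S1_comp A (fun r x => P (r 2) (r 1) (r 0) x (j (tl (tl (tl r))))) (fun r => i (tl (tl (tl r)))));
    [|now apply (T (fun r => i (tl (tl r)))), (T (fun r => i (tl r))), T].
  apply (S1_comp A (fun r x => P (r 3) (r 2) (r 1) (r 0) x) (fun r => j (tl (tl (tl (tl r))))));
    [|now apply (T (fun r => j (tl (tl (tl r))))), (T (fun r => j (tl (tl r)))), (T (fun r => j (tl r))), T].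
  apply (S1_subst _ _ H (fun r : env => r 4 .: r 3 .: r 2 .: r 1 .: r 0 .: r)).
  intros [|[|[|[|[|k]]]]]; unfold tl; simpl; constructor.
Qed.
Lemma D1_app5 {K : model} A (P : M -> M -> M -> M -> M -> Prop) f g h i j :
  D1 A (fun r => P (r 0) (r 1) (r 2) (r 3) (r 4)) ->
  F1 A f -> F1 A g -> F1 A h -> F1 A i -> F1 A j -> D1 A (fun r => P (f r) (g r) (h r) (i r) (j r)).
Proof.
  intros [H1 H2] Hf Hg Hh Hi Hj. split;
    [apply S1_app5 | apply (S1_app5 A (fun x y z t u => ~ P x y z t u))]; auto.
Qed.
Lemma S1_elim {K : model} A P : S1 A P -> exists Q, D0 A Q /\ forall r, P r <-> exists x, Q (x .: r).
Proof. easy. Qed.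
#[global] Opaque S1 D1 F1.

(** [defin_rel] is extended whenever a new relation or function is shown to be definable. *)
Ltac defin_rel := fail.
(** A Sigma-1 goal is first attempted as a Delta-1 goal, where negations may occur, and is split as
    a Sigma-1 formula only if this fails. *)
Ltac defin :=
  cbn beta; unfold tl, scons in |- *; cbn beta iota;
  lazymatch goal with
  | |- F1 _ (fun r => r ?k) => apply F1_var
  | |- F1 _ (fun r => _ + _)%M => apply F1_add; defin
  | |- F1 _ (fun r => _ * _)%M => apply F1_mul; defin
  | |- F1 _ (fun r => ite _ _ _) => apply F1_ite; defin
  | |- D1 _ (fun r => _ = _) => apply D1_eq; defin
  | |- D1 _ (fun r => mlt _ _ _) => apply D1_lt; defin
  | |- D1 _ (fun r => mle _ _) => apply D1_le; defin
  | |- D1 _ (fun r => mmem _ _ _) => apply D1_mem; [auto; fail | defin]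
  | |- D1 _ (fun r => _ /\ _) => apply D1_and; defin
  | |- D1 _ (fun r => _ \/ _) => apply D1_or; defin
  | |- D1 _ (fun r => _ <-> _) => apply D1_iff; defin
  | |- D1 _ (fun r => ~ _) => apply D1_not; defin
  | |- D1 _ (fun r => forall x, mlt _ x _ -> _) => apply D1_all; defin
  | |- D1 _ (fun r => exists x, mlt _ x _ /\ _) => apply D1_bex; defin
  | |- D1 _ (fun r => _ -> _) => apply D1_imp; defin
  | |- S1 _ (fun r => _ /\ _) => first [apply D1_S1; solve [defin] | apply S1_and; defin]
  | |- S1 _ (fun r => _ \/ _) => first [apply D1_S1; solve [defin] | apply S1_or; defin]
  | |- S1 _ (fun r => forall x, mlt _ x _ -> _) =>
      first [apply D1_S1; solve [defin] | apply S1_all; defin]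
  | |- S1 _ (fun r => exists x, mlt _ x _ /\ _) =>
      first [apply D1_S1; solve [defin] | apply S1_bex; defin]
  | |- S1 _ (fun r => exists x, _) =>
      first [apply D1_S1; solve [defin] | apply S1_ex; defin]
  | |- S1 _ (fun r => _ -> _) => first [apply D1_S1; solve [defin] | apply S1_imp; defin]
  | |- _ => first
    [ assumption | apply F1_const
    | lazymatch goal with
      | H : D1 ?A (fun r => ?P (r 0)) |- D1 ?A (fun r => ?P _) => apply (D1_app1 A P _ H); defin
      | H : F1 ?A (fun r => ?P (r 0)) |- F1 ?A (fun r => ?P _) => apply (F1_app1 A P _ H); defin
      | H : D1 ?A (fun r => ?P (r 0) (r 1)) |- D1 ?A (fun r => ?P _ _) => apply (D1_app2 A P _ _ H); defin
      | H : F1 ?A (fun r => ?P (r 0) (r 1)) |- F1 ?A (fun r => ?P _ _) => apply (F1_app2 A P _ _ H); defin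
      | H : D1 ?A (fun r => ?P (r 0) (r 1) (r 2) (r 3) (r 4)) |- D1 ?A (fun r => ?P _ _ _ _ _) =>
          apply (D1_app5 A P _ _ _ _ _ H); defin
      end
    | defin_rel; defin | apply D1_S1; defin ]
  end.

Section Model.
Context {K : model}.
Local Open Scope model_scope.
Add Ring model_ring : model_semi_ring.

(** * The definitions read in a model *)

(** Each definition copies its namesake in [Defs] symbol by symbol, so that the meaning of a
    sentence in a model unfolds to it by conversion ([sat_MLR], [sat_BR]). *)
Definition mpr (x y : M) : M := (x + y) * (x + y) + x.
Definition mElt (i c : M) : Prop :=
  exists k m n, c = mpr k (mpr m n) /\ i < k /\ exists q, n = q * (m * (i + 1) + 1).
Definition mFinSet (c : M) : Prop :=
  forall c', c' < c -> ~ (forall i, mElt i c' <-> mElt i c).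
Definition mFinSeq (s l : M) : Prop :=
  mFinSet s /\
  (forall p, mElt p s -> exists i x, i < l /\ p = mpr i x) /\
  (forall i, i < l -> exists x, forall y, mElt (mpr i y) s <-> y = x).
Definition mBinString (s l : M) : Prop :=
  mFinSeq s l /\ forall i x, mElt (mpr i x) s -> x < 2.
Definition mInitial (s t : M) : Prop := forall p, mElt p s -> mElt p t.
Definition mStringSet (B : M) : Prop :=
  mFinSet B /\ forall s, mElt s B -> exists l, mBinString s l.
Definition mInBasic (X : SetM) (B : M) : Prop :=
  exists s, mElt s B /\ forall i x, mElt (mpr i x) s -> (x = 1 <-> i ∈ₘ X).
Definition mPow2 (n p : M) : Prop :=
  exists s, mFinSeq s (n + 1) /\ mElt (mpr 0 1) s /\
    (forall i x, i < n /\ mElt (mpr i x) s -> mElt (mpr (i + 1) (2 * x)) s) /\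
    mElt (mpr n p) s.
Definition mMinimalIn (s B : M) : Prop :=
  mElt s B /\ ~ (exists t, mElt t B /\ mInitial t s /\ ~ t = s).
Definition mMu (B a b : M) : Prop :=
  exists S, mFinSeq S (B + 1) /\ mElt (mpr 0 (mpr 0 1)) S /\
    (forall x c d, x < B /\ mElt (mpr x (mpr c d)) S ->
       (~ mMinimalIn x B -> mElt (mpr (x + 1) (mpr c d)) S) /\
       (mMinimalIn x B -> forall l p, mBinString x l /\ mPow2 l p ->
          mElt (mpr (x + 1) (mpr (c * p + d) (d * p))) S)) /\
    mElt (mpr B (mpr a b)) S.
Definition mMuLe (B n : M) : Prop :=
  exists a b p, mMu B a b /\ mPow2 n p /\ a * p <= b.
Definition mFunction1 (F : SetM) : Prop :=
  (forall p, p ∈ₘ F -> exists i x, p = mpr i x) /\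
  (forall i, exists x, forall y, mpr i y ∈ₘ F <-> y = x).
Definition mFunction2 (F : SetM) : Prop :=
  (forall p, p ∈ₘ F -> exists n i x, p = mpr (mpr n i) x) /\
  (forall n i, exists x, forall y, mpr (mpr n i) y ∈ₘ F <-> y = x).
Definition mOpenCode (U : M -> M -> Prop) : Prop := forall i b, U i b -> mStringSet b.
Definition mInOpen (X : SetM) (U : M -> M -> Prop) : Prop :=
  exists i b, U i b /\ mInBasic X b.
Definition mOpenMuLe (U : M -> M -> Prop) (n : M) : Prop :=
  forall m, exists C, mFinSet C /\
    (forall s, mElt s C <-> exists i b, i <= m /\ U i b /\ mElt s b) /\ mMuLe C n.
Definition mSeqOf (F : SetM) : M -> M -> Prop := fun i b => mpr i b ∈ₘ F.
Definition mSection (F : SetM) (n : M) : M -> M -> Prop := fun i b => mpr (mpr n i) b ∈ₘ F.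
Definition mStep (Z : SetM) (R : M -> M -> M -> Prop) (a u v : M) : Prop :=
  a = mpr 0 v \/
  (a = mpr 1 0 /\ v = u) \/
  (a = mpr 2 0 /\ v = u + 1) \/
  (a = mpr 3 0 /\ exists w, u = mpr v w) \/
  (a = mpr 4 0 /\ exists w, u = mpr w v) \/
  (a = mpr 5 0 /\ ((u ∈ₘ Z /\ v = 1) \/ (~ u ∈ₘ Z /\ v = 0))) \/
  (exists b c, a = mpr 6 (mpr b c) /\
     exists w1 w2, R b u w1 /\ R c u w2 /\ v = mpr w1 w2) \/
  (exists b c, a = mpr 7 (mpr b c) /\ exists w, R c u w /\ R b w v) \/
  (exists b c, a = mpr 8 (mpr b c) /\ exists x n, u = mpr x n /\
     ((n = 0 /\ R b x v) \/
      (exists m w, n = m + 1 /\ R a (mpr x m) w /\ R c (mpr (mpr x m) w) v))) \/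
  (exists b, a = mpr 9 b /\ R b (mpr u v) 0 /\
     forall w, w < v -> exists k, R b (mpr u w) (k + 1)).
Definition mPhi (Z : SetM) (e x y : M) : Prop :=
  exists s l, mFinSeq s l /\
    (forall i p, mElt (mpr i p) s -> exists a u v, p = mpr a (mpr u v) /\
       mStep Z (fun a' u' v' => exists j, j < i /\ mElt (mpr j (mpr a' (mpr u' v'))) s) a u v) /\
    (exists i, mElt (mpr i (mpr e (mpr x y))) s).
Definition mComputes1 (Z : SetM) (e : M) (F : SetM) : Prop :=
  forall i x, mpr i x ∈ₘ F <-> mPhi Z e i x.
Definition mComputes2 (Z : SetM) (e : M) (F : SetM) : Prop :=
  forall n i x, mpr (mpr n i) x ∈ₘ F <-> mPhi Z e (mpr n i) x.
Definition mMLTest (U Z : SetM) : Prop :=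
  mFunction2 U /\ (exists e, mComputes2 Z e U) /\
  forall n, mOpenCode (mSection U n) /\ mOpenMuLe (mSection U n) n.
Definition mOneRandom (X Z : SetM) : Prop :=
  forall U, mMLTest U Z -> ~ (forall n, mInOpen X (mSection U n)).
Definition mAtMost (A : M -> Prop) (k : M) : Prop :=
  forall s l, mFinSeq s l /\
    (forall i x, mElt (mpr i x) s -> A x) /\
    (forall i j x, mElt (mpr i x) s /\ mElt (mpr j x) s -> i = j) -> l <= k.
Definition mHRE (h g : SetM) : Prop :=
  mFunction2 g /\
  forall n k, mpr n k ∈ₘ h ->
    mAtMost (fun s => ~ (exists v, mpr (mpr n s) v ∈ₘ g /\ mpr (mpr n (s + 1)) v ∈ₘ g)) k.
Definition mLimit (g : SetM) (n e : M) : Prop :=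
  exists s0, forall s, s0 <= s -> mpr (mpr n s) e ∈ₘ g.
Definition mDemuth (h g Z : SetM) : Prop :=
  mFunction1 h /\ (exists e, mComputes1 Z e h) /\ mHRE h g /\ (exists e, mComputes2 Z e g) /\
  forall n, exists e, mLimit g n e /\
    exists F, mFunction1 F /\ mComputes1 Z e F /\
      mOpenCode (mSeqOf F) /\ mOpenMuLe (mSeqOf F) n.
Definition mWeaklyPasses (X g Z : SetM) : Prop :=
  exists n e, mLimit g n e /\ ~ mInOpen X (mPhi Z e).
Definition mIsCPow2 (c : M) (h : SetM) : Prop :=
  mFunction1 h /\ forall n p, mPow2 n p -> mpr n (c * p) ∈ₘ h.
Definition mBalanced (X Z : SetM) : Prop :=
  forall c, forall h g, mIsCPow2 c h /\ mDemuth h g Z -> mWeaklyPasses X g Z.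

Lemma sat_MLR v w : sat struct v w MLR = forall Z, exists X, mOneRandom X Z.
Proof. reflexivity. Qed.
Lemma sat_BR v w : sat struct v w BR = forall Z, exists X, mBalanced X Z.
Proof. reflexivity. Qed.

(** * Coding of finite sets *)

(** Admits all sets as parameters, which suffices for induction and comprehension; computability
    from [Z] needs the class [only Z] defined later. *)
Definition every (_ : SetM) : Prop := True.

Lemma D1_fix A (P : env -> M -> Prop) : D1 A (fun r => P (tl r) (r 0%nat)) ->
  forall r, D1 A (fun r' => P r (r' 0%nat)).
Proof.
  intros H r. apply (D1_subst A _ H (fun r' => r' 0%nat .: r)). intros [|k]; simpl; constructor.
Qed.

Lemma least A (P : M -> Prop) : D1 A (fun r => P (r 0%nat)) -> forall x, P x ->
  exists y, P y /\ forall z, z < y -> ~ P z.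
Proof.
  intros HP x Hx. apply NNPP; intros N.
  assert (I : forall x z, z < x -> ~ P z).
  { apply (D1_induction A (fun x => forall z, z < x -> ~ P z)).
    - defin.
    - intros z Hz. exfalso; lin.
    - intros y Hy z Hz Pz. apply N. exists z. split; auto. intros t Ht. apply Hy. lin. }
  apply (I (x + 1) x); auto. lin.
Qed.

Lemma strong_induction A (P : M -> Prop) : D1 A (fun r => P (r 0%nat)) ->
  (forall x, (forall y, y < x -> P y) -> P x) -> forall x, P x.
Proof.
  intros HP H x. apply NNPP; intros N.
  destruct (least A (fun x => ~ P x) ltac:(defin) x N) as (y & Hy & Hm).
  apply Hy, H. intros z Hz. apply NNPP, Hm, Hz.
Qed.

Lemma zero_or_succ (x : M) : x = 0 \/ exists y, x = y + 1.
Proof.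
  destruct (classic (0 < x)) as [H|H]; [right | left; lin].
  assert (H' : 1 <= x) by lin. destruct H' as [H'| <-]; [|exists 0; lin].
  destruct (mlt_ex _ _ H') as [z Hz]. exists z. lin.
Qed.

Lemma le_ex (x y : M) : x <= y -> exists z, y = x + z.
Proof. intros [H|H]; [destruct (mlt_ex _ _ H) as [z Hz]; exists z | exists 0]; lin. Qed.
Lemma lt_ex (x y : M) : x < y -> exists z, y = x + z + 1.
Proof. intros H. destruct (le_ex (x + 1) y) as [z Hz]; [lin | exists z; lin]. Qed.

Lemma mul_le (a b c d : M) : a <= b -> c <= d -> a * c <= b * d.
Proof. intros H1 H2. destruct (le_ex _ _ H1) as [x ->], (le_ex _ _ H2) as [y ->]. lin. Qed.
Lemma mle_trans (a b c : M) : a <= b -> b <= c -> a <= c.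
Proof. lin. Qed.
Lemma mul_lt (a b c : M) : a < b -> 0 < c -> a * c < b * c.
Proof. intros; now apply mlt_mul. Qed.
Lemma mul_cancel_le (a b c : M) : 0 < c -> a * c <= b * c -> a <= b.
Proof. intros H1 H2. apply NNPP; intros N. assert (L := mul_lt b a c ltac:(lin) H1). lin. Qed.

(** The code is a square plus [x], where [x] is at most the root [x + y]; so it lies below the next
    square and determines the root, then [x]. *)
Lemma mpr_inj (x y x' y' : M) : mpr x y = mpr x' y' -> x = x' /\ y = y'.
Proof.
  assert (H : forall x y x' y', mpr x y = mpr x' y' -> x + y <= x' + y').
  { clear. intros x y x' y' E. apply NNPP; intros N. assert (L : x' + y' < x + y) by lin.
    apply lt_ex in L as [d Hd]. unfold mpr in E. rewrite Hd in E. lin. }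
  intros E. assert (S1 := H _ _ _ _ E). symmetry in E. assert (S2 := H _ _ _ _ E).
  assert (S : x + y = x' + y') by lin. unfold mpr in E. rewrite S in E. lin.
Qed.
Lemma mul_self_le (x : M) : x <= x * x.
Proof. destruct (zero_or_succ x) as [->|[y ->]]; lin. Qed.
Lemma mpr_l (x y : M) : x <= mpr x y.
Proof. unfold mpr. lin. Qed.
Lemma mpr_r (x y : M) : y <= mpr x y.
Proof. unfold mpr. assert (H := mul_self_le (x + y)). lin. Qed.
Lemma mpr_mono (x y x' y' : M) : x <= x' -> y <= y' -> mpr x y <= mpr x' y'.
Proof.
  intros H1 H2. unfold mpr. assert (H := mul_le (x + y) (x' + y') (x + y) (x' + y')).
  assert (x + y <= x' + y') by lin. specialize (H ltac:(auto) ltac:(auto)). lin.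
Qed.

Lemma F1_mpr A f g : F1 A f -> F1 A g -> F1 A (fun r => mpr (f r) (g r)).
Proof. intros. unfold mpr. repeat apply F1_add || apply F1_mul; auto. Qed.

Definition dvd (a b : M) : Prop := exists q, b = q * a.

Lemma D1_dvd A f g : F1 A f -> F1 A g -> D1 A (fun r => dvd (f r) (g r)).
Proof.
  apply (D1_app2 A dvd). apply D1_ext with (fun r => exists q, q < r 1%nat + 1 /\ r 1%nat = q * r 0%nat).
  - intros r. split; [intros (q & _ & H); now exists q|]. intros (q & H).
    destruct (zero_or_succ (r 0%nat)) as [E|[y E]]; rewrite E in H.
    + exists 0. rewrite E. split; lin.
    + exists q. rewrite E. split; lin.
  - defin.
Qed.

Ltac defin_rel ::= first [apply F1_mpr | apply D1_dvd].

Lemma dvd_add_cancel (x a b : M) : dvd x (a + b) -> dvd x a -> dvd x b.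
Proof.
  intros [q Hq] [p Hp]. destruct (classic (p <= q)) as [H|H].
  - apply le_ex in H as [d ->]. exists d. lin.
  - assert (L : q <= p) by lin. apply (mul_le q p x x) in L; [|now right].
    exists 0. lin.
Qed.
Lemma dvd_mul (x a b : M) : dvd x a -> dvd x (b * a).
Proof. intros [q ->]. exists (b * q). ring. Qed.
Lemma dvd_add (x a b : M) : dvd x a -> dvd x b -> dvd x (a + b).
Proof. intros [q ->] [p ->]. exists (q + p). ring. Qed.
Lemma dvd_le (x a : M) : 0 < a -> dvd x a -> x <= a.
Proof. intros H [q ->]. destruct (zero_or_succ q) as [->|[p ->]]; lin. Qed.

(** The moduli of Gödel's beta function, on which [mElt] is built. *)
Definition modulus (m i : M) : M := m * (i + 1) + 1.

(** If [j - i] divides [m], the moduli [x] and [y] at [i] and [j] satisfy an explicit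
    Bezout identity [A y + x = B x + 1]. *)
Lemma modulus_bezout (m i e t : M) : m = e * t ->
  (i + 1) * (i + 1) * t * modulus m (i + e) + modulus m i
  = (i + 1) * (i + e + 1) * t * modulus m i + 1.
Proof. intros ->. unfold modulus. ring. Qed.

(** Multiplying the Bezout identity by [n] leaves [n] as the only term not visibly divisible by the
    modulus at [i]. The same identity serves both orders of [i] and [j], with the roles of the two
    moduli exchanged. *)
Lemma modulus_coprime (m k i j n : M) : (forall e, e < k -> dvd (e + 1) m) -> i < k -> j < k ->
  i <> j -> dvd (modulus m i) (n * modulus m j) -> dvd (modulus m i) n.
Proof.
  intros Hm Hi Hj Hij H. destruct (mlt_total i j) as [L|[L|L]]; [|easy|].
  - apply lt_ex in L as [e ->]. destruct (Hm e ltac:(lin)) as [t Ht].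
    assert (B := modulus_bezout m i (e + 1) t ltac:(lin)). rewrite <- !madd_assoc in B.
    replace (i + (e + 1)) with (i + e + 1) in B by ring.
    set (x := modulus m i) in *. set (y := modulus m (i + e + 1)) in *.
    apply (f_equal (fun z => n * z)) in B.
    apply dvd_add_cancel with ((n * ((i + 1) * (i + e + 1 + 1) * t)) * x).
    + replace (_ + n) with (((i + 1) * (i + 1) * t) * (n * y) + n * x).
      * apply dvd_add; [now apply dvd_mul | apply dvd_mul; exists 1; ring].
      * transitivity (n * ((i + 1) * (i + 1) * t * y + x)); [ring|]. rewrite B. ring.
    + apply dvd_mul. exists 1; ring.
  - apply lt_ex in L as [e ->]. destruct (Hm e ltac:(lin)) as [t Ht].
    assert (B := modulus_bezout m j (e + 1) t ltac:(lin)).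
    replace (j + (e + 1)) with (j + e + 1) in B by ring.
    set (x := modulus m j) in *. set (y := modulus m (j + e + 1)) in *.
    apply (f_equal (fun z => n * z)) in B.
    apply dvd_add_cancel with (((j + 1) * (j + e + 1 + 1) * t) * (n * x)).
    + replace (_ + n) with ((n * ((j + 1) * (j + 1) * t)) * y + n * x).
      * apply dvd_add; auto. apply dvd_mul; exists 1; ring.
      * transitivity (n * ((j + 1) * (j + 1) * t * y + x)); [ring|]. rewrite B. ring.
    + now apply dvd_mul.
Qed.

Lemma common_multiple (k : M) : exists m, 0 < m /\ forall e, e < k -> dvd (e + 1) m.
Proof.
  revert k. apply (S1_induction every).
  - defin.
  - exists 1. split; [lin|]. intros e He. exfalso; lin.
  - intros k (m & Hm & H). exists ((k + 1) * m). split; [destruct (zero_or_succ m) as [->|[? ->]]; lin|].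
    intros e He. destruct (classic (e < k)) as [L|L]; [now apply dvd_mul, H|].
    replace e with k by lin. exists m. ring.
Qed.

Lemma F1_modulus A f g : F1 A f -> F1 A g -> F1 A (fun r => modulus (f r) (g r)).
Proof. intros. unfold modulus. defin. Qed.
Ltac defin_arith := first [apply F1_mpr | apply D1_dvd | apply F1_modulus].
Ltac defin_rel ::= defin_arith.

Lemma mul_pos (a b : M) : 0 < a -> 0 < b -> 0 < a * b.
Proof. intros H1 H2. assert (L := mul_lt 0 a b H1 H2). lin. Qed.

Lemma modulus_ge (m i : M) : 0 < m -> 2 <= modulus m i.
Proof. intros H. unfold modulus. assert (L := mul_pos m (i + 1) H ltac:(lin)). lin. Qed.

Lemma modulus_product (m k : M) : exists N, 0 < N /\ forall i, i < k -> dvd (modulus m i) N.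
Proof.
  revert k. apply (S1_induction every); [defin| |].
  - exists 1. split; [lin|]. intros i Hi; exfalso; lin.
  - intros k (N & HN & H). exists (N * modulus m k). split.
    + apply mul_pos; auto. unfold modulus. lin.
    + intros i Hi. destruct (classic (i < k)) as [L|L].
      * destruct (H i L) as [q Hq]. exists (modulus m k * q). rewrite Hq. ring.
      * replace i with k by lin. apply dvd_mul. exists 1. ring.
Qed.

(** Every modulus below [k] divides the least common multiple [N] exactly once, so all subsets
    of [0, k) are represented by divisors of the single number [N]. *)
Lemma divisor_code (m k : M) : 0 < m -> (forall e, e < k -> dvd (e + 1) m) ->
  exists N, forall A P, D1 A (fun r => P (r 0%nat)) ->
    exists n, n <= N /\ forall i, i < k -> (dvd (modulus m i) n <-> P i).
Proof.
  intros Hm0 Hm. destruct (modulus_product m k) as [N0 HN0].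
  destruct (least every (fun N => 0 < N /\ forall i, i < k -> dvd (modulus m i) N) ltac:(defin) N0 HN0)
    as (N & [HN HdN] & Hmin). clear N0 HN0.
  exists N. intros A P HP.
  (* Starting from [N], which represents all of [[0, k)], the indices [j] outside [P] are removed
     one after the other by dividing by their modulus. Staying a divisor of [N] keeps [n] below a
     bound that does not depend on [P]. *)
  assert (G : forall j, k < j \/ exists n, 0 < n /\ dvd n N /\
    forall i, i < k -> (dvd (modulus m i) n <-> (j <= i \/ P i))).
  { apply (S1_induction A (fun j => k < j \/ exists n, 0 < n /\ dvd n N /\
      forall i, i < k -> (dvd (modulus m i) n <-> (j <= i \/ P i)))).
    - defin.
    - right. exists N. split; auto. split; [exists 1; ring|]. intros i Hi. split; auto.
      intros _. left. lin.
    - intros j [L|(n & Hn & [p Hp] & H)]; [left; lin|].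
      destruct (classic (j < k)) as [Hj|Hj]; [right|left; lin].
      destruct (classic (P j)) as [Pj|Pj].
      + exists n. split; auto. split; [now exists p|]. intros i Hi. rewrite (H i Hi). split.
        * intros [[L|L]|L]; auto; [left; lin | subst; auto].
        * intros [L|L]; auto. left; lin.
      + destruct (proj2 (H j Hj) (or_introl (or_intror eq_refl))) as [n' Hn'].
        assert (Hn'0 : 0 < n') by (destruct (zero_or_succ n') as [E|[? E]]; rewrite E in *; lin).
        exists n'. split; auto. split; [exists (p * modulus m j); rewrite Hp, Hn'; ring|].
        intros i Hi. destruct (classic (i = j)) as [->|Hij].
        * split; [intros [q Hq]; exfalso | intros [L|L]; [exfalso; lin | easy]].
          assert (Hpn : 0 < p * n') by (apply mul_pos; auto;
            destruct (zero_or_succ p) as [E|[? E]]; rewrite E in *; lin).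
          (* If the modulus at [j] still divided [n'], then [N] divided by this modulus, which is
             [p * n'], would be a smaller common multiple of all the moduli. *)
          apply (Hmin (p * n')).
          -- assert (G := modulus_ge m j Hm0).
             assert (L := mul_le 2 (modulus m j) (p * n') (p * n') G (or_intror eq_refl)).
             rewrite Hp, Hn'. lin.
          -- split; auto. intros i Hi'. destruct (classic (i = j)) as [->|Hij].
             ++ exists (p * q). rewrite Hq. ring.
             ++ apply (modulus_coprime m k i j); auto.
                replace (p * n' * modulus m j) with N; auto. rewrite Hp, Hn'. ring.
        * split.
          -- intros D. apply (dvd_mul _ _ (modulus m j)) in D.
             replace (modulus m j * n') with n in D by (rewrite Hn'; ring).
             apply (H i Hi) in D as [L|L]; auto. left. destruct L; [lin | now subst].
          -- intros L. apply (modulus_coprime m k i j); auto. rewrite <- Hn'. apply (H i Hi).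
             destruct L as [L|L]; auto. left; lin. }
  destruct (G k) as [L|(n & Hn & HnN & H)]; [exfalso; lin|].
  exists n. split; [now apply dvd_le|]. intros i Hi. rewrite (H i Hi).
  split; auto. intros [L|L]; auto. exfalso; lin.
Qed.

(** The bound [B] is chosen before [P]: all subsets of [[0, k)] have codes in one finite range, the
    counterpart of an exponential bound. [string_bound] depends on this. *)
Lemma bounded_code (k : M) : exists B, forall A P, D1 A (fun r => P (r 0%nat)) ->
  exists c, c < B /\ forall i, mElt i c <-> i < k /\ P i.
Proof.
  destruct (common_multiple k) as (m & Hm0 & Hm).
  destruct (divisor_code m k Hm0 Hm) as [N HN].
  exists (mpr k (mpr m N) + 1). intros A P HP. destruct (HN A P HP) as (n & Hn & H).
  exists (mpr k (mpr m n)). split.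
  - assert (L : mpr k (mpr m n) <= mpr k (mpr m N)) by
      (apply mpr_mono; [now right | apply mpr_mono; [now right | auto]]). lin.
  - intros i. split.
    + intros (k' & m' & n' & E & Hi & D). apply mpr_inj in E as [<- E].
      apply mpr_inj in E as [<- <-]. split; auto. now apply H.
    + intros [Hi HPi]. exists k, m, n. split; auto. split; auto. now apply H.
Qed.

Lemma Elt_lt (i c : M) : mElt i c -> i < c.
Proof.
  intros (k & m & n & -> & H & _). assert (L := mpr_l k (mpr m n)). lin.
Qed.

Lemma D1_Elt A f g : F1 A f -> F1 A g -> D1 A (fun r => mElt (f r) (g r)).
Proof.
  apply (D1_app2 A mElt).
  apply D1_ext with (fun r => exists k, k < r 1%nat + 1 /\ exists m, m < r 1%nat + 1 /\
    exists n, n < r 1%nat + 1 /\ (r 1%nat = mpr k (mpr m n) /\ r 0%nat < k /\ dvd (modulus m (r 0%nat)) n)).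
  - intros r. split.
    + intros (k & _ & m & _ & n & _ & H). now exists k, m, n.
    + intros (k & m & n & H). destruct H as [E H].
      assert (L1 := mpr_l k (mpr m n)). assert (L2 := mpr_r k (mpr m n)).
      assert (L3 := mpr_l m n). assert (L4 := mpr_r m n).
      exists k. split; [lin|]. exists m. split; [lin|]. exists n. split; [lin | auto].
  - defin.
Qed.
Ltac defin_rel ::= first [defin_arith | apply D1_Elt].

Lemma D1_FinSet A f : F1 A f -> D1 A (fun r => mFinSet (f r)).
Proof.
  apply (D1_app1 A mFinSet).
  apply D1_ext with (fun r => forall c, c < r 0%nat -> ~ (forall i, i < r 0%nat + c -> (mElt i c <-> mElt i (r 0%nat)))).
  - intros r. split; intros H c Hc N; apply (H c Hc); auto. intros i.
    destruct (classic (i < r 0%nat + c)) as [L|L]; auto.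
    split; intros E; apply Elt_lt in E; exfalso; lin.
  - defin.
Qed.

Lemma FinSet_ext (c c' : M) : mFinSet c -> mFinSet c' -> (forall i, mElt i c <-> mElt i c') -> c = c'.
Proof.
  intros H1 H2 E. destruct (mlt_total c c') as [L|[L|L]]; auto; exfalso.
  - now apply (H2 c L).
  - apply (H1 c' L). intros i. now rewrite E.
Qed.

Lemma FinSet_min (c0 : M) : exists c, c <= c0 /\ mFinSet c /\ forall i, mElt i c <-> mElt i c0.
Proof.
  destruct (least every (fun c => forall i, i < c + c0 -> (mElt i c <-> mElt i c0))
    ltac:(defin) c0) as (c & H & Hm); [tauto|].
  assert (E : forall c1, (forall i, i < c1 + c0 -> (mElt i c1 <-> mElt i c0)) ->
    forall i, mElt i c1 <-> mElt i c0).
  { intros c1 H1 i. destruct (classic (i < c1 + c0)) as [L|L]; auto.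
    split; intros E; apply Elt_lt in E; exfalso; lin. }
  exists c. split; [|split; auto].
  - apply NNPP; intros N. assert (L : c0 < c) by lin. apply (Hm c0 L). tauto.
  - intros c' Hc' N. apply (Hm c' Hc'). intros i _. rewrite (N i). now apply E.
Qed.

Lemma bounded_FinSet (k : M) : exists B, forall A P, D1 A (fun r => P (r 0%nat)) ->
  (forall i, P i -> i < k) -> exists c, c < B /\ mFinSet c /\ forall i, mElt i c <-> P i.
Proof.
  destruct (bounded_code k) as [B HB]. exists B. intros A P HP Hk.
  destruct (HB A P HP) as (c0 & L0 & H0). destruct (FinSet_min c0) as (c & L & Hc & H).
  exists c. split; [lin|]. split; auto. intros i. rewrite H, H0. firstorder.
Qed.

Definition code (P : M -> Prop) : M :=
  epsilon (inhabits 0) (fun c => mFinSet c /\ forall i, mElt i c <-> P i).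

Lemma code_spec A P k : D1 A (fun r => P (r 0%nat)) -> (forall i, P i -> i < k) ->
  mFinSet (code P) /\ forall i, mElt i (code P) <-> P i.
Proof.
  intros HP Hk. unfold code. apply epsilon_spec.
  destruct (bounded_FinSet k) as [B HB]. destruct (HB A P HP Hk) as (c & _ & H). now exists c.
Qed.

Lemma code_eq A P k c : D1 A (fun r => P (r 0%nat)) -> (forall i, P i -> i < k) ->
  (c = code P <-> mFinSet c /\ forall i, mElt i c <-> P i).
Proof.
  intros HP Hk. destruct (code_spec A P k HP Hk) as [H1 H2]. split.
  - intros ->; auto.
  - intros [H3 H4]. apply FinSet_ext; auto. intros i. now rewrite H2, H4.
Qed.

Lemma F1_code A (P : env -> M -> Prop) b : (forall r i, P r i -> i < b r) -> F1 A b ->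
  D1 A (fun r => P (tl r) (r 0%nat)) -> F1 A (fun r => code (P r)).
Proof.
  intros Hb Fb HP.
  apply F1_graph with (fun r c => mFinSet c /\ forall i, i < c + b r -> (mElt i c <-> P r i)).
  - intros r c. rewrite (code_eq A (P r) (b r)); [|now apply D1_fix | auto].
    split; intros [H1 H2]; split; auto. intros i. destruct (classic (i < c + b r)) as [L|L]; auto.
    split; intros E; [apply Elt_lt in E | apply Hb in E]; exfalso; lin.
  - apply D1_S1, D1_and; [apply D1_FinSet, F1_var|].
    apply (D1_all A (fun r => r 0%nat + b (tl r)) (fun r i => mElt i (r 0%nat) <-> P (tl r) i)).
    + apply F1_add; [apply F1_var | now apply F1_tl].
    + apply D1_iff; [defin|].
      apply (D1_subst A _ HP (fun r => r 0%nat .: tl (tl r))).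
      intros [|k]; unfold tl; simpl; constructor.
Qed.

(** * Finite sequences and primitive recursion *)

Ltac defin_sets := first [defin_arith | apply D1_Elt | apply D1_FinSet].
Ltac defin_rel ::= defin_sets.

Lemma Elt_pair_lt (i x s : M) : mElt (mpr i x) s -> i < s /\ x < s.
Proof.
  intros H. apply Elt_lt in H. assert (L1 := mpr_l i x). assert (L2 := mpr_r i x). lin.
Qed.

Lemma D1_FinSeq A f g : F1 A f -> F1 A g -> D1 A (fun r => mFinSeq (f r) (g r)).
Proof.
  apply (D1_app2 A mFinSeq).
  apply D1_ext with (fun r => mFinSet (r 0%nat) /\
    (forall p, p < r 0%nat -> mElt p (r 0%nat) -> exists i, i < r 1%nat /\ exists x, x < p + 1 /\ p = mpr i x) /\
    (forall i, i < r 1%nat -> exists x, x < r 0%nat /\ mElt (mpr i x) (r 0%nat) /\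
       forall y, y < r 0%nat -> mElt (mpr i y) (r 0%nat) -> y = x)).
  - intros r. split; intros (H1 & H2 & H3); split; auto; split.
    + intros p Hp. destruct (classic (p < r 0%nat)) as [L|L]; [|apply Elt_lt in Hp; exfalso; lin].
      destruct (H2 p L Hp) as (i & Hi & x & _ & E). now exists i, x.
    + intros i Hi. destruct (H3 i Hi) as (x & Hx & Ex & H). exists x. intros y. split.
      * intros Hy. apply H; auto. now apply Elt_pair_lt in Hy.
      * now intros ->.
    + intros p _ Hp. destruct (H2 p Hp) as (i & x & Hi & E). exists i. split; auto. exists x.
      split; auto. assert (L := mpr_r i x). rewrite E. lin.
    + intros i Hi. destruct (H3 i Hi) as (x & Hx). exists x.
      assert (Ex : mElt (mpr i x) (r 0%nat)) by now apply Hx.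
      split; [now apply Elt_pair_lt in Ex|]. split; auto. intros y _ Hy. now apply Hx.
  - defin.
Qed.
Ltac defin_rel ::= first [defin_sets | apply D1_FinSeq].

Lemma FinSeq_val (s l i : M) : mFinSeq s l -> i < l -> exists x, mElt (mpr i x) s.
Proof. intros (_ & _ & H) Hi. destruct (H i Hi) as [x Hx]. exists x. now apply Hx. Qed.
Lemma FinSeq_fun (s l i x y : M) : mFinSeq s l -> mElt (mpr i x) s -> mElt (mpr i y) s -> x = y.
Proof.
  intros (_ & H1 & H2) Hx Hy. destruct (H1 _ Hx) as (j & z & Hj & E).
  apply mpr_inj in E as [<- _]. destruct (H2 i Hj) as [w Hw].
  apply Hw in Hx, Hy. congruence.
Qed.
Lemma FinSeq_dom (s l i x : M) : mFinSeq s l -> mElt (mpr i x) s -> i < l.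
Proof.
  intros (_ & H1 & _) Hx. destruct (H1 _ Hx) as (j & z & Hj & E). now apply mpr_inj in E as [<- _].
Qed.
Lemma FinSeq_pair (s l p : M) : mFinSeq s l -> mElt p s -> exists i x, i < l /\ p = mpr i x.
Proof. intros (_ & H & _). apply H. Qed.

Lemma FinSeq_ext (s s' l : M) : mFinSeq s l -> mFinSeq s' l ->
  (forall i x, mElt (mpr i x) s -> mElt (mpr i x) s') -> s = s'.
Proof.
  intros H1 H2 H. apply FinSet_ext; [apply H1 | apply H2|]. intros p. split; intros Hp.
  - destruct (FinSeq_pair _ _ _ H1 Hp) as (i & x & _ & ->). auto.
  - destruct (FinSeq_pair _ _ _ H2 Hp) as (i & x & Hi & ->).
    destruct (FinSeq_val _ _ _ H1 Hi) as [y Hy].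
    now rewrite (FinSeq_fun _ _ i x y H2 Hp (H _ _ Hy)).
Qed.

Lemma FinSeq_build A (G : M -> M -> Prop) (l b : M) : D1 A (fun r => G (r 0%nat) (r 1%nat)) ->
  (forall i, i < l -> exists x, G i x) -> (forall i x y, G i x -> G i y -> x = y) ->
  (forall i x, G i x -> i < l /\ x < b) ->
  exists s, mFinSeq s l /\ forall i x, mElt (mpr i x) s <-> G i x.
Proof.
  intros HG Hex Hun Hb.
  destruct (code_spec A (fun p => exists i, i < p + 1 /\ exists x, x < p + 1 /\ (p = mpr i x /\ G i x)) (mpr l b))
    as [H1 H2].
  - defin.
  - intros p (i & _ & x & _ & -> & H). apply Hb in H as [Hi Hx].
    destruct (lt_ex _ _ Hi) as [d ->]. assert (L := mpr_mono (i + d + 1) x (i + d + 1) b (or_intror eq_refl) ltac:(lin)).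
    assert (L' : mpr i x < mpr (i + d + 1) x) by (unfold mpr; lin). lin.
  - set (s := code _) in *. assert (E : forall i x, mElt (mpr i x) s <-> G i x).
    { intros i x. rewrite H2. split.
      - intros (i' & _ & x' & _ & E & H). now apply mpr_inj in E as [-> ->].
      - intros H. assert (L1 := mpr_l i x). assert (L2 := mpr_r i x).
        exists i. split; [lin|]. exists x. split; [lin | auto]. }
    exists s. split; auto. split; [|split]; auto.
    + intros p Hp. apply H2 in Hp as (i & _ & x & _ & -> & H). exists i, x. split; auto. now apply Hb in H.
    + intros i Hi. destruct (Hex i Hi) as [x Hx]. exists x. intros y. rewrite E. split; [|now intros ->].
      intros Hy. eapply Hun; eauto.
Qed.

Lemma FinSeq_snoc (s l v : M) : mFinSeq s l ->
  exists s', mFinSeq s' (l + 1) /\ forall i x, mElt (mpr i x) s' <-> mElt (mpr i x) s \/ i = l /\ x = v.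
Proof.
  intros Hs. apply (FinSeq_build every (fun i x => mElt (mpr i x) s \/ i = l /\ x = v) (l + 1) (s + v + 1)).
  - defin.
  - intros i Hi. destruct (classic (i < l)) as [L|L].
    + destruct (FinSeq_val _ _ _ Hs L) as [x Hx]. eauto.
    + exists v. right. split; auto. lin.
  - intros i x y [H|[-> ->]] [H'|[E ->]]; auto.
    + eapply FinSeq_fun; eauto.
    + subst. apply (FinSeq_dom _ _ _ _ Hs) in H. exfalso; lin.
    + apply (FinSeq_dom _ _ _ _ Hs) in H'. exfalso; lin.
  - intros i x [H|[-> ->]]; [|lin]. assert (L := FinSeq_dom _ _ _ _ Hs H).
    apply Elt_pair_lt in H. lin.
Qed.

Lemma FinSeq_nil : exists s, mFinSeq s 0 /\ forall i x, ~ mElt (mpr i x) s.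
Proof.
  destruct (FinSeq_build every (fun i x => False) 0 0) as (s & H1 & H2); try easy.
  - apply D1_ext with (fun r => 0 < 0); [intros; split; [lin | easy] | defin].
  - intros i Hi. exfalso; lin.
  - exists s. split; auto. intros i x. now rewrite H2.
Qed.

Lemma FinSeq_app (s l s' l' : M) : mFinSeq s l -> mFinSeq s' l' -> exists t, mFinSeq t (l + l') /\
  forall i x, mElt (mpr i x) t <-> mElt (mpr i x) s \/ exists j, i = l + j /\ mElt (mpr j x) s'.
Proof.
  intros Hs Hs'.
  destruct (FinSeq_build every (fun i x => mElt (mpr i x) s \/ exists j, j < i + 1 /\ (i = l + j /\ mElt (mpr j x) s'))
    (l + l') (s + s')) as (t & H1 & H2).
  - defin.
  - intros i Hi. destruct (classic (i < l)) as [L|L].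
    + destruct (FinSeq_val _ _ _ Hs L) as [x Hx]. eauto.
    + destruct (le_ex l i ltac:(lin)) as [j ->]. destruct (FinSeq_val _ _ j Hs' ltac:(lin)) as [x Hx].
      exists x. right. exists j. split; [lin | auto].
  - intros i x y [H|(j & _ & -> & H)] [H'|(j' & _ & E & H')].
    + now apply (FinSeq_fun _ _ i x y Hs).
    + subst. apply (FinSeq_dom _ _ _ _ Hs) in H. exfalso; lin.
    + apply (FinSeq_dom _ _ _ _ Hs) in H'. exfalso; lin.
    + assert (j = j') by lin. subst. now apply (FinSeq_fun _ _ j' x y Hs').
  - intros i x [H|(j & _ & -> & H)].
    + assert (L := FinSeq_dom _ _ _ _ Hs H). apply Elt_pair_lt in H. lin.
    + assert (L := FinSeq_dom _ _ _ _ Hs' H). apply Elt_pair_lt in H. lin.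
  - exists t. split; auto. intros i x. rewrite H2. split; intros [H|(j & H)]; auto; right; exists j.
    + tauto.
    + split; auto. lin.
Qed.

(** ** Primitive recursion *)

(** A coded computation history with last entry [v]. The bound [x < s] holds for every entry and
    keeps the recursion clause bounded. *)
Definition prec_rel (a : M) (G : M -> M -> M) (n v : M) : Prop :=
  exists s, mFinSeq s (n + 1) /\ mElt (mpr 0 a) s /\
    (forall i, i < n -> forall x, x < s -> mElt (mpr i x) s -> mElt (mpr (i + 1) (G i x)) s) /\
    mElt (mpr n v) s.

Definition prec (a : M) (G : M -> M -> M) (n : M) : M := epsilon (inhabits 0) (prec_rel a G n).

Lemma S1_prec_rel A a G n v : F1 A a -> F1 A (fun r => G (tl (tl r)) (r 0%nat) (r 1%nat)) ->
  F1 A n -> F1 A v -> S1 A (fun r => prec_rel (a r) (G r) (n r) (v r)).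
Proof.
  intros Ha HG Hn Hv. unfold prec_rel.
  apply S1_ex. cbn beta. apply S1_and; [apply D1_S1, D1_FinSeq; [apply F1_var | apply F1_add; [now apply F1_tl | apply F1_const]]|].
  apply S1_and; [apply D1_S1, D1_Elt; [apply F1_mpr; [apply F1_const | now apply F1_tl] | apply F1_var]|].
  apply S1_and; [|apply D1_S1, D1_Elt; [apply F1_mpr; now apply F1_tl | apply F1_var]].
  apply D1_S1.
  apply (D1_all A (fun r => n (tl r)) (fun r i => forall x, x < r 0%nat -> mElt (mpr i x) (r 0%nat) -> mElt (mpr (i + 1) (G (tl r) i x)) (r 0%nat))); [now apply F1_tl|].
  apply (D1_all A (fun r => tl r 0%nat) (fun r x => mElt (mpr (r 0%nat) x) (tl r 0%nat) -> mElt (mpr (r 0%nat + 1) (G (tl (tl r)) (r 0%nat) x)) (tl r 0%nat))); [apply F1_var|].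
  apply D1_imp; [defin|]. apply D1_Elt; [|defin]. apply F1_mpr; [defin|].
  apply F1_graph with (fun r y => y = G (tl (tl (tl r))) (r 1%nat) (r 0%nat)); [reflexivity|].
  apply F1_S1 in HG.
  assert (HT : forall k, T0 (fun r : env => (r 0%nat .: r 2%nat .: r 1%nat .: tl (tl (tl (tl r)))) k)) by
    (intros [|[|[|k]]]; unfold tl; simpl; constructor).
  exact (S1_subst A _ HG (fun r => r 0%nat .: r 2%nat .: r 1%nat .: tl (tl (tl (tl r)))) HT).
Qed.

Section Fixed.
Variables (A : SetM -> Prop) (a : M) (G : M -> M -> M).
Hypothesis HG : F1 A (fun r => G (r 0%nat) (r 1%nat)).

Lemma prec_rel_fun (n n' v v' : M) : prec_rel a G n v -> prec_rel a G n' v' -> n = n' -> v = v'.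
Proof.
  intros (s & Hs & H0 & HS & Hv) (s' & Hs' & H0' & HS' & Hv') <-.
  assert (I : forall i, i < n + 1 -> forall x, x < s -> mElt (mpr i x) s -> mElt (mpr i x) s').
  { apply (D1_induction every (fun i => i < n + 1 -> forall x, x < s -> mElt (mpr i x) s -> mElt (mpr i x) s')).
    - defin.
    - intros _ x _ Hx. now rewrite (FinSeq_fun _ _ _ _ _ Hs Hx H0).
    - intros i IH Hi x _ Hx. destruct (FinSeq_val _ _ i Hs ltac:(lin)) as [y Hy].
      assert (Hy' := IH ltac:(lin) y (proj2 (Elt_pair_lt _ _ _ Hy)) Hy).
      assert (N := HS i ltac:(lin) y (proj2 (Elt_pair_lt _ _ _ Hy)) Hy).
      rewrite (FinSeq_fun _ _ _ _ _ Hs Hx N).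
      apply HS'; auto; [lin | now apply Elt_pair_lt in Hy']. }
  apply (FinSeq_fun _ _ n v v' Hs'); auto. apply I; auto; [lin | now apply Elt_pair_lt in Hv].
Qed.

Lemma prec_rel_0 : prec_rel a G 0 a.
Proof.
  destruct FinSeq_nil as (s0 & Hs0 & _). destruct (FinSeq_snoc s0 0 a Hs0) as (s & Hs & E).
  exists s. split; auto. split; [apply E; auto|]. split; [|apply E; auto]. intros i Hi. exfalso; lin.
Qed.

Lemma prec_rel_S (n v : M) : prec_rel a G n v -> prec_rel a G (n + 1) (G n v).
Proof.
  intros (s & Hs & H0 & HS & Hv). destruct (FinSeq_snoc s (n + 1) (G n v) Hs) as (s' & Hs' & E).
  exists s'. split; auto. split; [apply E; auto|]. split; [|apply E; auto].
  intros i Hi x _ Hx. apply E in Hx as [Hx|[-> ->]]; [|exfalso; lin].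
  apply E. destruct (classic (i < n)) as [L|L].
  - left. apply HS; auto. now apply Elt_pair_lt in Hx.
  - right. assert (i = n) by lin. subst i. split; auto. f_equal. exact (FinSeq_fun _ _ _ _ _ Hs Hx Hv).
Qed.

Lemma prec_rel_ex (n : M) : exists v, prec_rel a G n v.
Proof.
  revert n. apply (S1_induction A).
  - apply S1_ex. apply (S1_prec_rel A (fun _ => a) (fun _ => G)); defin.
  - exists a. apply prec_rel_0.
  - intros n [v Hv]. exists (G n v). now apply prec_rel_S.
Qed.

Lemma prec_spec (n v : M) : prec_rel a G n v <-> v = prec a G n.
Proof.
  assert (H : prec_rel a G n (prec a G n)) by (unfold prec; apply epsilon_spec, prec_rel_ex).
  split; [intros H'; eapply prec_rel_fun; eauto | now intros ->].
Qed.

Lemma prec_0 : prec a G 0 = a.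
Proof. symmetry. apply prec_spec, prec_rel_0. Qed.
Lemma prec_S (n : M) : prec a G (n + 1) = G n (prec a G n).
Proof. symmetry. apply prec_spec, prec_rel_S. now apply prec_spec. Qed.
End Fixed.

Lemma F1_fix2 A (G : env -> M -> M -> M) : F1 A (fun r => G (tl (tl r)) (r 0%nat) (r 1%nat)) ->
  forall r, F1 A (fun r' => G r (r' 0%nat) (r' 1%nat)).
Proof.
  intros H r. apply F1_graph with (fun r' y => y = G r (r' 0%nat) (r' 1%nat)); [reflexivity|].
  assert (HT : forall k, T0 (fun r' : env => (r' 0%nat .: r' 1%nat .: r' 2%nat .: r) k)) by
    (intros [|[|[|k]]]; simpl; constructor).
  exact (S1_subst A _ (F1_S1 _ _ H) (fun r' => r' 0%nat .: r' 1%nat .: r' 2%nat .: r) HT).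
Qed.

Lemma F1_prec A a G n : F1 A a -> F1 A (fun r => G (tl (tl r)) (r 0%nat) (r 1%nat)) ->
  F1 A n -> F1 A (fun r => prec (a r) (G r) (n r)).
Proof.
  intros Ha HG Hn. apply F1_graph with (fun r y => prec_rel (a r) (G r) (n r) y).
  - intros r y. apply (prec_spec A). now apply F1_fix2.
  - apply (S1_prec_rel A (fun r => a (tl r)) (fun r => G (tl r)) (fun r => n (tl r)));
      [now apply F1_tl | | now apply F1_tl | apply F1_var].
    apply F1_graph with (fun r y => y = G (tl (tl (tl r))) (r 0%nat) (r 1%nat)); [reflexivity|].
    assert (HT : forall k, T0 (fun r' : env => (r' 0%nat .: r' 1%nat .: r' 2%nat .: tl (tl (tl (tl r')))) k)) by
      (intros [|[|[|k]]]; unfold tl; simpl; constructor).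
    exact (S1_subst A _ (F1_S1 _ _ HG) (fun r' => r' 0%nat .: r' 1%nat .: r' 2%nat .: tl (tl (tl (tl r')))) HT).
Qed.

(** * Powers of two and counting *)

Definition pow2 (n : M) : M := prec 1 (fun _ x => 2 * x) n.

Lemma F1_pow2 A f : F1 A f -> F1 A (fun r => pow2 (f r)).
Proof.
  intros H. apply (F1_prec A (fun _ => 1) (fun _ _ x => 2 * x) f); auto; defin.
Qed.
Lemma pow2_0 : pow2 0 = 1.
Proof. apply (prec_0 every). defin. Qed.
Lemma pow2_S n : pow2 (n + 1) = 2 * pow2 n.
Proof. apply (prec_S every 1 (fun _ x => 2 * x)). defin. Qed.

Lemma Pow2_iff n p : mPow2 n p <-> p = pow2 n.
Proof.
  unfold pow2. rewrite <- (prec_spec every) by defin. unfold prec_rel.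
  split; intros (s & H1 & H2 & H3 & H4); exists s; refine (conj H1 (conj H2 (conj _ H4))); intros i.
  - intros Hi x _ Hx. now apply H3.
  - intros x [Hi Hx]. apply H3; auto. now apply Elt_pair_lt in Hx.
Qed.

Ltac defin_rel ::= first [defin_sets | apply D1_FinSeq | apply F1_pow2].

Lemma pow2_pos n : 0 < pow2 n.
Proof.
  revert n. apply (D1_induction every); [defin| |].
  - rewrite pow2_0. lin.
  - intros n IH. rewrite pow2_S. lin.
Qed.
Lemma pow2_add n m : pow2 (n + m) = pow2 n * pow2 m.
Proof.
  revert m. apply (D1_induction every); [defin| |].
  - rewrite madd_0, pow2_0. ring.
  - intros m IH. rewrite <- madd_assoc, !pow2_S, IH. ring.
Qed.
Lemma pow2_gt n : n + 1 <= pow2 n.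
Proof.
  revert n. apply (D1_induction every); [defin| |].
  - rewrite pow2_0. lin.
  - intros n IH. rewrite pow2_S. lin.
Qed.

Definition cnt (P : M -> Prop) (n : M) : M := prec 0 (fun i x => ite (P i) (x + 1) x) n.

Lemma F1_cnt A P n : D1 A (fun r => P (tl r) (r 0%nat)) -> F1 A n ->
  F1 A (fun r => cnt (P r) (n r)).
Proof.
  intros HP Hn. apply (F1_prec A (fun _ => 0) (fun r i x => ite (P r i) (x + 1) x) n);
    [apply F1_const | | auto].
  apply (F1_ite A (fun r => P (tl (tl r)) (r 0%nat))); [|defin | defin].
  apply (D1_subst A _ HP (fun r => r 0%nat .: tl (tl r))).
  intros [|k]; unfold tl; simpl; constructor.
Qed.

Ltac defin_count := first [defin_sets | apply D1_FinSeq | apply F1_pow2 | apply F1_cnt].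
Ltac defin_rel ::= defin_count.

Definition dec (P : M -> Prop) : Prop := D1 every (fun r => P (r 0%nat)).

Lemma cnt_0 P : dec P -> cnt P 0 = 0.
Proof. unfold dec; intros H. apply (prec_0 every). defin. Qed.
Lemma cnt_S P n : dec P -> cnt P (n + 1) = ite (P n) (cnt P n + 1) (cnt P n).
Proof. unfold dec; intros H. apply (prec_S every 0 (fun i x => ite (P i) (x + 1) x)). defin. Qed.

Lemma cnt_yes P n : dec P -> P n -> cnt P (n + 1) = cnt P n + 1.
Proof. intros H HP. now rewrite cnt_S, ite_true. Qed.
Lemma cnt_no P n : dec P -> ~ P n -> cnt P (n + 1) = cnt P n.
Proof. intros H HP. now rewrite cnt_S, ite_false. Qed.

Lemma bounded_induction (P : M -> Prop) (n : M) : dec P -> P 0 ->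
  (forall x, x < n -> P x -> P (x + 1)) -> forall x, x <= n -> P x.
Proof.
  intros HP H0 HS. apply (D1_induction every (fun x => x <= n -> P x)); auto.
  - unfold dec in HP. defin.
  - intros x IH Hx. apply HS; [lin | apply IH; lin].
Qed.

Lemma cnt_le P Q n : dec P -> dec Q -> (forall i, i < n -> P i -> Q i) -> cnt P n <= cnt Q n.
Proof.
  intros HP HQ H. apply (bounded_induction (fun i => cnt P i <= cnt Q i) n); [| | |now right].
  - unfold dec in *. defin.
  - rewrite !cnt_0; auto. now right.
  - intros i Hi IH. destruct (classic (P i)) as [Pi|Pi].
    + rewrite !cnt_yes; auto. lin.
    + rewrite (cnt_no P); auto. destruct (classic (Q i)); [rewrite cnt_yes | rewrite cnt_no]; auto; lin.
Qed.

Lemma cnt_ext P Q n : dec P -> dec Q -> (forall i, i < n -> (P i <-> Q i)) -> cnt P n = cnt Q n.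
Proof. intros HP HQ H. apply mle_antisym; apply cnt_le; auto; intros i Hi; now apply H. Qed.

Lemma cnt_none P n : dec P -> (forall i, i < n -> ~ P i) -> cnt P n = 0.
Proof.
  intros HP H. apply (bounded_induction (fun i => cnt P i = 0) n); [| | |now right].
  - unfold dec in *. defin.
  - now apply cnt_0.
  - intros i Hi IH. rewrite cnt_no; auto.
Qed.

Lemma cnt_or P Q n : dec P -> dec Q -> cnt (fun i => P i \/ Q i) n <= cnt P n + cnt Q n.
Proof.
  intros HP HQ. assert (HR : dec (fun i => P i \/ Q i)) by (unfold dec in *; defin).
  revert n. apply (D1_induction every (fun n => cnt (fun i => P i \/ Q i) n <= cnt P n + cnt Q n)).
  - unfold dec in *. defin.
  - rewrite !cnt_0; auto. lin.
  - intros i IH. rewrite !cnt_S by auto. unfold ite.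
    repeat destruct excluded_middle_informative; try tauto; lin.
Qed.

Lemma cnt_disjoint P Q n : dec P -> dec Q -> (forall i, i < n -> P i -> Q i -> False) ->
  cnt (fun i => P i \/ Q i) n = cnt P n + cnt Q n.
Proof.
  intros HP HQ HD. assert (HR : dec (fun i => P i \/ Q i)) by (unfold dec in *; defin).
  apply (bounded_induction (fun n => cnt (fun i => P i \/ Q i) n = cnt P n + cnt Q n) n); [| | |now right].
  - unfold dec in *. defin.
  - rewrite !cnt_0; auto. ring.
  - intros i Hi IH. rewrite !cnt_S by auto. specialize (HD i Hi). unfold ite.
    repeat destruct excluded_middle_informative; try tauto; lin.
Qed.

Lemma dec_eq a : dec (fun i => i = a).
Proof. unfold dec. defin. Qed.

Lemma cnt_single a n : a < n -> cnt (fun i => i = a) n = 1.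
Proof.
  intros Ha. destruct (lt_ex _ _ Ha) as [d Hd].
  assert (H : forall x, cnt (fun i => i = a) (a + 1 + x) = 1).
  { apply (D1_induction every); [defin| |].
    - rewrite madd_0, cnt_yes; auto using dec_eq. rewrite cnt_none; auto using dec_eq; [ring|].
      intros i Hi E. subst i. lin.
    - intros x IH. rewrite <- madd_assoc, cnt_no; auto using dec_eq. intros E. lin. }
  replace n with (a + 1 + d) by lin. apply H.
Qed.

(** By induction on [n]: a new member of [P] adds a singleton to the image, disjoint from the
    earlier part by injectivity. *)
Lemma cnt_image P f n m : dec P -> F1 every (fun r => f (r 0%nat)) ->
  (forall x, x < n -> P x -> f x < m) ->
  (forall x y, x < n -> y < n -> P x -> P y -> f x = f y -> x = y) ->
  cnt (fun y => exists x, x < n /\ (P x /\ y = f x)) m = cnt P n.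
Proof.
  intros HP Hf Hm Hi. unfold dec in HP.
  assert (HD : forall k, dec (fun y => exists x, x < k /\ (P x /\ y = f x))) by
    (intros; unfold dec; defin).
  apply (bounded_induction (fun k => cnt (fun y => exists x, x < k /\ (P x /\ y = f x)) m = cnt P k) n);
    [| | |now right].
  - unfold dec. defin.
  - rewrite cnt_none, cnt_0; auto. intros i _ (x & Hx & _). lin.
  - intros k Hk IH. destruct (classic (P k)) as [Pk|Pk].
    + rewrite cnt_yes, <- IH; auto.
      transitivity (cnt (fun y => exists x, x < k /\ (P x /\ y = f x)) m + cnt (fun i => i = f k) m);
        [|rewrite cnt_single; auto].
      rewrite <- cnt_disjoint; auto using dec_eq.
      * apply cnt_ext; auto. { unfold dec. defin. }
        intros y _. split.
        -- intros (x & Hx & Px & E). destruct (classic (x = k)) as [->|N]; auto.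
           left. exists x. repeat split; auto. assert (x <> k -> x < k) by (intros; destruct (mlt_total x k) as [?|[?|?]]; auto; [easy | exfalso; lin]). auto.
        -- intros [(x & Hx & Px & E)| ->]; [exists x | exists k]; repeat split; auto; lin.
      * intros i _ (x & Hx & Px & E) E'. assert (x = k); [|subst; lin].
        apply Hi; auto; [lin | congruence].
    + rewrite cnt_no, <- IH; auto. apply cnt_ext; auto. intros y _. split; intros (x & Hx & Px & E).
      * exists x. repeat split; auto. destruct (mlt_total x k) as [?|[?|?]]; auto; [subst; easy | exfalso; lin].
      * exists x. repeat split; auto; lin.
Qed.

Lemma cnt_inj P Q f n m : dec P -> dec Q -> F1 every (fun r => f (r 0%nat)) ->
  (forall x, x < n -> P x -> f x < m /\ Q (f x)) ->
  (forall x y, x < n -> y < n -> P x -> P y -> f x = f y -> x = y) ->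
  cnt P n <= cnt Q m.
Proof.
  intros HP HQ Hf Hm Hi. rewrite <- (cnt_image P f n m); auto; [|intros; now apply Hm].
  unfold dec in *. apply cnt_le; auto; [unfold dec; defin|].
  intros i _ (x & Hx & Px & ->). now apply Hm.
Qed.

Lemma mpr_lt (a b n m : M) : a < n -> b < m -> mpr a b < mpr n m.
Proof.
  intros Ha Hb. destruct (lt_ex _ _ Ha) as [d ->].
  assert (L := mpr_mono (a + d + 1) b (a + d + 1) m (or_intror eq_refl) ltac:(lin)).
  assert (L' : mpr a b < mpr (a + d + 1) b) by (unfold mpr; lin). lin.
Qed.

(** Each new first component [k] in [P] adds a disjoint copy of [Q], the image of [Q] under
    [mpr k]. *)
Lemma cnt_prod P Q n m : dec P -> dec Q ->
  cnt (fun z => exists a, a < n /\ exists b, b < m /\ (P a /\ Q b /\ z = mpr a b)) (mpr n m)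
  = cnt P n * cnt Q m.
Proof.
  intros HP HQ. unfold dec in HP, HQ.
  set (R := fun k z => exists a, a < k /\ exists b, b < m /\ (P a /\ Q b /\ z = mpr a b)).
  assert (HD : forall k, dec (R k)) by (intros; unfold dec, R; defin).
  apply (bounded_induction (fun k => cnt (R k) (mpr n m) = cnt P k * cnt Q m) n);
    [| | |now right].
  - unfold dec, R. defin.
  - rewrite cnt_none, cnt_0; auto; [ring|]. intros i _ (x & Hx & _). lin.
  - intros k Hk IH. destruct (classic (P k)) as [Pk|Pk].
    + rewrite cnt_yes; auto.
      replace ((cnt P k + 1) * cnt Q m) with (cnt P k * cnt Q m + cnt Q m) by ring.
      rewrite <- IH, <- (cnt_image Q (mpr k) m (mpr n m)); auto.
      2: defin.
      2: intros; now apply mpr_lt.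
      2: intros x y _ _ _ _ E; now apply mpr_inj in E as [_ E].
      rewrite <- cnt_disjoint; auto; [| unfold dec; defin |].
      * apply cnt_ext; auto; [unfold dec, R; defin|]. unfold R. intros z _. split.
        -- intros (a & Ha & b & Hb & Pa & Qb & E). destruct (mlt_total a k) as [L|[->|L]].
           ++ left. exists a. split; auto. now exists b.
           ++ right. now exists b.
           ++ exfalso; lin.
        -- intros [(a & Ha & H)|(b & Hb & Qb & E)]; [exists a | exists k]; (split; [lin|auto]).
           now exists b.
      * intros i _ (a & Ha & b & Hb & Pa & Qb & E) (b' & _ & _ & E'). rewrite E in E'.
        apply mpr_inj in E' as [-> _]. lin.
    + rewrite cnt_no, <- IH; auto. apply cnt_ext; auto. intros z _. split; intros (a & Ha & b & Hb & Pa & H).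
      * exists a. split; [destruct (mlt_total a k) as [?|[?|?]]; auto; [subst; easy | exfalso; lin]|]. now exists b.
      * exists a. split; [lin|]. now exists b.
Qed.

(** Links the two notions of cardinality: [mAtMost] bounds the lengths of injective sequences, and
    this lemma produces one whose length is the count. *)
Lemma cnt_enum P N : dec P -> exists s, mFinSeq s (cnt P N) /\
  (forall i, i < s -> forall x, x < s -> mElt (mpr i x) s -> P x /\ x < N) /\
  (forall i, i < s -> forall j, j < s -> forall x, x < s -> mElt (mpr i x) s -> mElt (mpr j x) s -> i = j).
Proof.
  intros HP. unfold dec in HP. revert N. apply (S1_induction every).
  - defin.
  - rewrite cnt_0 by auto. destruct FinSeq_nil as (s & Hs & H). exists s.
    split; auto. split; intros i _; intros; exfalso; eapply H; eauto.
  - intros N (s & Hs & H1 & H2). destruct (classic (P N)) as [PN|PN].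
    + rewrite cnt_yes by auto. destruct (FinSeq_snoc s (cnt P N) N Hs) as (s' & Hs' & E).
      exists s'. split; auto. split.
      * intros i _ x _ Hx. apply E in Hx as [Hx|[-> ->]]; [|split; auto; lin].
        destruct (Elt_pair_lt _ _ _ Hx) as [L1 L2]. destruct (H1 i L1 x L2 Hx). split; auto. lin.
      * intros i _ j _ x _ Hi Hj.
        assert (G : forall i, mElt (mpr i N) s -> False).
        { intros k Hk. destruct (Elt_pair_lt _ _ _ Hk) as [L1 L2]. destruct (H1 k L1 N L2 Hk). lin. }
        apply E in Hi as [Hi|[-> ->]], Hj as [Hj|[-> Ej]]; auto; try (exfalso; subst; eapply G; eassumption).
        destruct (Elt_pair_lt _ _ _ Hi) as [L1 L2], (Elt_pair_lt _ _ _ Hj) as [L3 _]. eauto.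
    + rewrite cnt_no by auto. exists s. split; auto. split; auto. intros i Hi x Hx Hix.
      destruct (H1 i Hi x Hx Hix). split; auto. lin.
Qed.

(** * Kleene's functionals *)

Section Kleene.

Variable Z : SetM.
Definition only (X : SetM) : Prop := X = Z.
Definition before (s i a u v : M) : Prop := exists j, j < i /\ mElt (mpr j (mpr a (mpr u v))) s.
Definition has (s a u v : M) : Prop := exists i, mElt (mpr i (mpr a (mpr u v))) s.
Definition justified (s : M) : Prop :=
  forall i p, mElt (mpr i p) s -> exists a u v, p = mpr a (mpr u v) /\ mStep Z (before s i) a u v.
Definition run (s l : M) : Prop := mFinSeq s l /\ justified s.

Lemma Phi_iff e x y : mPhi Z e x y <-> exists s l, run s l /\ has s e x y.
Proof.
  unfold mPhi, run, justified, has. split.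
  - intros (s & l & H1 & H2 & H3). exists s, l. auto.
  - intros (s & l & [H1 H2] & H3). exists s, l. auto.
Qed.

(** The recorded values occur only positively in the step relation, so an entry stays justified when
    its run is embedded in a longer one. *)
Lemma step_mono (R R' : M -> M -> M -> Prop) a u v : (forall a u v, R a u v -> R' a u v) ->
  mStep Z R a u v -> mStep Z R' a u v.
Proof.
  intros H. unfold mStep.
  intros [E|[E|[E|[E|[E|[E|[(b & c & E & w1 & w2 & H1 & H2 & H3)|[(b & c & E & w & H1 & H2)|
   [(b & c & E & x & n & Eu & [[En H1]|(m & w & En & H1 & H2)])|(b & E & H1 & H2)]]]]]]]]]; try tauto.
  - do 6 right. left. exists b, c. split; auto. exists w1, w2. auto.
  - do 7 right. left. exists b, c. split; auto. exists w. auto.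
  - do 8 right. left. exists b, c. split; auto. exists x, n. auto.
  - do 8 right. left. exists b, c. split; auto. exists x, n. split; auto. right. exists m, w. auto.
  - do 9 right. exists b. split; auto. split; auto. intros w Hw. destruct (H2 w Hw) as [k Hk]. exists k; auto.
Qed.

Lemma has_before s l a u v : mFinSeq s l -> has s a u v -> before s l a u v.
Proof. intros Hs [i Hi]. exists i. split; auto. eapply FinSeq_dom; eauto. Qed.

Lemma run_nil : exists s, run s 0.
Proof.
  destruct FinSeq_nil as (s & Hs & H). exists s. split; auto. intros i p Hp. exfalso; eapply H; eauto.
Qed.

Lemma run_app s l s' l' : run s l -> run s' l' -> exists t, run t (l + l') /\
  (forall a u v, has s a u v -> has t a u v) /\ (forall a u v, has s' a u v -> has t a u v).
Proof.
  intros [Hs Js] [Hs' Js']. destruct (FinSeq_app s l s' l' Hs Hs') as (t & Ht & E).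
  exists t. split; [split; auto|split].
  - intros i p Hp. apply E in Hp as [Hp|(j & -> & Hp)].
    + destruct (Js i p Hp) as (a & u & v & Ep & S). exists a, u, v. split; auto.
      eapply step_mono; [|exact S]. intros a' u' v' (j & Hj & Ej). exists j. split; auto. apply E; auto.
    + destruct (Js' j p Hp) as (a & u & v & Ep & S). exists a, u, v. split; auto.
      eapply step_mono; [|exact S]. intros a' u' v' (k & Hk & Ek). exists (l + k). split; [lin|].
      apply E; eauto.
  - intros a u v [i Hi]. exists i. apply E; auto.
  - intros a u v [i Hi]. exists (l + i). apply E; eauto.
Qed.

Lemma run_snoc s l a u v : run s l -> mStep Z (has s) a u v -> exists t, run t (l + 1) /\ has t a u v.
Proof.
  intros [Hs Js] S. destruct (FinSeq_snoc s l (mpr a (mpr u v)) Hs) as (t & Ht & E).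
  exists t. split; [split; auto|].
  - intros i p Hp. apply E in Hp as [Hp|[-> ->]].
    + destruct (Js i p Hp) as (a' & u' & v' & Ep & S'). exists a', u', v'. split; auto.
      eapply step_mono; [|exact S']. intros a1 u1 v1 (j & Hj & Ej). exists j. split; auto. apply E; auto.
    + exists a, u, v. split; auto. eapply step_mono; [|exact S].
      intros a1 u1 v1 H1. apply (has_before s l) in H1 as (j & Hj & Ej); auto.
      exists j. split; auto. apply E; auto.
  - exists l. apply E; auto.
Qed.

Lemma D1_before A f1 f2 f3 f4 f5 : F1 A f1 -> F1 A f2 -> F1 A f3 -> F1 A f4 -> F1 A f5 ->
  D1 A (fun r => before (f1 r) (f2 r) (f3 r) (f4 r) (f5 r)).
Proof.
  intros. unfold before. apply (D1_bex A f2); auto.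
  apply D1_Elt; [apply F1_mpr; [apply F1_var|]|now apply F1_tl].
  repeat apply F1_mpr; now apply F1_tl.
Qed.

Lemma D1_has A f1 f3 f4 f5 : F1 A f1 -> F1 A f3 -> F1 A f4 -> F1 A f5 ->
  D1 A (fun r => has (f1 r) (f3 r) (f4 r) (f5 r)).
Proof.
  intros. apply D1_ext with (fun r => before (f1 r) (f1 r) (f3 r) (f4 r) (f5 r)).
  - intros r. split; intros [i Hi]; exists i; [apply Hi|]. split; auto. now apply Elt_pair_lt in Hi.
  - now apply D1_before.
Qed.

Ltac defin_rel ::= first [defin_count | apply D1_before | apply D1_has].

Lemma S1_run f g : F1 only f -> F1 only g -> S1 only (fun r => run (f r) (g r)).
Proof.
  apply (S1_app2 only run).
  assert (HS : S1 only (fun r => mStep Z (before (r 0%nat) (r 1%nat)) (r 2%nat) (r 3%nat) (r 4%nat))).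
  { unfold mStep. assert (HZ : only Z) by reflexivity. defin. }
  apply S1_ext with (fun r => mFinSeq (r 0%nat) (r 1%nat) /\ forall i, i < r 0%nat -> forall p, p < r 0%nat ->
     mElt (mpr i p) (r 0%nat) -> exists a u v, p = mpr a (mpr u v) /\ mStep Z (before (r 0%nat) i) a u v).
  - intros r. unfold run, justified. split; intros [H1 H2]; split; auto; intros i.
    intros p Hp. apply H2; auto; now apply Elt_pair_lt in Hp.
  - apply S1_and; [apply D1_S1; defin|]. apply S1_all; [defin|]. apply S1_all; [defin|].
    apply S1_imp; [defin|]. do 3 apply S1_ex. apply S1_and; [apply D1_S1; defin|].
    apply (S1_subst only _ HS (fun r => r 5%nat .: r 4%nat .: r 2%nat .: r 1%nat .: r 0%nat .: r)).
    intros [|[|[|[|[|k]]]]]; simpl; constructor.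
Qed.

Lemma S1_Phi f g h : F1 only f -> F1 only g -> F1 only h ->
  S1 only (fun r => mPhi Z (f r) (g r) (h r)).
Proof.
  apply (S1_app3 only (mPhi Z)).
  apply S1_ext with (fun r => exists s l, run s l /\ has s (r 0%nat) (r 1%nat) (r 2%nat)).
  - intros r. symmetry. apply Phi_iff.
  - do 2 apply S1_ex. apply S1_and; [apply S1_run; defin | apply D1_S1; defin].
Qed.

Lemma Phi_run s l a u v : run s l -> mStep Z (has s) a u v -> mPhi Z a u v.
Proof.
  intros H S. destruct (run_snoc s l a u v H S) as (t & Ht & E). apply Phi_iff. eauto.
Qed.

Lemma gather2 a u v a' u' v' : mPhi Z a u v -> mPhi Z a' u' v' ->
  exists s l, run s l /\ has s a u v /\ has s a' u' v'.
Proof.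
  intros H1 H2. apply Phi_iff in H1 as (s1 & l1 & R1 & E1), H2 as (s2 & l2 & R2 & E2).
  destruct (run_app s1 l1 s2 l2 R1 R2) as (t & Rt & H1 & H2). exists t, (l1 + l2). auto.
Qed.

(** Puts the computations of all unsuccessful trials of a search into one run. Their number may be
    nonstandard, so this is a Sigma-1 induction and not an iteration of [gather2]. *)
Lemma gather_search b u v : (forall w, w < v -> exists k, mPhi Z b (mpr u w) (k + 1)) ->
  forall j, v < j \/ exists s l, run s l /\ forall w, w < j -> exists k, has s b (mpr u w) (k + 1).
Proof.
  intros H. apply (S1_induction only).
  - apply S1_or; [apply D1_S1; defin|]. do 2 apply S1_ex.
    apply S1_and; [apply S1_run; defin | defin].
  - right. destruct run_nil as [s Hs]. exists s, 0. split; auto. intros w Hw. exfalso; lin.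
  - intros j [L|(s & l & R & E)]; [left; lin|].
    destruct (classic (j < v)) as [Hj|Hj]; [right | left; lin].
    destruct (H j Hj) as [k Hk]. apply Phi_iff in Hk as (s' & l' & R' & E').
    destruct (run_app s l s' l' R R') as (t & Rt & H1 & H2). exists t, (l + l'). split; auto.
    intros w Hw. destruct (mlt_total w j) as [L|[->|L]]; [|eauto|exfalso; lin].
    destruct (E w L) as [k' Hk']. eauto.
Qed.

(** Together with [Phi_fun], this lets later arguments treat [mPhi] as an inductively generated
    partial function and forget the runs. *)
Lemma Phi_intro e x y : mStep Z (mPhi Z) e x y -> mPhi Z e x y.
Proof.
  destruct run_nil as [s0 R0].
  intros [E|[E|[E|[E|[E|[E|[(b & c & E & w1 & w2 & H1 & H2 & H3)|[(b & c & E & w & H1 & H2)|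
   [(b & c & E & x' & n & Eu & [[En H1]|(m & w & En & H1 & H2)])|(b & E & H1 & H2)]]]]]]]]].
  1-6: apply (Phi_run s0 0); auto; unfold mStep; tauto.
  - destruct (gather2 _ _ _ _ _ _ H1 H2) as (s & l & R & E1 & E2). apply (Phi_run s l); auto.
    do 6 right. left. exists b, c. split; auto. exists w1, w2. auto.
  - destruct (gather2 _ _ _ _ _ _ H1 H2) as (s & l & R & E1 & E2). apply (Phi_run s l); auto.
    do 7 right. left. exists b, c. split; auto. exists w. auto.
  - destruct (gather2 _ _ _ _ _ _ H1 H1) as (s & l & R & E1 & E2). apply (Phi_run s l); auto.
    do 8 right. left. exists b, c. split; auto. exists x', n. auto.
  - destruct (gather2 _ _ _ _ _ _ H1 H2) as (s & l & R & E1 & E2). apply (Phi_run s l); auto.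
    do 8 right. left. exists b, c. split; auto. exists x', n. split; auto. right. exists m, w. auto.
  - destruct (gather_search b x y H2 y) as [L|(s & l & R & E2)]; [exfalso; lin|].
    apply Phi_iff in H1 as (s' & l' & R' & E1).
    destruct (run_app s l s' l' R R') as (t & Rt & G1 & G2). apply (Phi_run t (l + l')); auto.
    do 9 right. exists b. split; auto. split; auto. intros w Hw. destruct (E2 w Hw) as [k Hk]. exists k; auto.
Qed.

Lemma step_fun (R R' : M -> M -> M -> Prop) a u v v' :
  (forall a u v v', R a u v -> R' a u v' -> v = v') ->
  mStep Z R a u v -> mStep Z R' a u v' -> v = v'.
Proof.
  intros H S S'.
  assert (T : forall s t x y, mpr s x = mpr t y -> s = t /\ x = y) by (intros; now apply mpr_inj).
  destruct S as [E|[E|[E|[E|[E|[E|[(b & c & E & w1 & w2 & H1 & H2 & H3)|[(b & c & E & w & H1 & H2)|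
   [(b & c & E & x & n & Eu & [[En H1]|(m & w & En & H1 & H2)])|(b & E & H1 & H2)]]]]]]]]];
  (destruct S' as [E'|[E'|[E'|[E'|[E'|[E'|[(b' & c' & E' & w1' & w2' & H1' & H2' & H3')|[(b' & c' & E' & w' & H1' & H2')|
   [(b' & c' & E' & x' & n' & Eu' & [[En' H1']|(m' & w' & En' & H1' & H2')])|(b' & E' & H1' & H2')]]]]]]]]]);
  repeat match goal with H : _ /\ _ |- _ => destruct H end; subst;
  match goal with
  | H : mpr _ _ = mpr _ _ |- _ => apply T in H as [? ?]; try (exfalso; lin)
  end; subst; auto.
  all: try congruence.
  - destruct H3 as [w E], H1 as [w' E']. subst. now apply mpr_inj in E' as [? ?].
  - destruct H3 as [w E], H1 as [w' E']. subst. now apply mpr_inj in E' as [? ?].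
  - destruct H3 as [[? ?]|[? ?]], H1 as [[? ?]|[? ?]]; subst; easy.
  - apply mpr_inj in H3 as [-> ->]. f_equal; eauto.
  - apply mpr_inj in H3 as [-> ->]. assert (w = w') by eauto. subst. eauto.
  - apply T in E' as [_ E']. apply mpr_inj in E' as [-> ->]. eauto.
  - apply T in E' as [_ E']. apply mpr_inj in E' as [-> ->]. assert (m = m') by lin. subst.
    assert (w = w') by eauto. subst. eauto.
  (* The smaller of two search results has value 0, whereas the larger one claims a successor
     there. *)
  - destruct (mlt_total v v') as [L|[L|L]]; auto; exfalso.
    + destruct (H2' v L) as [k Hk]. specialize (H _ _ _ _ H1 Hk). lin.
    + destruct (H2 v' L) as [k Hk]. specialize (H _ _ _ _ Hk H1'). lin.
Qed.

Lemma Phi_fun e x y y' : mPhi Z e x y -> mPhi Z e x y' -> y = y'.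
Proof.
  intros H1 H2. apply Phi_iff in H1 as (s & l & [Hs Js] & [i Hi]), H2 as (s' & l' & R' & E').
  (* Strong induction on the position in the first run, with the position in the second arbitrary.
     The bounds by [s] and [s'] make the statement Delta-1; the entries of the runs satisfy them
     anyway. *)
  assert (G : forall i, forall a, a < s -> forall u, u < s -> forall v, v < s -> forall v', v' < s' ->
    mElt (mpr i (mpr a (mpr u v))) s -> has s' a u v' -> v = v').
  { apply (strong_induction every (fun i => forall a, a < s -> forall u, u < s -> forall v, v < s ->
      forall v', v' < s' -> mElt (mpr i (mpr a (mpr u v))) s -> has s' a u v' -> v = v')).
    - defin.
    - clear i Hi. intros i IH a _ u _ v _ v' _ Hi Hv'.
      destruct (Js i _ Hi) as (a1 & u1 & v1 & E & S). apply mpr_inj in E as [<- E]. apply mpr_inj in E as [<- <-].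
      destruct R' as [Hs' Js'], Hv' as [i' Hi'].
      destruct (Js' i' _ Hi') as (a1 & u1 & v1 & E & S'). apply mpr_inj in E as [<- E]. apply mpr_inj in E as [<- <-].
      revert S S'. apply step_fun. clear a u v v' Hi Hi' E'. intros a u v v' (j & Hj & Ej) (j' & Hj' & Ej').
      destruct (Elt_pair_lt _ _ _ Ej) as [_ L1], (Elt_pair_lt _ _ _ Ej') as [_ L2].
      assert (P1 := mpr_l a (mpr u v)). assert (P2 := mpr_r a (mpr u v)).
      assert (P3 := mpr_l u v). assert (P4 := mpr_r u v).
      assert (P5 := mpr_r a (mpr u v')). assert (P6 := mpr_r u v').
      apply (IH j Hj a ltac:(lin) u ltac:(lin) v ltac:(lin) v' ltac:(lin)); auto. now exists j'. }
  destruct (Elt_pair_lt _ _ _ Hi) as [_ L1]. destruct E' as [i' Hi'].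
  destruct (Elt_pair_lt _ _ _ Hi') as [_ L2].
  assert (P1 := mpr_l e (mpr x y)). assert (P2 := mpr_r e (mpr x y)).
  assert (P3 := mpr_l x y). assert (P4 := mpr_r x y).
  assert (P5 := mpr_r e (mpr x y')). assert (P6 := mpr_r x y').
  apply (G i e ltac:(lin) x ltac:(lin) y ltac:(lin) y' ltac:(lin)); auto. now exists i'.
Qed.
End Kleene.

(** * Indices for definable functions *)

Section Indices.
Ltac defin_rel ::= first [defin_count | apply S1_Phi].
Variable Z : SetM.

(** [f] is computed on the arguments coded by [cd]; pairing is not onto, so functions of
    several arguments live on a type of tuples. *)
Definition Cmp {I : Type} (cd f : I -> M) : Prop := exists e, forall i, mPhi Z e (cd i) (f i).

Section Closure.
Context {I : Type} {cd : I -> M}.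

Lemma Cmp_const c : Cmp cd (fun _ => c).
Proof. exists (mpr 0 c). intros i. apply Phi_intro. now left. Qed.
Lemma Cmp_id : Cmp cd cd.
Proof. exists (mpr 1 0). intros i. apply Phi_intro. right; now left. Qed.
Lemma Cmp_pair f g : Cmp cd f -> Cmp cd g -> Cmp cd (fun i => mpr (f i) (g i)).
Proof.
  intros [b Hb] [c Hc]. exists (mpr 6 (mpr b c)). intros i. apply Phi_intro.
  do 6 right. left. exists b, c. split; auto. exists (f i), (g i). auto.
Qed.
Lemma Cmp_comp {J : Type} (cd' : J -> M) (h : I -> J) g :
  Cmp cd (fun i => cd' (h i)) -> Cmp cd' g -> Cmp cd (fun i => g (h i)).
Proof.
  intros [c Hc] [b Hb]. exists (mpr 7 (mpr b c)). intros i. apply Phi_intro.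
  do 7 right. left. exists b, c. split; auto. exists (cd' (h i)). auto.
Qed.
Lemma Cmp_of_index e (f g : I -> M) : (forall i, mPhi Z e (g i) (f i)) -> Cmp cd g -> Cmp cd f.
Proof.
  intros He Hg. apply (Cmp_comp g (fun i => i)); auto. now exists e.
Qed.
Lemma Cmp_fst f g : Cmp cd (fun i => mpr (f i) (g i)) -> Cmp cd f.
Proof.
  apply (Cmp_of_index (mpr 3 0)). intros i. apply Phi_intro. do 3 right. left. split; auto. now exists (g i).
Qed.
Lemma Cmp_snd f g : Cmp cd (fun i => mpr (f i) (g i)) -> Cmp cd g.
Proof.
  apply (Cmp_of_index (mpr 4 0)). intros i. apply Phi_intro. do 4 right. left. split; auto. now exists (f i).
Qed.
Lemma Cmp_succ f : Cmp cd f -> Cmp cd (fun i => f i + 1).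
Proof.
  apply (Cmp_of_index (mpr 2 0)). intros i. apply Phi_intro. do 2 right. now left.
Qed.
Lemma Cmp_oracle f : Cmp cd f -> Cmp cd (fun i => ite (f i ∈ₘ Z) 1 0).
Proof.
  apply (Cmp_of_index (mpr 5 0)). intros i. apply Phi_intro. do 5 right. left. split; auto.
  unfold ite. destruct excluded_middle_informative; auto.
Qed.

Lemma Cmp_search (phi : I -> M -> M) f :
  Cmp (fun p : I * M => mpr (cd (fst p)) (snd p)) (fun p => phi (fst p) (snd p)) ->
  (forall i, phi i (f i) = 0 /\ forall w, w < f i -> phi i w <> 0) -> Cmp cd f.
Proof.
  intros [b Hb] Hf. exists (mpr 9 b). intros i. apply Phi_intro. do 9 right.
  destruct (Hf i) as [H0 H1]. exists b. split; auto. split.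
  - rewrite <- H0. apply (Hb (i, f i)).
  - intros w Hw. destruct (zero_or_succ (phi i w)) as [E|[k E]]; [now apply H1 in E|].
    exists k. rewrite <- E. apply (Hb (i, w)).
Qed.
End Closure.

Definition cd2 (p : M * M) : M := mpr (fst p) (snd p).
Definition cd3 (p : M * M * M) : M := mpr (cd2 (fst p)) (snd p).

(** The definability of [F] makes the claim that the index gives the value [F x n] a Sigma-1
    statement, as the induction on [n] requires. *)
Lemma Cmp_rec (F : M -> M -> M) (B : M -> M) (C : M -> M -> M -> M) :
  Cmp (fun x => x) B -> Cmp cd3 (fun p => C (fst (fst p)) (snd (fst p)) (snd p)) ->
  F1 (only Z) (fun r => F (r 0%nat) (r 1%nat)) ->
  (forall x, F x 0 = B x) -> (forall x n, F x (n + 1) = C x n (F x n)) ->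
  Cmp cd2 (fun p => F (fst p) (snd p)).
Proof.
  intros [b Hb] [c Hc] HF H0 HS. exists (mpr 8 (mpr b c)). intros [x n]. unfold cd2. simpl.
  revert n. apply (S1_induction (only Z)); [defin| |].
  - apply Phi_intro. do 8 right. left. exists b, c. split; auto. exists x, 0. split; auto.
    left. split; auto. rewrite H0. apply Hb.
  - intros n IH. apply Phi_intro. do 8 right. left. exists b, c. split; auto. exists x, (n + 1). split; auto.
    right. exists n, (F x n). split; auto. split; auto. rewrite HS. apply (Hc (x, n, F x n)).
Qed.

Lemma Cmp_app2 {I} (cd : I -> M) (F : M -> M -> M) f g : Cmp cd2 (fun p => F (fst p) (snd p)) ->
  Cmp cd f -> Cmp cd g -> Cmp cd (fun i => F (f i) (g i)).
Proof.
  intros HF Hf Hg. apply (Cmp_comp cd2 (fun i => (f i, g i)) (fun p => F (fst p) (snd p))); auto.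
  now apply Cmp_pair.
Qed.

Lemma Cmp3_1 : Cmp cd3 (fun p => fst (fst p)).
Proof. apply (Cmp_fst _ (fun p => snd (fst p))), (Cmp_fst _ (fun p => snd p)), Cmp_id. Qed.
Lemma Cmp3_2 : Cmp cd3 (fun p => snd (fst p)).
Proof. apply (Cmp_snd (fun p => fst (fst p))), (Cmp_fst _ (fun p => snd p)), Cmp_id. Qed.
Lemma Cmp3_3 : Cmp cd3 (fun p => snd p).
Proof. apply (Cmp_snd (fun p => cd2 (fst p))), Cmp_id. Qed.

Lemma Cmp_add {I} (cd : I -> M) f g : Cmp cd f -> Cmp cd g -> Cmp cd (fun i => f i + g i).
Proof.
  apply (Cmp_app2 cd (fun x y => x + y)), (Cmp_rec _ (fun x => x) (fun x n w => w + 1)); intros; try ring.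
  - apply Cmp_id.
  - apply Cmp_succ, Cmp3_3.
  - defin.
Qed.

Lemma Cmp_mul {I} (cd : I -> M) f g : Cmp cd f -> Cmp cd g -> Cmp cd (fun i => f i * g i).
Proof.
  apply (Cmp_app2 cd (fun x y => x * y)), (Cmp_rec _ (fun x => 0) (fun x n w => w + x)); intros; try ring.
  - apply Cmp_const.
  - apply Cmp_add; [apply Cmp3_3 | apply Cmp3_1].
  - defin.
Qed.

(** Truncated subtraction, which reduces comparisons to tests for zero. *)
Definition sub (x y : M) : M :=
  epsilon (inhabits 0) (fun d => x = y + d \/ x < y /\ d = 0).

Lemma sub_spec x y d : x = y + d \/ x < y /\ d = 0 <-> d = sub x y.
Proof.
  assert (H : x = y + sub x y \/ x < y /\ sub x y = 0).
  { unfold sub. apply epsilon_spec. destruct (classic (x < y)) as [L|L]; [exists 0; auto|].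
    destruct (le_ex y x ltac:(lin)) as [e He]. exists e. auto. }
  split; [|now intros ->]. intros [E|[L E]]; destruct H as [E'|[L' E']]; lin.
Qed.

Lemma F1_sub A f g : F1 A f -> F1 A g -> F1 A (fun r => sub (f r) (g r)).
Proof.
  apply (F1_app2 A sub). apply F1_graph with (fun r d => r 0%nat = r 1%nat + d \/ r 0%nat < r 1%nat /\ d = 0).
  - intros r y. apply sub_spec.
  - defin.
Qed.

Ltac sub_cases x y := let H := fresh in pose proof (proj2 (sub_spec x y _) eq_refl) as H;
  destruct H as [H|[? H]].

Lemma Cmp_pred {I} (cd : I -> M) f : Cmp cd f -> Cmp cd (fun i => sub (f i) 1).
Proof.
  intros Hf. apply (Cmp_app2 cd (fun x y => sub y 1) (fun _ => 0) f); auto using Cmp_const.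
  apply (Cmp_rec (fun x y => sub y 1) (fun x => 0) (fun x n w => n)).
  - apply Cmp_const.
  - apply Cmp3_2.
  - apply F1_sub; defin.
  - intros x. symmetry. apply sub_spec. right. split; auto. lin.
  - intros x n. symmetry. apply sub_spec. left. ring.
Qed.

Lemma Cmp_sub {I} (cd : I -> M) f g : Cmp cd f -> Cmp cd g -> Cmp cd (fun i => sub (f i) (g i)).
Proof.
  apply (Cmp_app2 cd sub), (Cmp_rec sub (fun x => x) (fun x n w => sub w 1)).
  - apply Cmp_id.
  - apply Cmp_pred, Cmp3_3.
  - apply F1_sub; defin.
  - intros x. symmetry. apply sub_spec. left; ring.
  - intros x n. symmetry. apply sub_spec.
    sub_cases x n; sub_cases (sub x n) 1; [left; lin | right; lin.. | right; lin].
Qed.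

(** Truth is represented by 0 because the search operator stops at a zero. *)
Definition chi (P : Prop) : M := ite P 0 1.
Definition CmpP {I} (cd : I -> M) (P : I -> Prop) : Prop := Cmp cd (fun i => chi (P i)).

Lemma chi_iff P x : (P /\ x = 0 \/ ~ P /\ x = 1) <-> x = chi P.
Proof. unfold chi, ite. destruct excluded_middle_informative; tauto. Qed.

Lemma chi_0 P : chi P = 0 <-> P.
Proof.
  unfold chi, ite. destruct excluded_middle_informative; [tauto|]. split; [intros; exfalso; lin | tauto].
Qed.

Lemma Cmp_ext {I} (cd f g : I -> M) : (forall i, f i = g i) -> Cmp cd f -> Cmp cd g.
Proof. intros H [e He]. exists e. intros i. now rewrite <- H. Qed.

Lemma CmpP_zero {I} (cd : I -> M) f : Cmp cd f -> CmpP cd (fun i => f i = 0).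
Proof.
  intros Hf. apply (Cmp_app2 cd (fun x y => chi (y = 0)) (fun _ => 0) f); auto using Cmp_const.
  apply (Cmp_rec (fun x y => chi (y = 0)) (fun x => 0) (fun x n w => 1)).
  - apply Cmp_const.
  - apply Cmp_const.
  - unfold chi. defin.
  - intros x. symmetry. apply chi_iff. auto.
  - intros x n. symmetry. apply chi_iff. right. split; auto. intros; lin.
Qed.

Lemma CmpP_ext {I} (cd : I -> M) (P Q : I -> Prop) : (forall i, P i <-> Q i) -> CmpP cd P -> CmpP cd Q.
Proof.
  intros H. apply Cmp_ext. intros i. f_equal. now apply propositional_extensionality.
Qed.

Lemma CmpP_and {I} (cd : I -> M) P Q : CmpP cd P -> CmpP cd Q -> CmpP cd (fun i => P i /\ Q i).
Proof.
  intros HP HQ. apply CmpP_ext with (fun i => chi (P i) + chi (Q i) = 0).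
  - intros i. rewrite <- (chi_0 (P i)), <- (chi_0 (Q i)) at 2. split; [split; lin | intros []; lin].
  - now apply CmpP_zero, Cmp_add.
Qed.
Lemma CmpP_or {I} (cd : I -> M) P Q : CmpP cd P -> CmpP cd Q -> CmpP cd (fun i => P i \/ Q i).
Proof.
  intros HP HQ. apply CmpP_ext with (fun i => chi (P i) * chi (Q i) = 0).
  - intros i. rewrite <- (chi_0 (P i)), <- (chi_0 (Q i)) at 2.
    destruct (zero_or_succ (chi (P i))) as [->|[x ->]], (zero_or_succ (chi (Q i))) as [->|[y ->]];
      split; intros; try lin.
    + left; auto.
    + left; auto.
    + right; auto.
    + destruct H; exfalso; lin.
  - now apply CmpP_zero, Cmp_mul.
Qed.
Lemma CmpP_not {I} (cd : I -> M) P : CmpP cd P -> CmpP cd (fun i => ~ P i).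
Proof.
  intros HP. apply CmpP_ext with (fun i => sub 1 (chi (P i)) = 0).
  - intros i. sub_cases 1 (chi (P i)); unfold chi, ite in *; destruct excluded_middle_informative;
      split; intros; try tauto; try (exfalso; lin); lin.
  - apply CmpP_zero, Cmp_sub; auto. apply Cmp_const.
Qed.
Lemma CmpP_imp {I} (cd : I -> M) P Q : CmpP cd P -> CmpP cd Q -> CmpP cd (fun i => P i -> Q i).
Proof.
  intros HP HQ. apply CmpP_ext with (fun i => ~ P i \/ Q i); [intros; tauto|].
  apply CmpP_or; auto. now apply CmpP_not.
Qed.
Lemma CmpP_lt {I} (cd : I -> M) f g : Cmp cd f -> Cmp cd g -> CmpP cd (fun i => f i < g i).
Proof.
  intros Hf Hg. apply CmpP_ext with (fun i => sub (f i + 1) (g i) = 0).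
  - intros i. sub_cases (f i + 1) (g i); split; intros; lin.
  - apply CmpP_zero, Cmp_sub; auto. now apply Cmp_succ.
Qed.
Lemma CmpP_eq {I} (cd : I -> M) f g : Cmp cd f -> Cmp cd g -> CmpP cd (fun i => f i = g i).
Proof.
  intros Hf Hg. apply CmpP_ext with (fun i => ~ (f i < g i) /\ ~ (g i < f i)).
  - intros i. split; [intros []; lin | intros; split; lin].
  - apply CmpP_and; apply CmpP_not, CmpP_lt; auto.
Qed.
Lemma CmpP_oracle {I} (cd : I -> M) f : Cmp cd f -> CmpP cd (fun i => f i ∈ₘ Z).
Proof.
  intros Hf. apply CmpP_ext with (fun i => ~ ite (f i ∈ₘ Z) 1 0 = 0).
  - intros i. unfold ite. destruct excluded_middle_informative; split; intros; try tauto. intros N. lin.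
  - now apply CmpP_not, CmpP_zero, Cmp_oracle.
Qed.

(** The search is for the least [v] with [P i v] or [t i <= v]. The second alternative makes it
    terminate, and the quantifier is true exactly when the result is below [t i]. *)
Lemma CmpP_bex {I} (cd : I -> M) t (P : I -> M -> Prop) : Cmp cd t ->
  (forall i, D1 (only Z) (fun r => P i (r 0%nat))) ->
  CmpP (fun p : I * M => mpr (cd (fst p)) (snd p)) (fun p => P (fst p) (snd p)) ->
  CmpP cd (fun i => exists x, x < t i /\ P i x).
Proof.
  intros Ht HD HP.
  assert (L : forall i, exists v, (t i <= v \/ P i v) /\ forall w, w < v -> ~ (t i <= w \/ P i w)).
  { intros i. assert (H := HD i). apply (least (only Z) (fun v => t i <= v \/ P i v)) with (t i); [defin|].
    left; now right. }
  set (f := fun i => epsilon (inhabits 0) (fun v => (t i <= v \/ P i v) /\ forall w, w < v -> ~ (t i <= w \/ P i w))).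
  assert (Hf : forall i, (t i <= f i \/ P i (f i)) /\ forall w, w < f i -> ~ (t i <= w \/ P i w)) by
    (intros i; apply epsilon_spec, L).
  assert (Cf : Cmp cd f).
  { apply (Cmp_search (fun i v => chi (t i <= v \/ P i v))).
    - apply (CmpP_or _ (fun p => t (fst p) <= snd p) (fun p => P (fst p) (snd p))); auto.
      apply CmpP_ext with (fun p => ~ snd p < t (fst p)).
      + intros [i x]; simpl. split; intros; lin.
      + apply CmpP_not, CmpP_lt; [apply (Cmp_snd (fun p => cd (fst p))), Cmp_id|].
        apply (Cmp_comp cd (fun p : I * M => fst p)); auto.
        apply (Cmp_fst _ (fun p => snd p)), Cmp_id.
    - intros i. setoid_rewrite chi_0. apply Hf. }
  apply CmpP_ext with (fun i => f i < t i); [|now apply CmpP_lt].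
  intros i. destruct (Hf i) as [H1 H2]. split.
  - intros H. exists (f i). split; auto. destruct H1; auto. exfalso; lin.
  - intros (x & Hx & Px). apply NNPP; intros N. apply (H2 x); [lin | auto].
Qed.

Lemma T0_Cmp g : T0 g -> forall {I} (cd : I -> M) (r : I -> env),
  (forall k, Cmp cd (fun i => r i k)) -> Cmp cd (fun i => g (r i)).
Proof. induction 1; intros I cd r Hr; auto using Cmp_const, Cmp_add, Cmp_mul. Qed.

Lemma D0_Cmp P : D0 (only Z) P -> forall {I} (cd : I -> M) (r : I -> env),
  (forall k, Cmp cd (fun i => r i k)) -> CmpP cd (fun i => P (r i)).
Proof.
  (* The quantified variable is handled by passing to the argument type [I * M]. The universal
     quantifier is obtained from this case by two negations. *)
  assert (HB : forall P, D0 (only Z) P ->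
    (forall {I} (cd : I -> M) (r : I -> env), (forall k, Cmp cd (fun i => r i k)) -> CmpP cd (fun i => P (r i))) ->
    forall {I} (cd : I -> M) (r : I -> env) t, T0 t -> (forall k, Cmp cd (fun i => r i k)) ->
    CmpP cd (fun i => exists x, x < t (r i) /\ P (x .: r i))).
  { intros Q HQ IH I cd r t Ht Hr. apply (CmpP_bex cd (fun i => t (r i)) (fun i x => Q (x .: r i))).
    - now apply T0_Cmp.
    - intros i. apply D0_D1. apply (D0_subst _ _ HQ (fun r' => r' 0%nat .: r i)).
      intros [|k]; simpl; constructor.
    - apply (IH _ _ (fun p : I * M => snd p .: r (fst p))). intros [|k]; simpl.
      + apply (Cmp_snd (fun p => cd (fst p))), Cmp_id.
      + apply (Cmp_comp cd (fun p : I * M => fst p) (fun i => r i k)); auto.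
        apply (Cmp_fst _ (fun p => snd p)), Cmp_id. }
  induction 1; intros I cd r Hr.
  - apply CmpP_ext with (fun _ => 1 = 0); [intros; split; [intros; lin | easy]|].
    apply CmpP_zero, Cmp_const.
  - apply CmpP_eq; now apply T0_Cmp.
  - apply CmpP_lt; now apply T0_Cmp.
  - rewrite H. apply (CmpP_oracle cd (fun i => f (r i))); now apply T0_Cmp.
  - apply CmpP_imp; auto.
  - apply CmpP_and; auto.
  - apply CmpP_or; auto.
  - apply CmpP_ext with (fun i => ~ exists x, x < t (r i) /\ (P (x .: r i) -> False)).
    + intros i. split; [|intros H1 (x & Hx & N); auto].
      intros N x Hx. apply NNPP; intros Nx. apply N; eauto.
    + apply CmpP_not. apply (HB (fun r => P r -> False)); auto.
      * apply D0_imp; auto. apply D0_bot.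
      * intros. apply (CmpP_not _ (fun i => P (r0 i))). auto.
  - apply (HB P); auto.
Qed.

(** Kleene's normal form: search for a pair (value, witness). *)
Theorem F1_Cmp f : F1 (only Z) f -> forall {I} (cd : I -> M) (r : I -> env),
  (forall k, Cmp cd (fun i => r i k)) -> Cmp cd (fun i => f (r i)).
Proof.
  intros Hf I cd r Hr. apply F1_S1, S1_elim in Hf as (Q & HQ & E).
  set (Q' := fun r : env => exists y, y < r 0%nat + 1 /\ exists w, w < r 0%nat + 1 /\ (r 0%nat = mpr y w /\ Q (w .: y .: tl r))).
  assert (HQ' : D0 (only Z) Q').
  { apply (D0_ex _ (fun r => r 0%nat + 1) (fun r => exists w, w < r 1%nat + 1 /\ (r 1%nat = mpr (r 0%nat) w /\ Q (w .: r 0%nat .: tl (tl r)))));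
      [repeat constructor|].
    apply (D0_ex _ (fun r => r 1%nat + 1) (fun r => r 2%nat = mpr (r 1%nat) (r 0%nat) /\ Q (r 0%nat .: r 1%nat .: tl (tl (tl r)))));
      [repeat constructor|].
    apply D0_and; [unfold mpr; repeat constructor|].
    apply (D0_subst _ _ HQ). intros [|[|k]]; unfold tl; simpl; constructor. }
  assert (HE : forall r z, Q' (z .: r) <-> exists w, z = mpr (f r) w /\ Q (w .: f r .: r)).
  { intros r' z. unfold Q'. simpl. change (tl (z .: r')) with r'. split.
    - intros (y & _ & w & _ & Ez & H). assert (Ey : y = f r') by (apply (E (y .: r')); eauto).
      subst y. now exists w.
    - intros (w & Ez & H). assert (L1 := mpr_l (f r') w). assert (L2 := mpr_r (f r') w).
      exists (f r'). split; [lin|]. exists w. split; [lin | auto]. }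
  set (g := fun i => epsilon (inhabits 0) (fun z => Q' (z .: r i) /\ forall z', z' < z -> ~ Q' (z' .: r i))).
  assert (Hg : forall i, Q' (g i .: r i) /\ forall z', z' < g i -> ~ Q' (z' .: r i)).
  { intros i. unfold g. apply epsilon_spec.
    destruct (proj1 (E (f (r i) .: r i)) eq_refl) as [w Hw].
    apply (least (only Z) (fun z => Q' (z .: r i))) with (mpr (f (r i)) w).
    - apply D0_D1. apply (D0_subst _ _ HQ' (fun r' => r' 0%nat .: r i)). intros [|k]; simpl; constructor.
    - apply HE. eauto. }
  assert (Cg : Cmp cd g).
  { apply (Cmp_search (fun i z => chi (Q' (z .: r i)))).
    - apply (D0_Cmp Q' HQ' (fun p : I * M => mpr (cd (fst p)) (snd p)) (fun p : I * M => snd p .: r (fst p))).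
      intros [|k]; simpl.
      + apply (Cmp_snd (fun p => cd (fst p))), Cmp_id.
      + apply (Cmp_comp cd (fun p : I * M => fst p) (fun i => r i k)); auto.
        apply (Cmp_fst _ (fun p => snd p)), Cmp_id.
    - intros i. setoid_rewrite chi_0. apply Hg. }
  set (h := fun i => epsilon (inhabits 0) (fun w => g i = mpr (f (r i)) w)).
  apply (Cmp_fst _ h). apply Cmp_ext with g; auto. intros i.
  apply (epsilon_spec (inhabits 0) (fun w => g i = mpr (f (r i)) w)).
  destruct (proj1 (HE (r i) (g i)) (proj1 (Hg i))) as (w & Ew & _). eauto.
Qed.
End Indices.

(** * Binary strings and measure *)

Lemma D1_BinString A f g : F1 A f -> F1 A g -> D1 A (fun r => mBinString (f r) (g r)).
Proof.
  apply (D1_app2 A mBinString).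
  apply D1_ext with (fun r => mFinSeq (r 0%nat) (r 1%nat) /\ forall i, i < r 0%nat ->
    forall x, x < r 0%nat -> mElt (mpr i x) (r 0%nat) -> x < 2).
  - intros r. split; intros [H1 H2]; split; auto; intros i.
    + intros x Hx. destruct (Elt_pair_lt _ _ _ Hx). eauto.
    + eauto.
  - defin.
Qed.

Lemma D1_Initial A f g : F1 A f -> F1 A g -> D1 A (fun r => mInitial (f r) (g r)).
Proof.
  apply (D1_app2 A mInitial).
  apply D1_ext with (fun r => forall p, p < r 0%nat -> mElt p (r 0%nat) -> mElt p (r 1%nat)).
  - intros r. split; intros H p; auto. intros Hp. apply H; auto. now apply Elt_lt.
  - defin.
Qed.
Ltac defin_rel ::= first [defin_count | apply D1_BinString | apply D1_Initial].

Lemma D1_MinimalIn A f g : F1 A f -> F1 A g -> D1 A (fun r => mMinimalIn (f r) (g r)).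
Proof.
  apply (D1_app2 A mMinimalIn).
  apply D1_ext with (fun r => mElt (r 0%nat) (r 1%nat) /\ ~ exists t, t < r 1%nat /\
    (mElt t (r 1%nat) /\ mInitial t (r 0%nat) /\ ~ t = r 0%nat)).
  - intros r. split; intros [H1 H2]; split; auto; intros (t & Ht); apply H2; exists t; [|tauto].
    split; auto. now apply Elt_lt.
  - defin.
Qed.

Lemma FinSeq_len (s l : M) : mFinSeq s l -> l <= s.
Proof.
  intros H. destruct (zero_or_succ l) as [->|[k ->]]; [destruct (zero_or_succ s) as [->|[? ->]]; lin|].
  destruct (FinSeq_val _ _ k H ltac:(lin)) as [x Hx]. apply Elt_pair_lt in Hx. lin.
Qed.

Lemma FinSeq_len_fun (s l l' : M) : mFinSeq s l -> mFinSeq s l' -> l = l'.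
Proof.
  assert (G : forall l l', mFinSeq s l -> mFinSeq s l' -> ~ l < l').
  { clear. intros l l' H H' L. destruct (FinSeq_val _ _ l H' L) as [x Hx].
    apply (FinSeq_dom _ _ _ _ H) in Hx. lin. }
  intros H H'. destruct (mlt_total l l') as [L|[L|L]]; auto; exfalso.
  - now apply (G l l').
  - now apply (G l' l).
Qed.

Lemma D1_StringSet A f : F1 A f -> D1 A (fun r => mStringSet (f r)).
Proof.
  apply (D1_app1 A mStringSet).
  apply D1_ext with (fun r => mFinSet (r 0%nat) /\ forall s, s < r 0%nat -> mElt s (r 0%nat) ->
    exists l, l < s + 1 /\ mBinString s l).
  - intros r. split; intros [H1 H2]; split; auto; intros s.
    + intros Hs. destruct (H2 s ltac:(now apply Elt_lt) Hs) as (l & _ & Hl). eauto.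
    + intros _ Hs. destruct (H2 s Hs) as (l & Hl). exists l. split; auto.
      assert (L := FinSeq_len s l (proj1 Hl)). lin.
  - defin.
Qed.
Ltac defin_strings := first [defin_count | apply D1_BinString | apply D1_Initial
  | apply D1_MinimalIn | apply D1_StringSet].
Ltac defin_rel ::= defin_strings.

Lemma FinSeq_of_fun A f n : F1 A (fun r => f (r 0%nat)) ->
  exists s, mFinSeq s n /\ forall i, i < n -> mElt (mpr i (f i)) s.
Proof.
  intros Hf. revert n. apply (S1_induction A).
  - defin.
  - destruct FinSeq_nil as (s & Hs & _). exists s. split; auto. intros i Hi; exfalso; lin.
  - intros n (s & Hs & H). destruct (FinSeq_snoc s n (f n) Hs) as (t & Ht & E). exists t. split; auto.
    intros i Hi. apply E. destruct (mlt_total i n) as [L|[->|L]]; auto. exfalso; lin.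
Qed.

(** Such a string is a set of pairs below [mpr L 2], and codes of subsets of a fixed interval have a
    common bound. *)
Lemma string_bound (L : M) : exists S, forall y l, l <= L -> mBinString y l -> y < S.
Proof.
  destruct (bounded_FinSet (mpr L 2)) as [S HS]. exists S. intros y l Hl [Hy Hb].
  destruct (HS every (fun p => mElt p y)) as (c & Hc & Fc & E).
  - defin.
  - intros p Hp. destruct (FinSeq_pair _ _ _ Hy Hp) as (i & x & Hi & ->).
    apply mpr_lt; [lin | now apply Hb in Hp].
  - replace y with c; auto. apply FinSet_ext; auto. apply Hy.
Qed.

(** ** Extending strings *)

Definition snoc (y n b : M) : M := code (fun p => mElt p y \/ p = mpr n b).

Lemma snoc_spec y n b : mFinSeq y n ->
  mFinSeq (snoc y n b) (n + 1) /\
  forall i x, mElt (mpr i x) (snoc y n b) <-> mElt (mpr i x) y \/ i = n /\ x = b.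
Proof.
  intros Hy. destruct (code_spec every (fun p => mElt p y \/ p = mpr n b) (y + mpr n b + 1)) as [_ H].
  - defin.
  - intros p [Hp| ->]; [apply Elt_lt in Hp|]; lin.
  - destruct (FinSeq_snoc y n b Hy) as (t & Ht & E).
    assert (Et : t = snoc y n b).
    { apply (code_eq every _ (y + mpr n b + 1)); [defin| |].
      - intros p [Hp| ->]; [apply Elt_lt in Hp|]; lin.
      - split; [apply Ht|]. intros p. split.
        + intros Hp. destruct (FinSeq_pair _ _ _ Ht Hp) as (i & x & _ & ->).
          apply E in Hp as [Hp|[-> ->]]; auto.
        + intros [Hp| ->]; [|apply E; auto].
          destruct (FinSeq_pair _ _ _ Hy Hp) as (i & x & _ & ->). apply E; auto. }
    rewrite <- Et. auto.
Qed.

Lemma F1_snoc A f g h : F1 A f -> F1 A g -> F1 A h -> F1 A (fun r => snoc (f r) (g r) (h r)).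
Proof.
  intros Hf Hg Hh. unfold snoc.
  apply (F1_code A (fun r p => mElt p (f r) \/ p = mpr (g r) (h r)) (fun r => f r + mpr (g r) (h r) + 1)).
  - intros r p [Hp| ->]; [apply Elt_lt in Hp|]; lin.
  - apply F1_add; [apply F1_add; [|apply F1_mpr] | apply F1_const]; auto.
  - apply D1_or; [apply D1_Elt | apply D1_eq; [|apply F1_mpr]]; try apply F1_var; now apply F1_tl.
Qed.
Ltac defin_rel ::= first [defin_strings | apply F1_snoc].

Lemma snoc_string y n b : mBinString y n -> b < 2 -> mBinString (snoc y n b) (n + 1).
Proof.
  intros [Hy Hb] Hb2. destruct (snoc_spec y n b Hy) as [H1 H2]. split; auto.
  intros i x Hx. apply H2 in Hx as [Hx|[-> ->]]; eauto.
Qed.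

Lemma snoc_inv z n : mBinString z (n + 1) -> exists y b, mBinString y n /\ b < 2 /\ z = snoc y n b.
Proof.
  intros [Hz Hb].
  destruct (FinSeq_build every (fun i x => mElt (mpr i x) z /\ i < n) n z) as (y & Hy & E).
  - defin.
  - intros i Hi. destruct (FinSeq_val _ _ i Hz ltac:(lin)) as [x Hx]. eauto.
  - intros i x x' [H _] [H' _]. exact (FinSeq_fun _ _ _ _ _ Hz H H').
  - intros i x [H Hi]. split; auto. now apply Elt_pair_lt in H.
  - destruct (FinSeq_val _ _ n Hz ltac:(lin)) as [b Eb]. exists y, b. split; [|split].
    + split; auto. intros i x Hx. apply E in Hx as [Hx _]. eauto.
    + eauto.
    + destruct (snoc_spec y n b Hy) as [H1 H2]. apply (FinSeq_ext _ _ (n + 1)); auto.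
      intros i x Hx. apply H2. assert (Hi := FinSeq_dom _ _ _ _ Hz Hx).
      destruct (mlt_total i n) as [L|[->|L]].
      * left. apply E; auto.
      * right. split; auto. exact (FinSeq_fun _ _ _ _ _ Hz Hx Eb).
      * exfalso; lin.
Qed.

Lemma snoc_inj y y' n b b' : mFinSeq y n -> mFinSeq y' n -> snoc y n b = snoc y' n b' -> y = y' /\ b = b'.
Proof.
  intros Hy Hy' E. destruct (snoc_spec y n b Hy) as [H1 H2], (snoc_spec y' n b' Hy') as [H3 H4].
  rewrite E in *. split.
  - apply (FinSeq_ext _ _ n); auto. intros i x Hx. assert (L := FinSeq_dom _ _ _ _ Hy Hx).
    destruct (proj1 (H4 i x) (proj2 (H2 i x) (or_introl Hx))) as [?|[? _]]; auto. exfalso; lin.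
  - destruct (proj1 (H4 n b) (proj2 (H2 n b) (or_intror (conj eq_refl eq_refl)))) as [H|[_ ?]]; auto.
    apply (FinSeq_dom _ _ _ _ Hy') in H. exfalso; lin.
Qed.

Lemma Initial_snoc s y n b l : mFinSeq s l -> l <= n -> mFinSeq y n ->
  (mInitial s (snoc y n b) <-> mInitial s y).
Proof.
  intros Hs Hl Hy. destruct (snoc_spec y n b Hy) as [H1 H2]. split; intros H p Hp;
    destruct (FinSeq_pair _ _ _ Hs Hp) as (i & x & Hi & ->).
  - apply H, H2 in Hp as [?|[? _]]; auto. exfalso; lin.
  - apply H2. auto.
Qed.

Lemma Initial_eq s y l : mFinSeq s l -> mFinSeq y l -> mInitial s y -> s = y.
Proof. intros Hs Hy H. apply (FinSeq_ext _ _ l); auto. Qed.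

Section Fixed.
Variables L S : M.
Hypothesis HS : forall y l, l <= L -> mBinString y l -> y < S.

(** By induction on [d]: appending 0 and appending 1 are two injections with disjoint images, which
    together give all extensions of the next length. *)
Lemma cnt_extensions s l d : mBinString s l -> l + d <= L ->
  cnt (fun y => mBinString y (l + d) /\ mInitial s y) S = pow2 d.
Proof.
  intros Hs. revert d. apply (D1_induction every (fun d => l + d <= L ->
    cnt (fun y => mBinString y (l + d) /\ mInitial s y) S = pow2 d)); [defin| |].
  - intros Hl. rewrite madd_0 in *. rewrite pow2_0, <- (cnt_single s S) by eauto.
    apply cnt_ext; [unfold dec; defin | apply dec_eq|].
    intros y _. split.
    + intros [Hy H]. symmetry. apply (Initial_eq _ _ l); auto; [apply Hs | apply Hy].
    + intros ->. split; auto. intros p; auto.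
  - intros d IH Hl. rewrite pow2_S. rewrite <- madd_assoc in *.
    rewrite <- IH by lin. assert (Hn : l <= l + d) by lin. set (n := l + d) in *. clearbody n.
    set (P := fun y => mBinString y n /\ mInitial s y).
    assert (HP : dec P) by (unfold dec, P; defin).
    assert (HI : forall b, b < 2 -> dec (fun z => exists y, y < S /\ (P y /\ z = snoc y n b)) /\
      cnt (fun z => exists y, y < S /\ (P y /\ z = snoc y n b)) S = cnt P S).
    { intros b Hb. split; [unfold dec, P; defin|]. apply cnt_image; auto.
      - defin.
      - intros y Hy [Py _]. apply (HS _ (n + 1)); auto. now apply snoc_string.
      - intros y y' _ _ [Py _] [Py' _] E. apply snoc_inj in E as [E _]; auto; [apply Py | apply Py']. }
    destruct (HI 0 ltac:(lin)) as [D0' E0], (HI 1 ltac:(lin)) as [D1' E1].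
    transitivity (cnt P S + cnt P S); [|unfold P; ring]. rewrite <- E0 at 1. rewrite <- E1 at 1.
    rewrite <- cnt_disjoint; auto.
    + apply cnt_ext; [unfold dec; defin | unfold dec, P; defin|]. intros z _. split.
      * intros [Hz Hi]. destruct (snoc_inv z n Hz) as (y & b & Hy & Hb & ->).
        apply (Initial_snoc s y n b l) in Hi; [|apply Hs | auto | apply Hy].
        assert (Hy' : y < S) by (apply (HS _ n); auto; lin).
        destruct (zero_or_succ b) as [->|[b' ->]]; [left; exists y; unfold P; auto|].
        right. assert (Eb : b' + 1 = 1) by lin. rewrite Eb. exists y; unfold P; auto.
      * intros [(y & _ & [Hy Hi] & ->)|(y & _ & [Hy Hi] & ->)];
          (split; [apply snoc_string; auto; lin|]);
          apply (Initial_snoc s y n _ l); auto; try apply Hs; apply Hy.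
    + intros z _ (y & _ & [Py _] & ->) (y' & _ & [Py' _] & E).
      apply snoc_inj in E as [_ E]; [lin | apply Py | apply Py'].
Qed.

Definition covers (B y : M) : Prop := exists s, s < B /\ (mElt s B /\ mInitial s y).

(** This is [2^L] times the measure of the open set generated by [B], provided that the strings in
    [B] have length at most [L]; by [HS] the bound [S] exceeds all strings that are counted. *)
Definition cov (B : M) : M := cnt (fun y => mBinString y L /\ covers B y) S.

Lemma Initial_compare s t y l l' n : mFinSeq s l -> mFinSeq t l' -> mFinSeq y n ->
  mInitial s y -> mInitial t y -> l <= l' -> mInitial s t.
Proof.
  intros Hs Ht Hy H1 H2 Hl p Hp. destruct (FinSeq_pair _ _ _ Hs Hp) as (i & x & Hi & ->).
  destruct (FinSeq_val _ _ i Ht ltac:(lin)) as [x' Hx'].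
  now rewrite (FinSeq_fun _ _ i x x' Hy (H1 _ Hp) (H2 _ Hx')).
Qed.

Lemma Initial_len s t l l' : mFinSeq s l -> mFinSeq t l' -> mInitial s t -> l <= l'.
Proof.
  intros Hs Ht H. apply NNPP; intros N. assert (L' : l' < l) by lin.
  destruct (FinSeq_val _ _ l' Hs L') as [x Hx]. apply H in Hx. apply (FinSeq_dom _ _ _ _ Ht) in Hx. lin.
Qed.

(** Among the initial segments of [s] in [B], one of least length is minimal. *)
Lemma minimal_below B s : mStringSet B -> mElt s B -> exists t, mMinimalIn t B /\ mInitial t s.
Proof.
  intros [_ HB] Hs.
  destruct (least every (fun l => exists t, t < B /\ (mElt t B /\ mInitial t s /\ mBinString t l)) ltac:(defin)
    (epsilon (inhabits 0) (fun l => mBinString s l))) as (l & (t & _ & Ht & Hts & Hl) & Hmin).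
  - exists s. split; [now apply Elt_lt|]. split; auto. split; [intros p; auto|].
    apply epsilon_spec. auto.
  - exists t. split; auto. split; auto. intros (u & Hu & Hut & N).
    destruct (HB u Hu) as [l' Hl'].
    assert (L' := Initial_len u t l' l (proj1 Hl') (proj1 Hl) Hut). destruct L' as [L'| ->].
    + apply (Hmin l' L'). exists u. split; [now apply Elt_lt|]. split; auto. split; auto.
      intros p Hp. auto.
    + apply N. apply (Initial_eq u t l); auto; [apply Hl' | apply Hl].
Qed.

Lemma Mu_cov B a b : mStringSet B -> (forall s l, mElt s B -> mBinString s l -> l <= L) ->
  mMu B a b -> 0 < b /\ a * pow2 L = b * cov B.
Proof.
  intros HB HL (Q & HQ & Q0 & QS & QB).
  (* [C x] collects the strings of length [L] covered by minimal strings below [x]. The invariant is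
     that the partial sum [c / d] at [x] equals their number divided by [2^L]. *)
  set (C := fun x y => mBinString y L /\ exists s, s < x /\ (mMinimalIn s B /\ mInitial s y)).
  assert (HC : forall x, dec (C x)) by (intros; unfold dec, C; defin).
  assert (PQ : forall x c d, mElt (mpr x (mpr c d)) Q -> c < Q /\ d < Q).
  { intros x c d E. apply Elt_pair_lt in E as [_ E]. assert (H1 := mpr_l c d).
    assert (H2 := mpr_r c d). lin. }
  assert (I : forall x, x <= B -> exists c, c < Q /\ exists d, d < Q /\
    (mElt (mpr x (mpr c d)) Q /\ 0 < d /\ c * pow2 L = d * cnt (C x) S)).
  { apply (bounded_induction (fun x => exists c, c < Q /\ exists d, d < Q /\
      (mElt (mpr x (mpr c d)) Q /\ 0 < d /\ c * pow2 L = d * cnt (C x) S)) B).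
    - unfold dec, C. defin.
    - exists 0. split; [now apply (PQ 0 0 1)|]. exists 1. split; [now apply (PQ 0 0 1)|].
      split; auto. split; [lin|]. rewrite cnt_none; auto; [ring|]. intros y _ [_ (s & Hs & _)]. lin.
    - intros x Hx (c & _ & d & _ & Ev & Hd & IHc).
      assert (G : forall c d, mElt (mpr (x + 1) (mpr c d)) Q -> 0 < d ->
        c * pow2 L = d * cnt (C (x + 1)) S -> exists c, c < Q /\ exists d, d < Q /\
        (mElt (mpr (x + 1) (mpr c d)) Q /\ 0 < d /\ c * pow2 L = d * cnt (C (x + 1)) S)).
      { intros c' d' E H1 H2. destruct (PQ _ _ _ E). exists c'. split; auto. exists d'. auto. }
      destruct (QS x c d (conj Hx Ev)) as [QN QY].
      destruct (classic (mMinimalIn x B)) as [Mx|Mx].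
      + destruct HB as [FB HB]. destruct (HB x (proj1 Mx)) as [l Hl].
        assert (E2 := QY Mx l (pow2 l) (conj Hl (proj2 (Pow2_iff _ _) eq_refl))).
        refine (G _ _ E2 _ _); [apply mul_pos; auto; apply pow2_pos|].
        assert (Hl' := HL x l (proj1 Mx) Hl). destruct (le_ex _ _ Hl') as [e He].
        (* A minimal string [x] of length [L - e] contributes [2^e] new strings: two initial
           segments of the same string are comparable, so distinct minimal strings have no common
           extension. *)
        assert (EN : cnt (C (x + 1)) S = cnt (C x) S + pow2 e).
        { assert (HX := cnt_extensions x l e Hl ltac:(lin)). rewrite <- He in HX.
          rewrite <- HX, <- cnt_disjoint; auto; [| unfold dec; defin |].
          - apply cnt_ext; auto; [unfold dec, C; defin|]. unfold C. intros y _. split.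
            + intros [Hy (s & Hs & Ms & Is)]. destruct (mlt_total s x) as [Ls|[->|Ls]]; auto; [|exfalso; lin].
              left. split; auto. now exists s.
            + intros [[Hy (s & Hs & H)]|[Hy Iy]]; split; auto; [exists s | exists x]; (split; [lin|auto]).
          - intros y _ [Hy (s & Hs & Ms & Is)] [_ Iy].
            destruct (HB s (proj1 Ms)) as [l' Hs'].
            destruct (classic (l <= l')) as [Ll|Ll].
            + apply (proj2 Ms). exists x. split; [apply Mx|]. split; [|intros ->; lin].
              apply (Initial_compare x s y l l' L); auto; [apply Hl | apply Hs' | apply Hy].
            + apply (proj2 Mx). exists s. split; [apply Ms|]. split; [|intros ->; lin].
              apply (Initial_compare s x y l' l L); auto; [apply Hs' | apply Hl | apply Hy | lin]. }
        rewrite EN. rewrite He in *. rewrite pow2_add in *.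
        transitivity (pow2 l * (c * (pow2 l * pow2 e)) + d * (pow2 l * pow2 e)); [ring|].
        rewrite IHc. ring.
      + refine (G _ _ (QN Mx) Hd _). rewrite IHc. f_equal. apply cnt_ext; auto. unfold C. intros y _. split.
        * intros [Hy (s & Hs & H)]. split; auto. exists s. split; [lin|auto].
        * intros [Hy (s & Hs & Ms & H)]. split; auto. exists s. split; auto.
          destruct (mlt_total s x) as [Ls|[->|Ls]]; auto; [easy | exfalso; lin]. }
  destruct (I B ltac:(now right)) as (a' & _ & b' & _ & E & Hb & Ha).
  assert (E' := FinSeq_fun _ _ _ _ _ HQ QB E). apply mpr_inj in E' as [-> ->]. split; auto.
  rewrite Ha. f_equal. apply cnt_ext; auto; [unfold dec, covers; defin|]. unfold C, covers.
  intros y _. split.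
  - intros [Hy (s & Hs & Ms & Is)]. split; auto. exists s. split; auto. split; auto. apply Ms.
  - intros [Hy (s & Hs & Es & Is)]. split; auto. destruct (minimal_below B s HB Es) as (t & Mt & It).
    exists t. split; [apply Elt_lt, Mt|]. split; auto. intros p Hp; auto.
Qed.

(** The pair of numerator and denominator is defined by two successive recursions, since the
    denominators do not depend on the numerators. *)
Lemma Mu_ex B : exists a b, mMu B a b.
Proof.
  (* The value 0 on numbers that code no sequence makes the length a total definable function. *)
  set (len := fun s => epsilon (inhabits 0) (fun l => mFinSeq s l \/ l = 0 /\ ~ exists l, mFinSeq s l)).
  assert (Hl0 : forall s, mFinSeq s (len s) \/ len s = 0 /\ ~ exists l, mFinSeq s l).
  { intros s. unfold len. apply epsilon_spec.
    destruct (classic (exists l, mFinSeq s l)) as [[l H]|H]; eauto. }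
  assert (Hlen : forall s l, mFinSeq s l -> l = len s).
  { intros s l Hs. destruct (Hl0 s) as [H|[_ H]]; [eapply FinSeq_len_fun; eauto | exfalso; eauto]. }
  assert (Flen : F1 every (fun r => len (r 0%nat))).
  { apply F1_graph with (fun r y => mFinSeq (r 0%nat) y \/ y = 0 /\ ~ exists l, l < r 0%nat + 1 /\ mFinSeq (r 0%nat) l).
    - intros r y. assert (E : (exists l, l < r 0%nat + 1 /\ mFinSeq (r 0%nat) l) <-> exists l, mFinSeq (r 0%nat) l).
      { split; [intros (l & _ & H); eauto|]. intros (l & H). exists l. split; auto.
        apply FinSeq_len in H. lin. }
      rewrite E. split.
      + intros [H|[-> H]]; [now apply Hlen|]. symmetry.
        destruct (Hl0 (r 0%nat)) as [H'|[H' _]]; auto. exfalso; eauto.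
      + intros ->. apply Hl0.
    - defin. }
  set (d := prec 1 (fun x d => ite (mMinimalIn x B) (d * pow2 (len x)) d)).
  assert (Fd : F1 every (fun r => d (r 0%nat))).
  { apply (F1_prec every (fun _ => 1) (fun _ x d => ite (mMinimalIn x B) (d * pow2 (len x)) d) (fun r => r 0%nat)); defin. }
  set (c := prec 0 (fun x c => ite (mMinimalIn x B) (c * pow2 (len x) + d x) c)).
  assert (Fc : F1 every (fun r => c (r 0%nat))).
  { apply (F1_prec every (fun _ => 0) (fun _ x c => ite (mMinimalIn x B) (c * pow2 (len x) + d x) c) (fun r => r 0%nat)); defin. }
  assert (Sd : forall x, d (x + 1) = ite (mMinimalIn x B) (d x * pow2 (len x)) (d x)).
  { intros x. apply (prec_S every 1 (fun x d => ite (mMinimalIn x B) (d * pow2 (len x)) d)). defin. }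
  assert (Sc : forall x, c (x + 1) = ite (mMinimalIn x B) (c x * pow2 (len x) + d x) (c x)).
  { intros x. apply (prec_S every 0 (fun x c => ite (mMinimalIn x B) (c * pow2 (len x) + d x) c)). defin. }
  destruct (FinSeq_of_fun every (fun x => mpr (c x) (d x)) (B + 1) ltac:(defin)) as (Q & HQ & E).
  exists (c B), (d B), Q. split; auto. split; [|split].
  - replace 0 with (c 0) at 2 by (apply (prec_0 every); defin).
    replace 1 with (d 0) by (apply (prec_0 every); defin). apply E. lin.
  - intros x c' d' [Hx Ex].
    assert (E' := FinSeq_fun _ _ _ _ _ HQ Ex (E x ltac:(lin))). apply mpr_inj in E' as [-> ->].
    assert (E1 := E (x + 1) ltac:(lin)). rewrite Sc, Sd in E1. split.
    + intros N. now rewrite !ite_false in E1.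
    + intros Mx l p [Hl Hp]. rewrite !ite_true in E1 by auto. apply Pow2_iff in Hp as ->.
      now rewrite (Hlen x l (proj1 Hl)).
  - apply E. lin.
Qed.

Lemma MuLe_cov B n : mStringSet B -> (forall s l, mElt s B -> mBinString s l -> l <= L) ->
  (mMuLe B n <-> cov B * pow2 n <= pow2 L).
Proof.
  intros HB HL. split.
  - intros (a & b & p & Hm & Hp & Hl). apply Pow2_iff in Hp as ->.
    destruct (Mu_cov B a b HB HL Hm) as [Hb E]. apply (mul_cancel_le _ _ b); auto.
    assert (H := mul_le _ _ (pow2 L) (pow2 L) Hl ltac:(now right)).
    replace (cov B * pow2 n * b) with (b * cov B * pow2 n) by ring. rewrite <- E.
    replace (a * pow2 L * pow2 n) with (a * pow2 n * pow2 L) by ring.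
    now rewrite (mmul_comm (pow2 L) b).
  - intros H. destruct (Mu_ex B) as (a & b & Hm). exists a, b, (pow2 n). split; auto.
    split; [now apply Pow2_iff|]. destruct (Mu_cov B a b HB HL Hm) as [Hb E].
    apply (mul_cancel_le _ _ (pow2 L)); [apply pow2_pos|].
    replace (a * pow2 n * pow2 L) with (a * pow2 L * pow2 n) by ring. rewrite E.
    replace (b * cov B * pow2 n) with (b * (cov B * pow2 n)) by ring.
    apply mul_le; auto. now right.
Qed.
End Fixed.

(** * From balanced randomness to 1-randomness *)

Lemma graph1 A f : F1 A (fun r => f (r 0%nat)) ->
  exists F, mFunction1 F /\ forall i x, mpr i x ∈ₘ F <-> x = f i.
Proof.
  intros Hf.
  destruct (D1_comprehension A (fun p => exists i, i < p + 1 /\ p = mpr i (f i))) as [F HF]; [defin|].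
  assert (E : forall i x, mpr i x ∈ₘ F <-> x = f i).
  { intros i x. rewrite HF. split.
    - intros (j & _ & E). now apply mpr_inj in E as [<- E].
    - intros ->. exists i. split; auto. assert (L := mpr_l i (f i)). lin. }
  exists F. split; auto. split.
  - intros p Hp. apply HF in Hp as (i & _ & ->). eauto.
  - intros i. exists (f i). apply E.
Qed.

Lemma graph2 A f : F1 A (fun r => f (r 0%nat) (r 1%nat)) ->
  exists F, mFunction2 F /\ forall n i x, mpr (mpr n i) x ∈ₘ F <-> x = f n i.
Proof.
  intros Hf.
  destruct (D1_comprehension A (fun p => exists n, n < p + 1 /\ exists i, i < p + 1 /\ p = mpr (mpr n i) (f n i)))
    as [F HF]; [defin|].
  assert (E : forall n i x, mpr (mpr n i) x ∈ₘ F <-> x = f n i).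
  { intros n i x. rewrite HF. split.
    - intros (m & _ & j & _ & E). apply mpr_inj in E as [E ->]. now apply mpr_inj in E as [<- <-].
    - intros ->. assert (L := mpr_l (mpr n i) (f n i)). assert (L1 := mpr_l n i). assert (L2 := mpr_r n i).
      exists n. split; [lin|]. exists i. split; [lin | auto]. }
  exists F. split; auto. split.
  - intros p Hp. apply HF in Hp as (n & _ & i & _ & ->). eauto.
  - intros n i. exists (f n i). apply E.
Qed.

Lemma computes2 Z F f : (forall n i x, mpr (mpr n i) x ∈ₘ F <-> x = f n i) ->
  Cmp Z cd2 (fun p => f (fst p) (snd p)) -> exists e, mComputes2 Z e F.
Proof.
  intros HF [e He]. exists e. intros n i x. rewrite HF. assert (H := He (n, i)). split.
  - now intros ->.
  - intros H'. exact (Phi_fun Z e _ _ _ H' H).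
Qed.

(** The s-m-n index of [i |-> Phi_e (n, i)]. *)
Definition section_index (e n : M) : M := mpr 7 (mpr e (mpr 6 (mpr (mpr 0 n) (mpr 1 0)))).

Lemma section_index_spec Z e n i x : mPhi Z e (mpr n i) x -> mPhi Z (section_index e n) i x.
Proof.
  intros H. apply Phi_intro. do 7 right. left. eexists _, _. split; [reflexivity|].
  exists (mpr n i). split; auto. apply Phi_intro. do 6 right. left. eexists _, _. split; [reflexivity|].
  exists n, i. split; [|split; auto]; apply Phi_intro; [now left | right; now left].
Qed.

Lemma balanced_random X Z : mBalanced X Z -> mOneRandom X Z.
Proof.
  intros HX U (FU & [e He] & HU) HIn.
  assert (UP : forall n i x, mPhi Z (section_index e n) i x <-> mpr (mpr n i) x ∈ₘ U).
  { intros n i x. split; [|intros H; apply section_index_spec, He, H].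
    intros H. destruct (proj2 FU n i) as [y Hy].
    assert (Hy' : mpr (mpr n i) y ∈ₘ U) by now apply Hy.
    replace x with y; auto. refine (Phi_fun Z _ _ _ _ _ H). apply section_index_spec, He, Hy'. }
  destruct (graph1 every (fun _ => 0)) as (h & Fh & Eh); [defin|].
  destruct (graph2 every (fun n s => section_index e n)) as (g & Fg & Eg); [unfold section_index; defin|].
  (* As [g] is constant in its second argument, the constant [c = 0] bounds its changes. *)
  destruct (HX 0 h g) as (n & e' & (s0 & Hl) & Hn).
  - split.
    + split; auto. intros n p _. apply Eh. ring.
    + split; auto. split; [|split; [|split]].
      * exists (mpr 0 0). intros i x. rewrite Eh. split.
        -- intros ->. apply Phi_intro. now left.
        -- intros H. refine (Phi_fun Z _ _ _ _ H _). apply Phi_intro. now left.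
      * split; auto. intros n k _ s l (Hs & HA & _).
        destruct (zero_or_succ l) as [->|[l' ->]]; [destruct (zero_or_succ k) as [->|[? ->]]; lin|].
        destruct (FinSeq_val _ _ l' Hs ltac:(lin)) as [x Hx]. exfalso. apply (HA _ _ Hx).
        exists (section_index e n). split; now apply Eg.
      * apply (computes2 Z g (fun n s => section_index e n)); auto. unfold section_index.
        do 3 (apply Cmp_pair; [apply Cmp_const|]).
        apply Cmp_pair; [|apply Cmp_const]. apply Cmp_pair; [apply Cmp_const|].
        apply (Cmp_fst Z _ (fun p => snd p)), Cmp_id.
      * intros n. exists (section_index e n). split; [exists 0; intros; now apply Eg|].
        destruct (HU n) as [HO HM].
        destruct (D1_comprehension every (fun p => exists i, i < p + 1 /\ exists x, x < p + 1 /\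
          (p = mpr i x /\ mpr (mpr n i) x ∈ₘ U))) as [F HF].
        { assert (HE : every U) by exact I. defin. }
        assert (EF : forall i x, mpr i x ∈ₘ F <-> mpr (mpr n i) x ∈ₘ U).
        { intros i x. rewrite HF. split.
          - intros (j & _ & y & _ & E & H). now apply mpr_inj in E as [-> ->].
          - intros H. assert (L1 := mpr_l i x). assert (L2 := mpr_r i x).
            exists i. split; [lin|]. exists x. split; [lin | auto]. }
        exists F. split; [split|split; [|split]].
        -- intros p Hp. apply HF in Hp as (i & _ & x & _ & -> & _). eauto.
        -- intros i. destruct (proj2 FU n i) as [y Hy]. exists y. intros x. rewrite EF. apply Hy.
        -- intros i x. now rewrite EF, UP.
        -- intros i b Hb. apply (HO i b). now apply EF.
        -- intros m. destruct (HM m) as (C & HC1 & HC2 & HC3). exists C. split; auto. split; auto.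
           intros s. rewrite HC2. unfold mSeqOf, mSection. setoid_rewrite EF. reflexivity.
  - apply Hn. destruct (HIn n) as (i & b & Hb & HB). exists i, b. split; auto.
    assert (E : e' = section_index e n) by (apply (Eg n s0), Hl; now right).
    rewrite E. now apply UP.
Qed.

(** * From 1-randomness to balanced randomness *)

Ltac defin_rel ::= first [defin_strings | apply S1_Phi].

Lemma D1_covers A f g : F1 A f -> F1 A g -> D1 A (fun r => covers (f r) (g r)).
Proof. apply (D1_app2 A covers). unfold covers. defin. Qed.

Lemma S1_MuLe A f g : F1 A f -> F1 A g -> S1 A (fun r => mMuLe (f r) (g r)).
Proof.
  apply (S1_app2 A mMuLe).
  apply S1_ext with (fun r => exists a b S, (mFinSeq S (r 0%nat + 1) /\ mElt (mpr 0 (mpr 0 1)) S /\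
    (forall x, x < r 0%nat -> forall c, c < S -> forall d, d < S -> mElt (mpr x (mpr c d)) S ->
       (~ mMinimalIn x (r 0%nat) -> mElt (mpr (x + 1) (mpr c d)) S) /\
       (mMinimalIn x (r 0%nat) -> forall l, l < x + 1 -> mBinString x l ->
          mElt (mpr (x + 1) (mpr (c * pow2 l + d) (d * pow2 l))) S)) /\
    mElt (mpr (r 0%nat) (mpr a b)) S) /\ a * pow2 (r 1%nat) <= b).
  - intros r. split.
    + intros (a & b & S & (H1 & H2 & H3 & H4) & H5). exists a, b, (pow2 (r 1%nat)).
      split; [|split; auto; now apply Pow2_iff]. exists S. split; auto. split; auto. split; auto.
      intros x c d [Hx E]. assert (L := proj2 (Elt_pair_lt _ _ _ E)).
      assert (L1 := mpr_l c d). assert (L2 := mpr_r c d).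
      destruct (H3 x Hx c ltac:(lin) d ltac:(lin) E) as [HN HY]. split; auto.
      intros Mx l p [Hl Hp]. apply Pow2_iff in Hp as ->. apply HY; auto.
      assert (L3 := FinSeq_len x l (proj1 Hl)). lin.
    + intros (a & b & p & (S & H1 & H2 & H3 & H4) & Hp & H5). apply Pow2_iff in Hp as ->.
      exists a, b, S. split; auto. split; auto. split; auto. split; auto.
      intros x Hx c _ d _ E. destruct (H3 x c d (conj Hx E)) as [HN HY]. split; auto.
      intros Mx l _ Hl. apply (HY Mx l (pow2 l)). split; auto. now apply Pow2_iff.
  - do 3 apply S1_ex. apply D1_S1. defin.
Qed.

(** [ev b y] is the string of the bits of [y] at positions [2 i + b]. *)
Definition ev (b y : M) : M :=
  code (fun p => exists i, i < y /\ exists x, x < y /\ (p = mpr i x /\ mElt (mpr (2 * i + b) x) y)).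

Lemma F1_ev A f g : F1 A f -> F1 A g -> F1 A (fun r => ev (f r) (g r)).
Proof.
  apply (F1_app2 A ev).
  apply (F1_code A (fun r p => exists i, i < r 1%nat /\ exists x, x < r 1%nat /\
    (p = mpr i x /\ mElt (mpr (2 * i + r 0%nat) x) (r 1%nat))) (fun r => mpr (r 1%nat) (r 1%nat))).
  - intros r p (i & Hi & x & Hx & -> & _). now apply mpr_lt.
  - defin.
  - defin.
Qed.
Ltac defin_tests := first [defin_strings | apply S1_Phi | apply D1_covers | apply S1_MuLe | apply F1_ev].
Ltac defin_rel ::= defin_tests.

Lemma ev_code b y : mFinSet (ev b y) /\ forall p, mElt p (ev b y) <->
  exists i, i < y /\ exists x, x < y /\ (p = mpr i x /\ mElt (mpr (2 * i + b) x) y).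
Proof.
  apply (code_spec every _ (mpr y y)); [defin|].
  intros p (i & Hi & x & Hx & -> & _). now apply mpr_lt.
Qed.

Lemma ev_spec b y i x : mElt (mpr i x) (ev b y) <-> mElt (mpr (2 * i + b) x) y.
Proof.
  rewrite (proj2 (ev_code b y)). split.
  - intros (j & _ & z & _ & E & H). now apply mpr_inj in E as [-> ->].
  - intros H. destruct (Elt_pair_lt _ _ _ H). exists i. split; [lin|]. exists x. auto.
Qed.

Lemma ev_string b y L : b < 2 -> mBinString y (2 * L) -> mBinString (ev b y) L.
Proof.
  intros Hb [Hy H2]. split.
  - split; [apply ev_code | split].
    + intros p Hp. apply ev_code in Hp as (i & _ & x & _ & -> & H). exists i, x. split; auto.
      apply (FinSeq_dom _ _ _ _ Hy) in H. apply NNPP; intros N. assert (L <= i) by lin. lin.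
    + intros i Hi. destruct (FinSeq_val y (2 * L) (2 * i + b) Hy) as [x Hx].
      { assert (i + 1 <= L) by lin. lin. }
      exists x. intros z. rewrite ev_spec. split; [|now intros ->].
      intros Hz. exact (FinSeq_fun _ _ _ _ _ Hy Hz Hx).
  - intros i x Hx. apply ev_spec in Hx. eauto.
Qed.

(** Every position is even or odd, so each bit of [y] is read off one of the two halves. *)
Lemma ev_inj y y' L : mBinString y (2 * L) -> mBinString y' (2 * L) ->
  ev 0 y = ev 0 y' -> ev 1 y = ev 1 y' -> y = y'.
Proof.
  intros [Hy _] [Hy' _] E0 E1. apply (FinSeq_ext _ _ (2 * L)); auto. intros q x Hq.
  assert (D : exists i, q = 2 * i \/ q = 2 * i + 1).
  { clear. cut (exists i, i < q + 1 /\ (q = 2 * i \/ q = 2 * i + 1)); [intros (i & _ & H); eauto|].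
    revert q. apply (D1_induction every); [defin| |].
    - exists 0. split; [lin|]. left. ring.
    - intros q (i & Hi & [->| ->]); [exists i | exists (i + 1)]; (split; [lin|]); [right | left]; ring. }
  destruct D as [i [->| ->]].
  - replace (2 * i) with (2 * i + 0) in * by ring. apply ev_spec. rewrite <- E0. now apply ev_spec.
  - apply ev_spec. rewrite <- E1. now apply ev_spec.
Qed.

(** [C] is the union of the first [j + 1] members of the sequence with index [e]. *)
Definition stage (Z : SetM) (e j C : M) : Prop :=
  mStringSet C /\
  (forall i, i < j + 1 -> exists b, mPhi Z e i b /\ forall s, s < b -> mElt s b -> mElt s C) /\
  (forall s, s < C -> mElt s C -> exists i, i < j + 1 /\ exists b, mPhi Z e i b /\ mElt s b).

(** * Decidable approximations to the versions of small measure *)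

Definition small_stage (Z : SetM) (n e j C : M) : Prop := stage Z e j C /\ mMuLe C n.

Lemma stage_mono Z e j j' C C' s : stage Z e j C -> stage Z e j' C' -> j <= j' ->
  mElt s C -> mElt s C'.
Proof.
  intros (_ & _ & H2) (_ & H1 & _) Hj Hs.
  destruct (H2 s ltac:(now apply Elt_lt) Hs) as (i & Hi & b & Hb & Es).
  destruct (H1 i ltac:(lin)) as (b' & Hb' & H). apply H; auto; rewrite <- (Phi_fun Z _ _ _ _ Hb Hb'); auto.
  now apply Elt_lt.
Qed.

(** Being a small stage is only Sigma-1, since it includes convergence. Bounding the witness by [T]
    gives a relation that is Delta-1 in [Z], so that a test built from it is computable from [Z],
    and that increases with [T]. *)
Lemma small_stage_approx Z : exists R : M -> M -> M -> M -> M -> Prop,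
  D1 (only Z) (fun r => R (r 0%nat) (r 1%nat) (r 2%nat) (r 3%nat) (r 4%nat)) /\
  (forall T T' n e j C, T <= T' -> R T n e j C -> R T' n e j C) /\
  forall n e j C, small_stage Z n e j C <-> exists T, R T n e j C.
Proof.
  assert (HS : S1 (only Z) (fun r => small_stage Z (r 0%nat) (r 1%nat) (r 2%nat) (r 3%nat))).
  { unfold small_stage, stage. defin. }
  apply S1_elim in HS as (Q & HQ & E).
  exists (fun T n e j C => exists w, w < T /\ Q (w .: n .: e .: j .: C .: fun _ => 0)). split; [|split].
  - apply D0_D1. apply (D0_ex _ (fun r => r 0%nat) (fun r => Q (r 0%nat .: r 2%nat .: r 3%nat .: r 4%nat .: r 5%nat .: fun _ => 0)));
      [constructor|].
    apply (D0_subst _ _ HQ (fun r => r 0%nat .: r 2%nat .: r 3%nat .: r 4%nat .: r 5%nat .: fun _ => 0)).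
    intros [|[|[|[|[|k]]]]]; simpl; constructor.
  - intros T T' n e j C HT (w & Hw & H). exists w. split; auto. lin.
  - intros n e j C. rewrite (E (n .: e .: j .: C .: fun _ => 0)). split.
    + intros [w Hw]. exists (w + 1), w. split; auto. lin.
    + intros (T & w & _ & H). eauto.
Qed.

(** * Counting the strings caught by pairs of versions *)

Section Joint.

Variable Z : SetM.
Variable R : M -> M -> M -> M -> M -> Prop.
Hypothesis R_D1 : D1 (only Z) (fun r => R (r 0%nat) (r 1%nat) (r 2%nat) (r 3%nat) (r 4%nat)).
Hypothesis R_spec : forall n e j C, small_stage Z n e j C <-> exists T, R T n e j C.

(** By time [T], some stage of the version [e] that covers [z] has been confirmed to have measure at
    most [2^-n]. An index that diverges or grows too large catches nothing further. *)
Definition caught (T n e z : M) : Prop :=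
  exists j, j < T /\ exists C, C < T /\ (R T n e j C /\ covers C z).

Lemma D1_caught A f g h i : (forall X, only Z X -> A X) -> F1 A f -> F1 A g -> F1 A h -> F1 A i ->
  D1 A (fun r => caught (f r) (g r) (h r) (i r)).
Proof.
  intros HA Hf Hg Hh Hi. assert (HR := D1_mono _ A _ HA R_D1).
  assert (HT : forall f, F1 A f -> F1 A (fun r => f (tl r))) by (intros; now apply F1_tl).
  unfold caught. apply (D1_bex A f); auto.
  apply (D1_bex A (fun r => f (tl r))); auto.
  apply D1_and.
  - apply (D1_app5 A R (fun r => f (tl (tl r))) (fun r => g (tl (tl r))) (fun r => h (tl (tl r))));
      auto using F1_var; [apply (HT (fun r => f (tl r))) | apply (HT (fun r => g (tl r))) | apply (HT (fun r => h (tl r))) | apply (F1_tl A (fun r => r 0%nat)), F1_var]; auto.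
  - apply D1_covers; [apply F1_var | apply (HT (fun r => i (tl r)))]; auto.
Qed.

Ltac defin_rel ::= first [defin_tests | apply D1_caught; [easy|..]].

Section Stage.
Variables T S n : M.
Hypothesis HS : forall y l, l <= T -> mBinString y l -> y < S.

(** The stages are nested, so only the last small one counts. *)
Lemma caught_cnt e : cnt (fun z => mBinString z T /\ caught T n e z) S * pow2 n <= pow2 T.
Proof.
  assert (HR := D1_mono (only Z) every _ (fun _ _ => I) R_D1).
  set (P := fun J z => mBinString z T /\ exists j, j < J /\ exists C, C < T /\ (R T n e j C /\ covers C z)).
  assert (HP : forall J, dec (P J)) by (intros; unfold dec, P; defin).
  assert (G : forall J, J <= T -> cnt (P J) S * pow2 n <= pow2 T); [|apply (G T); now right].
  apply (bounded_induction (fun J => cnt (P J) S * pow2 n <= pow2 T) T).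
  - unfold dec, P. defin.
  - rewrite cnt_none; auto; [lin|]. intros z _ [_ (j & Hj & _)]. lin.
  - intros J HJ IH. destruct (classic (exists C, C < T /\ R T n e J C)) as [(C & HC & HRC)|N].
    + assert (HCs : small_stage Z n e J C) by (apply R_spec; eauto). destruct HCs as [HCs HCm].
      (* Length [T] is large enough for the count: [C] is below [T], and a string in [C] is below
         [C] and at least as large as its length. *)
      apply (MuLe_cov T S HS) in HCm; [|apply HCs|].
      * assert (L : cnt (P (J + 1)) S <= cov T S C).
        { apply cnt_le; auto; [unfold dec; defin|]. intros z _ [Hz (j & Hj & C' & HC' & HRC' & s & Hs & Es & Is)].
          split; auto. assert (Es' : mElt s C).
          { assert (HCs' : small_stage Z n e j C') by (apply R_spec; eauto).
            apply (stage_mono Z e j J C' C); auto; [apply HCs' | lin]. }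
          exists s. split; [now apply Elt_lt | auto]. }
        assert (L' := mul_le _ _ (pow2 n) (pow2 n) L ltac:(now right)). lin.
      * intros s l Es Hl. assert (L1 := Elt_lt _ _ Es). assert (L2 := FinSeq_len _ _ (proj1 Hl)). lin.
    + replace (cnt (P (J + 1)) S) with (cnt (P J) S); auto.
      apply cnt_ext; auto. intros z _. split; intros [Hz (j & Hj & C & HC & H)]; split; auto.
      * exists j. split; [lin | eauto].
      * exists j. split; [|eauto]. destruct (mlt_total j J) as [L|[->|L]]; auto; exfalso; [|lin].
        apply N. exists C. split; auto. apply H.
Qed.

Variables (S2 : M) (u v : M -> M).
Hypothesis Fu : F1 every (fun r => u (r 0%nat)).
Hypothesis Fv : F1 every (fun r => v (r 0%nat)).

Definition both (s y : M) : Prop :=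
  mBinString y (2 * T) /\ caught T n (u s) (ev 0 y) /\ caught T n (v s) (ev 1 y).

Lemma dec_both s : dec (both s).
Proof. unfold dec, both. defin. Qed.

(** The map from [y] to its two halves is injective into the product of the two caught sets; this is
    the independence of the halves, in terms of counting. *)
Lemma both_cnt s : cnt (both s) S2 * (pow2 n * pow2 n) <= pow2 (2 * T).
Proof.
  set (P := fun z => mBinString z T /\ caught T n (u s) z).
  set (Q := fun z => mBinString z T /\ caught T n (v s) z).
  assert (HP : dec P) by (unfold dec, P; defin). assert (HQ : dec Q) by (unfold dec, Q; defin).
  assert (LP : cnt P S * pow2 n <= pow2 T) by apply caught_cnt.
  assert (LQ : cnt Q S * pow2 n <= pow2 T) by apply caught_cnt.
  assert (L : cnt (both s) S2 <= cnt P S * cnt Q S).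
  { rewrite <- cnt_prod by auto. apply cnt_inj with (fun y => mpr (ev 0 y) (ev 1 y)).
    - apply dec_both.
    - unfold dec in *. defin.
    - defin.
    - intros y _ (Hy & H0 & H1).
      assert (E0 := ev_string 0 y T ltac:(lin) Hy). assert (E1 := ev_string 1 y T ltac:(lin) Hy).
      assert (B0 : ev 0 y < S) by (apply (HS _ T); auto; now right).
      assert (B1 : ev 1 y < S) by (apply (HS _ T); auto; now right).
      split; [now apply mpr_lt|]. exists (ev 0 y). split; auto. exists (ev 1 y). split; auto.
      split; [split; auto|]. split; [split; auto | auto].
    - intros y y' _ _ (Hy & _) (Hy' & _) E. apply mpr_inj in E as [E0 E1]. now apply (ev_inj y y' T). }
  assert (L1 := mul_le _ _ _ _ LP LQ).
  assert (L2 := mul_le _ _ (pow2 n * pow2 n) (pow2 n * pow2 n) L ltac:(now right)).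
  replace (2 * T) with (T + T) by ring. rewrite pow2_add. lin.
Qed.

Definition changes (w : M -> M) (s : M) : M := cnt (fun t => ~ w t = w (t + 1)) s.

(** The summand 1 pays for the initial pair of versions. Passing from [s] to [s + 1] adds strings
    only if [u] or [v] changes, and then the right side gains at least one unit to pay for them. *)
Lemma versions_cnt s : cnt (fun y => exists t, t < s + 1 /\ both t y) S2 * (pow2 n * pow2 n)
  <= (1 + changes u s + changes v s) * pow2 (2 * T).
Proof.
  assert (HD : forall s, dec (fun y => exists t, t < s + 1 /\ both t y)) by
    (intros; unfold dec, both; defin).
  assert (Hu : dec (fun t => ~ u t = u (t + 1))) by (unfold dec; defin).
  assert (Hv : dec (fun t => ~ v t = v (t + 1))) by (unfold dec; defin).
  revert s. apply (D1_induction every).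
  - unfold changes, both. defin.
  - unfold changes. rewrite !cnt_0 by auto. assert (L := both_cnt 0).
    replace (cnt (fun y => exists t, t < 0 + 1 /\ both t y) S2) with (cnt (both 0) S2); [lin|].
    apply cnt_ext; auto using dec_both. intros y _. split.
    + intros H. exists 0. split; auto. lin.
    + intros (t & Ht & H). replace 0 with t; auto. lin.
  - intros s IH. unfold changes in *.
    assert (Mono : forall w : M -> M, dec (fun t => ~ w t = w (t + 1)) ->
      cnt (fun t => ~ w t = w (t + 1)) s <= cnt (fun t => ~ w t = w (t + 1)) (s + 1)).
    { intros w Hw. rewrite cnt_S by auto. unfold ite. destruct excluded_middle_informative; lin. }
    assert (Mu := Mono u Hu). assert (Mv := Mono v Hv).
    destruct (classic (u s = u (s + 1) /\ v s = v (s + 1))) as [[Eu Ev]|N].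
    + replace (cnt (fun y => exists t, t < s + 1 + 1 /\ both t y) S2)
        with (cnt (fun y => exists t, t < s + 1 /\ both t y) S2).
      * assert (L := mul_le (1 + cnt (fun t => ~ u t = u (t + 1)) s + cnt (fun t => ~ v t = v (t + 1)) s)
          (1 + cnt (fun t => ~ u t = u (t + 1)) (s + 1) + cnt (fun t => ~ v t = v (t + 1)) (s + 1))
          (pow2 (2 * T)) (pow2 (2 * T)) ltac:(lin) ltac:(now right)). lin.
      * apply cnt_ext; auto. intros y _. split; intros (t & Ht & H).
        -- exists t. split; auto. lin.
        -- destruct (classic (t < s + 1)) as [L|L]; [eauto|]. assert (t = s + 1) by lin. subst t.
           exists s. split; [lin|]. unfold both in *. now rewrite Eu, Ev.
    + assert (L : cnt (fun y => exists t, t < s + 1 + 1 /\ both t y) S2 <=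
        cnt (fun y => exists t, t < s + 1 /\ both t y) S2 + cnt (both (s + 1)) S2).
      { eapply mle_trans; [|apply cnt_or; auto using dec_both]. apply cnt_le; auto.
        - unfold dec, both. defin.
        - intros y _ (t & Ht & H). destruct (classic (t < s + 1)) as [Lt|Lt]; [left; eauto|].
          right. replace (s + 1) with t by lin. auto. }
      assert (L1 := both_cnt (s + 1)).
      assert (L2 := mul_le _ _ (pow2 n * pow2 n) (pow2 n * pow2 n) L ltac:(now right)).
      (* At least one of the two counts of changes grows by one here. *)
      assert (L3 : 1 + cnt (fun t => ~ u t = u (t + 1)) s + cnt (fun t => ~ v t = v (t + 1)) s + 1 <=
        1 + cnt (fun t => ~ u t = u (t + 1)) (s + 1) + cnt (fun t => ~ v t = v (t + 1)) (s + 1)).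
      { destruct (classic (u s = u (s + 1))) as [Eu|Eu].
        - rewrite (cnt_yes (fun t => ~ v t = v (t + 1))) by tauto. lin.
        - rewrite (cnt_yes (fun t => ~ u t = u (t + 1))) by tauto. lin. }
      assert (L4 := mul_le _ _ (pow2 (2 * T)) (pow2 (2 * T)) L3 ltac:(now right)). lin.
Qed.
End Stage.
End Joint.

(** * The Martin-Löf test built from two failed Demuth tests *)

Lemma ev_mono b y z : mInitial y z -> mInitial (ev b y) (ev b z).
Proof.
  intros H p Hp. apply ev_code in Hp as (i & _ & x & _ & -> & E). apply ev_spec. auto.
Qed.

(** Extracts what the measure estimate uses: [g] is a [Z]-definable function whose changes up to any
    [s] number at most [c 2^n]. The bound follows by listing the changes below [s] in an injective
    sequence. *)
Lemma demuth_function Z c h g : mIsCPow2 c h -> mDemuth h g Z -> exists u : M -> M -> M,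
  F1 (only Z) (fun r => u (r 0%nat) (r 1%nat)) /\
  (forall n s v, mpr (mpr n s) v ∈ₘ g <-> v = u n s) /\
  (forall n s, changes (u n) s <= c * pow2 n).
Proof.
  intros [_ Hh] (_ & _ & [Fg HA] & [e He] & _).
  set (u := fun n s => epsilon (inhabits 0) (fun v => mpr (mpr n s) v ∈ₘ g)).
  assert (Hu : forall n s v, mpr (mpr n s) v ∈ₘ g <-> v = u n s).
  { intros n s v. destruct (proj2 Fg n s) as [w Hw].
    assert (E : mpr (mpr n s) (u n s) ∈ₘ g) by (apply epsilon_spec; exists w; now apply Hw).
    split; [|now intros ->]. intros Hv. apply Hw in Hv, E. congruence. }
  assert (Fu : F1 (only Z) (fun r => u (r 0%nat) (r 1%nat))).
  { apply F1_graph with (fun r v => mPhi Z e (mpr (r 0%nat) (r 1%nat)) v).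
    - intros r v. rewrite <- (He (r 0%nat) (r 1%nat) v). apply Hu.
    - apply S1_Phi; defin. }
  exists u. split; auto. split; auto. intros n s.
  assert (Fe := F1_mono _ every _ (fun _ _ => I) Fu).
  assert (HD : dec (fun t => ~ u n t = u n (t + 1))) by (unfold dec; defin).
  destruct (cnt_enum _ s HD) as (q & Hq & H1 & H2).
  apply (HA n (c * pow2 n)) with q; [now apply Hh, Pow2_iff|]. split; auto. split.
  - intros i x Hx (v & Hv & Hv'). apply Hu in Hv, Hv'.
    destruct (Elt_pair_lt _ _ _ Hx) as [L1 L2]. apply (proj1 (H1 i L1 x L2 Hx)). congruence.
  - intros i j x [Hi Hj]. destruct (Elt_pair_lt _ _ _ Hi), (Elt_pair_lt _ _ _ Hj). eauto.
Qed.

Definition agrees (s : M) (Y : SetM) : Prop := forall i x, mElt (mpr i x) s -> (x = 1 <-> i ∈ₘ Y).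

(** The final version captures [Y] through one string, in a member with some number [j]. The union
    of the members up to [j] is a small stage because the final set as a whole has measure at most
    [2^-n]. *)
Lemma failed_test Z h g Y (u : M -> M -> M) :
  (forall n s v, mpr (mpr n s) v ∈ₘ g <-> v = u n s) -> mDemuth h g Z -> ~ mWeaklyPasses Y g Z ->
  forall n, exists e s0 j C s, (forall t, s0 <= t -> u n t = e) /\ small_stage Z n e j C /\
    mElt s C /\ agrees s Y.
Proof.
  intros Hu (_ & _ & _ & _ & HL) HW n.
  destruct (HL n) as (e & [s0 Hs0] & F & _ & HF & HO & HM).
  assert (HIn : mInOpen Y (mPhi Z e)).
  { apply NNPP; intros N. apply HW. exists n, e. split; auto. now exists s0. }
  destruct HIn as (j & b & Hb & s & Hs & Ha).
  destruct (HM j) as (C & HC & HE & Hmu). exists e, s0, j, C, s. split; [|split; [|split; auto]].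
  - intros t Ht. symmetry. now apply Hu, Hs0.
  - assert (HB : forall i b s, mPhi Z e i b -> mElt s b -> exists l, mBinString s l).
    { intros i b' s' Hb' Hs'. apply (HO i b'); auto. now apply HF. }
    split; auto. split; [|split].
    + split; auto. intros s' Hs'. apply HE in Hs' as (i & b' & _ & Hb' & Hs'). apply HF in Hb'. eauto.
    (* Convergence at [i] comes from the total function that the test supplies. Its index is again
       [e], since both limits equal [u n (s0 + s1)]. *)
    + intros i Hi. destruct (HL n) as (e' & [s1 Hs1] & F' & HF' & HFe' & _).
      assert (e' = e) as ->.
      { transitivity (u n (s0 + s1)); [apply Hu, Hs1 | symmetry; apply Hu, Hs0]; lin. }
      destruct (proj2 HF' i) as [b' Hb'].
      assert (P : mPhi Z e i b') by now apply HFe', Hb'.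
      exists b'. split; auto. intros s' _ Hs'. apply HE. exists i, b'. split; [lin|]. split; auto. now apply HF.
    + intros s' _ Hs'. apply HE in Hs' as (i & b' & Hi & Hb' & Hs'). exists i. split; [lin|].
      exists b'. split; auto. now apply HF.
  - apply HE. exists j, b. split; [now right|]. split; auto. now apply HF.
Qed.

(** An initial segment of [X] that contains the positions [2 * i] and [2 * i + 1] for all [i] below
    [l0 + l1] has halves long enough to extend [s0] and [s1]. *)
Lemma prefix_exists X X0 X1 s0 s1 l0 l1 : (forall i, i ∈ₘ X0 <-> 2 * i ∈ₘ X) ->
  (forall i, i ∈ₘ X1 <-> 2 * i + 1 ∈ₘ X) -> mBinString s0 l0 -> mBinString s1 l1 ->
  agrees s0 X0 -> agrees s1 X1 ->
  exists r l, mBinString r l /\ agrees r X /\ mInitial s0 (ev 0 r) /\ mInitial s1 (ev 1 r).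
Proof.
  intros E0 E1 H0 H1 A0 A1. assert (HX : every X) by exact I.
  set (l := 2 * (l0 + l1) + 2).
  destruct (FinSeq_build every (fun q x => q < l /\ (q ∈ₘ X /\ x = 1 \/ ~ q ∈ₘ X /\ x = 0)) l 2)
    as (r & Hr & E).
  - defin.
  - intros q Hq. destruct (classic (q ∈ₘ X)); eauto.
  - intros q x y [_ [[? ->]|[? ->]]] [_ [[? ->]|[? ->]]]; easy.
  - intros q x [Hq [[_ ->]|[_ ->]]]; split; auto; lin.
  - assert (Ag : agrees r X).
    { intros q x Hx. apply E in Hx as [_ [[? ->]|[? ->]]]; split; intros; auto; [exfalso; lin | easy]. }
    assert (G : forall b s l' Y, b < 2 -> mBinString s l' -> l' <= l0 + l1 -> agrees s Y ->
      (forall i, i ∈ₘ Y <-> 2 * i + b ∈ₘ X) -> mInitial s (ev b r)).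
    { intros b s l' Y Hb [Hs Hs2] Hl As EY p Hp.
      destruct (FinSeq_pair _ _ _ Hs Hp) as (i & x & Hi & ->). apply ev_spec, E.
      split; [unfold l; lin|]. rewrite <- EY. assert (Hx := Hs2 _ _ Hp). assert (Ax := As _ _ Hp).
      destruct (zero_or_succ x) as [->|[x' ->]].
      - right. split; auto. intros N. apply Ax in N. lin.
      - left. assert (x' + 1 = 1) by lin. split; auto. now apply Ax. }
    exists r, l. split; [split; auto|split; [auto|split]].
    + intros q x Hx. apply E in Hx as [_ [[_ ->]|[_ ->]]]; lin.
    + apply (G 0 s0 l0 X0); auto; [lin | lin |]. intros i. rewrite E0. now rewrite madd_0.
    + apply (G 1 s1 l1 X1); auto; lin.
Qed.

(** Here [E] is [2^n] and [d] is the factor gained by the shift of the index. As [E] is at least 1,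
    the number [1 + a + b] of versions is at most [d * E]; cancelling [E] and then [d] leaves the
    bound. *)
Lemma final_bound N E k d c c' a b Q : E = k * d -> 0 < k -> 2 + c + c' <= d ->
  a <= c * E -> b <= c' * E -> N * (E * E) <= (1 + a + b) * Q -> N * k <= Q.
Proof.
  intros HE Hk Hd Ha Hb H. assert (Hd0 : 0 < d) by lin.
  assert (HE0 : 0 < E) by (rewrite HE; now apply mul_pos).
  assert (L0 : 1 <= E) by lin.
  assert (L1 := mul_le (2 + c + c') d E E Hd ltac:(now right)).
  assert (L2 : 1 + a + b <= d * E) by lin.
  assert (L3 := mul_le _ _ Q Q L2 ltac:(now right)).
  assert (L4 : N * E <= d * Q) by (apply (mul_cancel_le _ _ E); auto; lin).
  rewrite HE in L4. apply (mul_cancel_le _ _ d); auto. lin.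
Qed.

Lemma random_half X X0 X1 Z : (forall i, i ∈ₘ X0 <-> 2 * i ∈ₘ X) ->
  (forall i, i ∈ₘ X1 <-> 2 * i + 1 ∈ₘ X) -> mOneRandom X Z -> mBalanced X0 Z \/ mBalanced X1 Z.
Proof.
  intros E0 E1 HX. apply NNPP; intros N. apply not_or_and in N as [N0 N1].
  assert (exists c h g, mIsCPow2 c h /\ mDemuth h g Z /\ ~ mWeaklyPasses X0 g Z) as (c & h & g & Hh & Hg & F).
  { apply NNPP; intros N. apply N0. intros c h g [H1 H2]. apply NNPP; intros H3. apply N. now exists c, h, g. }
  assert (exists c h g, mIsCPow2 c h /\ mDemuth h g Z /\ ~ mWeaklyPasses X1 g Z) as (c' & h' & g' & Hh' & Hg' & F').
  { apply NNPP; intros N. apply N1. intros c' h' g' [H1 H2]. apply NNPP; intros H3. apply N. now exists c', h', g'. }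
  clear N0 N1.
  destruct (demuth_function Z c h g Hh Hg) as (u & Fu & Hu & Cu).
  destruct (demuth_function Z c' h' g' Hh' Hg') as (v & Fv & Hv & Cv).
  assert (Fail := failed_test Z h g X0 u Hu Hg F). assert (Fail' := failed_test Z h' g' X1 v Hv Hg' F').
  destruct (small_stage_approx Z) as (R & RD & RM & RS).
  (* Member [k] of the new test uses level [k + D] of the two old ones. Since [D + 1] is at most
     [2^D], this shift absorbs the factor [1 + c + c'] and leaves measure at most [2^-k]. *)
  set (D := 1 + c + c').
  (* The members of the test increase with [i], so that their finite unions are again members. *)
  set (V := fun k i r => r < i /\ ((exists l, l < i + 1 /\ mBinString r l) /\
    exists s, s < i /\ (caught R i (k + D) (u (k + D) s) (ev 0 r) /\ caught R i (k + D) (v (k + D) s) (ev 1 r)))).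
  assert (DV : D1 (only Z) (fun r => V (r 1%nat) (r 2%nat) (r 0%nat))).
  { assert (HC := fun f g h i => D1_caught Z R RD (only Z) f g h i (fun _ H => H)).
    unfold V. apply D1_and; [defin|]. apply D1_and; [defin|]. apply D1_bex; [defin|].
    apply D1_and; apply HC; defin. }
  assert (DV' : forall k i, dec (fun r => V k i r)).
  { intros k i. apply (D1_mono (only Z)); [easy|].
    apply (D1_app3 (only Z) (fun r k i => V k i r)); defin. }
  set (B := fun k i => code (V k i)).
  assert (FB : F1 (only Z) (fun r => B (r 0%nat) (r 1%nat))).
  { apply (F1_code (only Z) (fun r => V (r 0%nat) (r 1%nat)) (fun r => r 1%nat)); [|defin | exact DV].
    intros r x Hx. apply Hx. }
  assert (HB : forall k i, mFinSet (B k i) /\ forall r, mElt r (B k i) <-> V k i r).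
  { intros k i. apply (code_spec every _ i); [apply DV' | intros r Hr; apply Hr]. }
  assert (VM : forall k i i' r, i <= i' -> V k i r -> V k i' r).
  { intros k i i' r Hi (Hr & (l & Hl & Hs) & s & Hs' & H1 & H2).
    assert (CM : forall n e z, caught R i n e z -> caught R i' n e z).
    { intros n e z (j & Hj & C & HC & HR & Hc). exists j. split; [lin|]. exists C. split; [lin|].
      split; auto. eapply RM; eauto. }
    split; [lin|]. split; [exists l; split; [lin | auto]|]. exists s. split; [lin|]. auto. }
  destruct (graph2 (only Z) B FB) as (U & FU & EU).
  apply (HX U).
  - split; auto. split.
    + apply (computes2 Z U B EU).
      apply (F1_Cmp Z _ FB cd2 (fun p => fst p .: snd p .: fun _ => 0)). intros [|[|k]]; simpl.
      * apply (Cmp_fst Z _ (fun p => snd p)), Cmp_id.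
      * apply (Cmp_snd Z (fun p => fst p)), Cmp_id.
      * apply Cmp_const.
    + intros k. assert (SB : forall i, mStringSet (B k i)).
      { intros i. split; [apply HB|]. intros r Hr. apply HB in Hr as (_ & (l & _ & Hl) & _). eauto. }
      split; [intros i b Hb; apply EU in Hb as ->; apply SB|].
      intros m. exists (B k m). split; [apply HB|]. split.
      * intros r. split.
        -- intros Hr. exists m, (B k m). split; [now right|]. split; auto. now apply EU.
        -- intros (i & b & Hi & Hb & Hr). apply EU in Hb as ->. apply HB. apply HB in Hr. eauto.
      (* Counting takes place at length [2 * m], whose halves have length [m], the time bound up to
         which versions are observed in [B k m]. *)
      * destruct (string_bound m) as [S HS], (string_bound (2 * m)) as [S2 HS2].
        apply (MuLe_cov (2 * m) S2 HS2); auto.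
        { intros r l Hr Hl. apply HB in Hr as (Hr & _). assert (L := FinSeq_len _ _ (proj1 Hl)). lin. }
        set (n := k + D).
        assert (Fun : F1 every (fun r => u n (r 0%nat))).
        { apply (F1_mono (only Z)); [easy|]. defin. }
        assert (Fvn : F1 every (fun r => v n (r 0%nat))).
        { apply (F1_mono (only Z)); [easy|]. defin. }
        assert (W := versions_cnt Z R RD RS m S n HS S2 (u n) (v n) Fun Fvn m).
        (* If a member [r] of [B k m] is an initial segment of [y], the halves of [y] extend those
           of [r] and are caught by the same pair of versions. *)
        assert (L : cov (2 * m) S2 (B k m) <= cnt (fun y => exists t, t < m + 1 /\ both R m n (u n) (v n) t y) S2).
        { apply cnt_le; [unfold dec; defin; apply D1_covers; defin | | ].
          - unfold dec. apply (D1_bex every (fun _ => m + 1)); [defin|].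
            unfold both. apply D1_and; [defin|].
            apply D1_and; apply (D1_caught Z R RD every); try easy; defin.
          - intros y _ [Hy (r & _ & Hr & Hi)]. apply HB in Hr as (_ & _ & s & Hs & C0 & C1).
            exists s. split; [lin|]. split; auto.
            assert (CM : forall e b, caught R m n e (ev b r) -> caught R m n e (ev b y)).
            { intros e b (j & Hj & C & HC & HR & q & Hq & Eq & Iq). exists j. split; auto.
              exists C. split; auto. split; auto. exists q. split; auto. split; auto.
              intros p Hp. apply (ev_mono b r y Hi). auto. }
            split; auto. }
        apply (final_bound _ (pow2 n) (pow2 k) (pow2 D) c c' (changes (u n) m) (changes (v n) m)); auto.
        -- apply pow2_add.
        -- apply pow2_pos.
        -- assert (G := pow2_gt D). unfold D in *. lin.
        -- assert (L' := mul_le _ _ (pow2 n * pow2 n) (pow2 n * pow2 n) L ltac:(now right)). lin.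
  - intros k. set (n := k + D).
    destruct (Fail n) as (e & t0 & j & C & s & He & HS & Hs & As).
    destruct (Fail' n) as (e' & t1 & j' & C' & s' & He' & HS' & Hs' & As').
    destruct (proj2 (proj1 (proj1 HS)) s Hs) as [l Hl].
    destruct (proj2 (proj1 (proj1 HS')) s' Hs') as [l' Hl'].
    destruct (prefix_exists X X0 X1 s s' l l' E0 E1 Hl Hl' As As') as (r & lr & Hr & Ar & I0 & I1).
    apply RS in HS as [T HT], HS' as [T' HT'].
    set (i := T + T' + t0 + t1 + j + j' + C + C' + r + lr + 1).
    exists i, (B k i). split; [now apply EU|]. exists r. split; auto. apply HB.
    split; [unfold i; lin|]. split; [exists lr; split; [unfold i; lin | auto]|].
    exists (t0 + t1). split; [unfold i; lin|]. fold n.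
    rewrite (He (t0 + t1)), (He' (t0 + t1)) by lin. split.
    + exists j. split; [unfold i; lin|]. exists C. split; [unfold i; lin|].
      split; [apply (RM T); auto; unfold i; lin|]. exists s. split; [now apply Elt_lt | auto].
    + exists j'. split; [unfold i; lin|]. exists C'. split; [unfold i; lin|].
      split; [apply (RM T'); auto; unfold i; lin|]. exists s'. split; [now apply Elt_lt | auto].
Qed.

Lemma halves X : exists X0 X1, (forall i, i ∈ₘ X0 <-> 2 * i ∈ₘ X) /\ (forall i, i ∈ₘ X1 <-> 2 * i + 1 ∈ₘ X).
Proof.
  assert (HX : every X) by exact I.
  destruct (D1_comprehension every (fun i => 2 * i ∈ₘ X)) as [X0 H0]; [defin|].
  destruct (D1_comprehension every (fun i => 2 * i + 1 ∈ₘ X)) as [X1 H1]; [defin|].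
  now exists X0, X1.
Qed.

Lemma MLR_BR v w : sat struct v w MLR <-> sat struct v w BR.
Proof.
  rewrite sat_MLR, sat_BR. split; intros H Z; destruct (H Z) as [X HX].
  - destruct (halves X) as (X0 & X1 & E0 & E1). destruct (random_half X X0 X1 Z E0 E1 HX); eauto.
  - exists X. now apply balanced_random.
Qed.

End Model.

Theorem theorem6p3 : (RCA0 |-- fImp MLR BR) /\ (RCA0 |-- fIff MLR BR).
Proof.
  assert (H : forall (K : model) v w, sat struct v w (fIff MLR BR)) by
    (intros K v w; apply MLR_BR).
  split; apply RCA0_proves; try reflexivity; intros K v w; apply (H K).
Qed.
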